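(* Let $\beta\in(0,\tfrac13)$ be a constant. Let $\varphi_0\in L^1(\mathbb{R})$, $g_0\in L^2(\mathbb{R})$, and let $f_0\in L^2(\mathbb{R})$ be the exact solution of $$\int_{-\infty}^{\infty}\varphi_0(t-s)f_0(s)\,ds=g_0(t),\qquad t\in\mathbb{R}.$$ Put $$C_1=4\left(1+\|g_0\|_{L^2(\mathbb{R})}^2+\|\varphi_0\|_{L^1(\mathbb{R})}^2\right),\qquad C_2=1+\|g_0\|_{L^2(\mathbb{R})}^2 .$$ For small $\epsilon>0$ let $\varphi_\epsilon\in L^1(\mathbb{R})$ and $g_\epsilon\in L^2(\mathbb{R})$ satisfy $$\max\{\|\varphi_0-\varphi_\epsilon\|_{L^1(\mathbb{R})},\ \|g_0-g_\epsilon\|_{L^2(\mathbb{R})}\}\le\epsilon ,$$ let $\delta_\epsilon=\sqrt[4]{C_1/C_2}\;\epsilon^{(1+3\beta)/2}$, and let $f_\epsilon\in L^2(\mathbb{R})$ be the function whose Fourier transform is $$\widehat{f_\epsilon}=\frac{\widehat{g_\epsilon}\,\overline{\widehat{\varphi_\epsilon}}}{\delta_\epsilon+|\widehat{\varphi_\epsilon}|^2}.$$ Let $R_\epsilon>0$ be such that $\lim_{\epsilon\to0}R_\epsilon=\infty$. Then, for all sufficiently small $\epsilon>0$, $$\|f_0-f_\epsilon\|_{L^2(\mathbb{R})}^2\le 3\left[\int_{|\lambda|>R_\epsilon,\ |\widehat{\varphi_0}(\lambda)|<\epsilon^\beta}|\widehat{f_0}(\lambda)|^2\,d\lambda+\int_{|\lambda|<R_\epsilon,\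 |\widehat{\varphi_0}(\lambda)|<\epsilon^\beta}|\widehat{f_0}(\lambda)|^2\,d\lambda+2\sqrt{C_1C_2}\;\epsilon^{1-3\beta}\right].$$
   Context: The Fourier transform is normalized as $\widehat{h}(\lambda)=\int_{-\infty}^{\infty}h(x)e^{-i\lambda x}\,dx$ (extended to $L^2(\mathbb{R})$ in the usual way). *)

(* Defs.v *)
From HB Require Import structures.
From mathcomp Require Import all_boot all_order all_algebra.
From mathcomp Require Import all_classical all_reals all_analysis.
From mathcomp Require Import complex.

Set Implicit Arguments.
Unset Strict Implicit.
Unset Printing Implicit Defensive.

Import Order.TTheory GRing.Theory Num.Theory.
Import numFieldNormedType.Exports.
Import ComplexField.

Local Open Scope classical_set_scope.
Local Open Scope ring_scope.

(* Functions on the line are complex valued; real valued ones are the special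
   case [Im h = 0]. The modulus is [Normc.normc z : R] because [`|z|] lives in
   [R[i]]. *)

Section ComplexFourier.
Context {R : realType}.
Implicit Types (h H : R -> R[i]) (p : \bar R) (D : set R).

Local Notation mu := (@lebesgue_measure R).

Definition Cintegral D h : R[i] :=
  Complex (\int[mu]_(x in D) complex.Re (h x)) (\int[mu]_(x in D) complex.Im (h x)).

Definition CLnorm p h : \bar R := Lnorm mu p (fun x => (Normc.normc (h x))%:E).

Definition in_CLp p h : Prop :=
  [/\ measurable_fun setT (fun x => complex.Re (h x)),
      measurable_fun setT (fun x => complex.Im (h x))
    & (CLnorm p h < +oo)%E].

Definition convolution (phi f : R -> R[i]) (t : R) : R[i] :=
  Cintegral setT (fun s => phi (t - s) * f s).

(* [Complex (cos (l * x)) (- sin (l * x))] is e^{-i l x}. *)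
Definition fourier_on D h (l : R) : R[i] :=
  Cintegral D (fun x => h x * Complex (cos (l * x)) (- sin (l * x))).

Definition fourier h : R -> R[i] := fourier_on setT h.

(* [H] is a representative of the Fourier-Plancherel transform of [h]: the L^2
   limit of the transforms of the truncations of [h] to [-n, n], which belong
   to both L^1 and L^2 when [h] is in L^2. *)
Definition is_fourierL2 h H : Prop :=
  in_CLp 2%:E H /\
  CLnorm 2%:E (fun l => H l - fourier_on `[- n%:R, n%:R] h l) @[n --> \oo]
    --> 0%E.

(* For [h] in L^2 a representative exists and is unique up to a null set
   (Plancherel); the zero function is only a default for other [h]. *)
Definition fourierL2 h : R -> R[i] :=
  xget (fun=> 0) [set H | is_fourierL2 h H].

End ComplexFourier.

(* Main.v *)
Require Import Defs.
From HB Require Import structures.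
From mathcomp Require Import all_boot all_order all_algebra finmap.
From mathcomp Require Import all_classical all_reals all_analysis.
From mathcomp Require Import measurable_realfun complex.
From mathcomp Require Import ring lra.

(**
Write [F0], [G0], [P0] for the transforms of [f0], [g0], [phi0], and [F], [G],
[P] for those of the perturbed data. The convolution theorem turns the equation
into [G0 = P0 * F0], and the regularized solution is [F = G * conj P / D] with
[D = delta + |P|^2]. Then
[F0 - F = (delta * F0 - (P0 - P) * F0 * conj P + (P0 * F0 - G) * conj P) / D]
splits the error into a bias, an error in the kernel and an error in the data.
The last one is at most [|G0 - G| / (2 sqrt delta)], because
[|P| / D <= 1 / (2 sqrt delta)]. Where
[|P0|] is below the threshold [e^beta] the first two are at most a constant times
[|F0|], which gives the two integrals of the bound; where [|P0| >= e^beta] they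
are at most powers of [e] times [|P0 * F0| = |G0|], whose norm is known
([normc_tikhonov_le], [tikhonov_pointwise]). The choice of [delta] makes
everything that remains of order [e^(1 - 3 beta)] ([tikhonov_parameters]), and
integrating over the line gives [energy_tikhonov_le].

With the unnormalized transform, Plancherel's identity multiplies squared norms
by [2 pi]. The two integrals of the bound are taken over the frequencies, and do
not carry that factor; this slack absorbs the numerical constants of the
pointwise estimate.

Two facts about the transform are needed: Plancherel's identity on L2 and the
convolution theorem for a product of an L1 and an L2 function.

Plancherel's identity is first proved for real [a] in L1 and L2, without
inverting the transform. Damping by [exp (- e |l|)], whose transform is the
Poisson kernel, legitimates Fubini's theorem; Schur's test and monotone
convergence as [e] tends to 0 give the inequality [bessel]. The defect of this
inequality is a bounded nonnegative quadratic form, so the functions of defect 0 form a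
vector space that is closed under L2 limits. It contains the indicators of
intervals, by an explicit computation with the arctangent
([exact_energy_itv]), hence the indicators of bounded Borel sets by Dynkin's
lemma, hence everything ([trig_plancherel]). Complex functions follow by
averaging over [l] and [- l] ([plancherel_L1L2]), and completeness of L2
([cL2_complete]) extends the transform and its identity to L2
([ex_fourierL2], [is_fourierL2_nrm]).

The convolution theorem is Fubini's theorem for bounded integrable functions
([fourier_convolution]). Young's inequality for L1 and L2
([integral_conv_sqr_le]) makes both sides continuous in the second factor for
the L2 norm, so the identity passes to all of L2 ([fourierL2_convolution]).
*)

Set Implicit Arguments.
Unset Strict Implicit.
Unset Printing Implicit Defensive.

Import Order.TTheory GRing.Theory Num.Theory.
Import numFieldNormedType.Exports.
Import ComplexField.

Local Open Scope classical_set_scope.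
Local Open Scope ring_scope.

(** * Reflections of the line and iterated integrals *)

Section generalities.
Context {R : realType}.
Local Notation mu := (@lebesgue_measure R).

(** Reflection maps an interval to one of the same length, and Lebesgue measure
    is determined by its values on half-open intervals. *)
Lemma lebesgue_measure_reflect (c : R) (A : set (measurableTypeR R)) : measurable A ->
  mu A = pushforward mu (fun x : R => c - x) A.
Proof.
have mf : measurable_fun (setT : set (measurableTypeR R)) (fun x : R => c - x : measurableTypeR R).
  by apply: measurable_funD => //; exact: measurable_funN.
pose m' : {measure set (measurableTypeR R) -> \bar R} :=
  measure_function_pushforward__canonical__measure_function_Measure mu mf.
move: A; apply: (@lebesgue_measure_unique R m') => X [[a b] _ <-].
rewrite /m' /= /pushforward.
rewrite (_ : _ @^-1` _ = `[c - b, c - a[%classic); last first.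
  by apply/seteqP; split => x /=; rewrite !in_itv/= => /andP[? ?]; apply/andP; split; lra.
rewrite !lebesgue_measure_itv/= !lte_fin ltrD2l ltrN2.
by case: ifP => // _; congr EFin; lra.
Qed.

Lemma measurable_reflect (c : R) : measurable_fun setT (fun x : R => c - x).
Proof. by apply: measurable_funD => //; exact: measurable_funN. Qed.

Lemma ge0_integral_reflect (c : R) (f : R -> \bar R) :
  measurable_fun setT f -> (forall x, 0 <= f x)%E ->
  (\int[mu]_x f (c - x)%R = \int[mu]_x f x)%E.
Proof.
move=> mf f0.
have mr : measurable_fun (setT : set (measurableTypeR R)) (fun x : R => c - x : measurableTypeR R).
  exact: measurable_reflect.
pose m' : {measure set (measurableTypeR R) -> \bar R} :=
  measure_function_pushforward__canonical__measure_function_Measure mu mr.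
have h := @ge0_integral_pushforward _ _ _ _ R _ mr mu setT f measurableT mf (fun y _ => f0 y).
rewrite preimage_setT in h; rewrite -[LHS]h.
by apply: (@eq_measure_integral _ _ R setT mu m' f) => A mA _; exact/esym/lebesgue_measure_reflect.
Qed.

Lemma integral_reflect (c : R) (f : R -> \bar R) :
  measurable_fun setT f -> (\int[mu]_x f (c - x)%R = \int[mu]_x f x)%E.
Proof.
move=> mf; rewrite integralE [in RHS]integralE.
congr (_ - _)%E.
  rewrite -(@ge0_integral_reflect c (f^\+)%E)//; last exact: measurable_funepos.
  by apply: eq_integral => x _; rewrite !funeposE.
rewrite -(@ge0_integral_reflect c (f^\-)%E)//; last exact: measurable_funeneg.
by apply: eq_integral => x _; rewrite !funenegE.
Qed.

Lemma ge0_integral_shift (c : R) (f : R -> \bar R) :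
  measurable_fun setT f -> (forall x, 0 <= f x)%E ->
  (\int[mu]_x f (x - c)%R = \int[mu]_x f x)%E.
Proof.
move=> mf f0.
rewrite -(@ge0_integral_reflect 0 f)// -(@ge0_integral_reflect c (fun x => f (0 - x)%R))//.
  by apply: eq_integral => x _; rewrite sub0r opprB.
exact: (measurableT_comp mf (measurable_reflect 0)).
Qed.

(** At the points [x], forming a null set, where the section of [F] is not
    integrable, the real-valued inner integral is a default value. The identity
    therefore needs the outer integral. *)
Lemma ae_Rintegral1 (F : R -> R -> R) :
  (mu \x mu)%E.-integrable setT (fun z => (F z.1 z.2)%:E) ->
  (\int[mu]_x (\int[mu]_y F x y)%:E = \int[mu]_x \int[mu]_y (F x y)%:E)%E.
Proof.
move=> iF; apply: ae_eq_integral => //.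
- apply/measurable_EFinP; apply: measurableT_comp => //.
  exact: (measurable_fubini_F iF).
- exact: (measurable_fubini_F iF).
- have := ae_integrable1 iF; apply: filterS => x iFx _.
  by rewrite fineK//; apply: integrable_fin_num.
Qed.

Lemma ae_Rintegral2 (F : R -> R -> R) :
  (mu \x mu)%E.-integrable setT (fun z => (F z.1 z.2)%:E) ->
  (\int[mu]_y (\int[mu]_x F x y)%:E = \int[mu]_y \int[mu]_x (F x y)%:E)%E.
Proof.
move=> iF; apply: ae_eq_integral => //.
- apply/measurable_EFinP; apply: measurableT_comp => //.
  exact: (measurable_fubini_G iF).
- exact: (measurable_fubini_G iF).
- have := ae_integrable2 iF; apply: filterS => x iFx _.
  by rewrite fineK//; apply: integrable_fin_num.
Qed.

Lemma Rintegral_fubini (F : R -> R -> R) :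
  (mu \x mu)%E.-integrable setT (fun z => (F z.1 z.2)%:E) ->
  \int[mu]_x \int[mu]_y F x y = \int[mu]_y \int[mu]_x F x y.
Proof.
move=> iF; congr fine; rewrite ae_Rintegral1// ae_Rintegral2//.
exact: (Fubini iF).
Qed.

(** Every double integral in the computation of the damped energy has a majorant
    of this form, because the trigonometric factors are bounded. *)
Lemma integrable_prod_dominated (F : R -> R -> R) (u v : R -> R) :
  measurable_fun setT (fun z : R * R => F z.1 z.2) ->
  mu.-integrable setT (EFin \o u) -> mu.-integrable setT (EFin \o v) ->
  (forall x y, `|F x y| <= `|u x| * `|v y|) ->
  (mu \x mu)%E.-integrable setT (fun z => (F z.1 z.2)%:E).
Proof.
move=> mF iu iv Fuv.
have /integrableP[/measurable_EFinP mu' u_oo] := iu.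
have /integrableP[/measurable_EFinP mv v_oo] := iv.
have mF' : measurable_fun setT (fun z : R * R => (F z.1 z.2)%:E).
  exact/measurable_EFinP.
apply/integrable12ltyP => //=.
apply: (@le_lt_trans _ _ (\int[mu]_x (`|u x|%:E * \int[mu]_y `|v y|%:E))%E).
  apply: ge0_le_integral => //.
  - by move=> x _; apply: integral_ge0 => y _; rewrite lee_fin.
  - apply: (@measurable_fun_fubini_tonelli_F _ _ _ _ _ mu (fun z => `|F z.1 z.2|%:E)) => //=.
    by apply/measurable_EFinP; exact: measurableT_comp.
  - by apply: emeasurable_funM => //; apply/measurable_EFinP; exact: measurableT_comp.
  - move=> x _; rewrite -ge0_integralZl//; last first.
      by apply/measurable_EFinP; exact: measurableT_comp.
    apply: ge0_le_integral => //.
    + apply/measurable_EFinP; apply: measurableT_comp => //.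
      exact: (measurableT_comp mF (measurable_pair1 x)).
    + by apply/measurable_EFinP; apply: measurable_funM => //; exact: measurableT_comp.
    + by move=> y _; rewrite -EFinM lee_fin.
rewrite ge0_integralZr//; last 2 first.
- by apply/measurable_EFinP; exact: measurableT_comp.
- by apply: integral_ge0 => y _; rewrite lee_fin.
by apply: lte_mul_pinfty => //; [apply: integral_ge0 => x _; rewrite lee_fin|rewrite ge0_fin_numE//; apply: integral_ge0 => x _; rewrite lee_fin].
Qed.

End generalities.

(** * The Poisson kernel *)

Section poisson.
Context {R : realType}.
Local Notation mu := (@lebesgue_measure R).
Implicit Types (f g F : R -> R) (e u x p q l : R).

Lemma is_derive_mul f g (x df dg : R) :
  is_derive x 1 f df -> is_derive x 1 g dg ->
  is_derive x 1 (fun y => f y * g y) (df * g x + f x * dg).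
Proof.
move=> hf hg. have h := is_deriveM hf hg.
apply: (is_derive_eq h).
rewrite /GRing.scale /=; ring.
Qed.

Lemma is_derive_add f g (x df dg : R) :
  is_derive x 1 f df -> is_derive x 1 g dg ->
  is_derive x 1 (fun y => f y + g y) (df + dg).
Proof. by move=> hf hg; exact: is_deriveD. Qed.

Lemma is_derive_scale f (c x df : R) :
  is_derive x 1 f df -> is_derive x 1 (fun y => c * f y) (c * df).
Proof. by move=> hf; exact: (is_deriveZ c hf). Qed.

Lemma is_derive_chain f g (x df dg : R) :
  is_derive (g x) 1 f df -> is_derive x 1 g dg ->
  is_derive x 1 (fun y => f (g y)) (df * dg).
Proof. by move=> hf hg; exact: (is_derive1_comp hf hg). Qed.

Lemma is_derive_continuous f (df : R -> R) : (forall x : R, is_derive x 1 f (df x)) -> continuous f.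
Proof.
move=> hf x; apply: differentiable_continuous; apply/derivable1_diffP.
by have [] := hf x.
Qed.

Lemma integral_derive f F (p q : R) : p <= q -> continuous f ->
  (forall x : R, is_derive x 1 F (f x)) ->
  (\int[mu]_(x in `[p, q]) (f x)%:E = (F q - F p)%:E)%E.
Proof.
rewrite le_eqVlt => /predU1P[-> _ _|pq cf dF].
  by rewrite set_itv1 integral_set1 subrr.
have cF := is_derive_continuous dF.
rewrite EFinB; apply: continuous_FTC2 => //.
- exact: continuous_subspaceT.
- split.
  + by move=> x _; have [] := dF x.
  + exact/cvg_at_right_filter/cF.
  + exact/cvg_at_left_filter/cF.
- by move=> x _; rewrite derive1E; have [_ ->] := dF x.
Qed.

(** An antiderivative is required on the positive half-line only: the integrands
    of interest contain an absolute value, and have no common formula on the two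
    sides. *)
Lemma integralT_even_derive f F (l : R) : (forall x, 0 <= f x) -> continuous f ->
  (forall x, f (- x) = f x) ->
  (forall x : R, 0 < x -> is_derive x 1 F (f x)) -> F x @[x --> 0^'+] --> F 0 ->
  F x @[x --> +oo] --> l ->
  (\int[mu]_x (f x)%:E = (2 * (l - F 0))%:E)%E.
Proof.
move=> f0 cf ef dF cF Fl.
rewrite ge0_symfun_integralT//.
rewrite (_ : [set x | _] = `[0, +oo[%classic); last first.
  by apply/seteqP; split => x/=; rewrite in_itv/= andbT.
rewrite (@ge0_continuous_FTC2y _ f F 0 l)//.
- exact: continuous_subspaceT.
- by move=> x x0; have [] := dF x x0.
- by move=> x; rewrite in_itv/= andbT => x0; rewrite derive1E; have [_ ->] := dF x x0.
by move=> x /=; rewrite ef.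
Qed.

(** The transform of [exp (- e |l|)]. It is [2 * pi] times the Poisson kernel of
    the upper half-plane at height [e], whence the total mass [2 * pi]. *)
Definition poisson (e u : R) := 2 * e / (e ^+ 2 + u ^+ 2).

Lemma poisson_den_gt0 (e u : R) : 0 < e -> 0 < e ^+ 2 + u ^+ 2.
Proof. by move=> e0; rewrite ltr_pwDl ?exprn_gt0// sqr_ge0. Qed.

Lemma poisson_ge0 e u : 0 < e -> 0 <= poisson e u.
Proof.
by move=> e0; rewrite /poisson divr_ge0 ?mulr_ge0// ltW// poisson_den_gt0.
Qed.

Lemma poissonN e u : poisson e (- u) = poisson e u.
Proof. by rewrite /poisson sqrrN. Qed.

Lemma is_derive_poisson e (x u : R) : 0 < e ->
  is_derive u 1 (fun y => 2 * atan ((y - x) / e)) (poisson e (x - u)).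
Proof.
move=> e0.
have h : is_derive u 1 (fun y => (y - x) / e) (e^-1).
  have -> : (fun y => (y - x) / e) = (fun y => e^-1 * (y + - x)).
    by apply/funext => y; rewrite mulrC.
  rewrite -[X in is_derive _ _ _ X]mulr1; apply: is_derive_scale.
  rewrite -[X in is_derive _ _ _ X]addr0.
  by apply: is_derive_add.
have -> : poisson e (x - u) = 2 * ((1 + ((u - x) / e) ^+ 2)^-1 * e^-1).
  rewrite -poissonN opprB /poisson.
  have := poisson_den_gt0 (u - x) e0; move: (u - x) => v v0.
  by field; rewrite !gt_eqF//= mulrC divfK ?gt_eqF// expr2.
by apply: is_derive_scale; apply: is_derive_chain.
Qed.

Lemma continuous_poisson e : 0 < e -> continuous (poisson e).
Proof.
move=> e0 u; apply: cvgM; first exact: cvg_cst.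
apply: cvgV; first by rewrite gt_eqF// poisson_den_gt0.
apply: cvgD; first exact: cvg_cst.
exact: exprn_continuous.
Qed.

Lemma integral_poisson e : 0 < e -> (\int[mu]_u (poisson e u)%:E = (2 * pi)%:E)%E.
Proof.
move=> e0.
have dF (x : R) : 0 < x -> is_derive x 1 (fun y => 2 * atan ((y - 0) / e)) (poisson e x).
  by move=> _; have := is_derive_poisson 0 x e0; rewrite sub0r poissonN.
rewrite (integralT_even_derive (l := pi) (fun u => poisson_ge0 u e0) (continuous_poisson e0) (poissonN e) dF).
- by rewrite subr0 mul0r atan0 mulr0 subr0.
- apply: cvg_at_right_filter.
  exact: (is_derive_continuous (fun x => is_derive_poisson 0 x e0)).
- have h : (fun y => (y - 0) / e) x @[x --> +oo] --> +oo.
    apply/cvgryPge => A; apply: filterS (nbhs_pinfty_ge (num_real (A * e))) => y.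
    by rewrite subr0 ler_pdivlMr.
  rewrite [X in _ --> X](_ : pi = 2 * (pi / 2)); last by rewrite mulrC divfK.
  by apply: cvgMr; exact: (cvg_comp _ _ h (@cvgy_atan R)).
Qed.

Lemma integral_itv_poisson e (x p q : R) : 0 < e -> p <= q ->
  (\int[mu]_(y in `[p, q]) (poisson e (x - y))%:E =
   (2 * atan ((q - x) / e) + 2 * atan ((x - p) / e))%:E)%E.
Proof.
move=> e0 pq.
have cp : continuous (fun y => poisson e (x - y)).
  move=> u; apply: (@continuous_comp _ _ _ (fun y => x - y) (poisson e)).
    by apply: cvgB; [exact: cvg_cst|exact: cvg_id].
  exact: continuous_poisson.
rewrite (integral_derive pq cp (fun u => is_derive_poisson x u e0)).
by rewrite -mulrN -atanN -mulNr opprB.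
Qed.

(** Adding 1 to the cosine makes the integrand nonnegative, so that the integral
    over the line is a limit of integrals over intervals. The case [u = 0] gives
    the integral of the factor [exp (- e |l|)] alone, which is then subtracted
    in [Rintegral_damp_cos]. *)
Lemma integral_exp_cos1 (e u : R) : 0 < e ->
  (\int[mu]_l (expR (- e * `|l|) * (1 + cos (l * u)))%:E = (2 / e + poisson e u)%:E)%E.
Proof.
move=> e0; have d0 := poisson_den_gt0 u e0.
(* Two integrations by parts give this antiderivative, as [exp (- e l) * G l]. *)
pose G (l : R) := (- e^-1 + (e ^+ 2 + u ^+ 2)^-1 * (u * sin (u * l) + (- e) * cos (u * l))).
have dc (c l : R) : is_derive l 1 (fun y => c * y) c.
  by rewrite -[X in is_derive _ _ _ X]mulr1; apply: is_derive_scale.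
have dF l : is_derive l 1 (fun l => expR (- e * l) * G l) (expR (- e * l) * (1 + cos (l * u))).
  have -> : expR (- e * l) * (1 + cos (l * u)) = (expR (- e * l) * - e) * G l +
     expR (- e * l) * (0 + (e ^+ 2 + u ^+ 2)^-1 * (u * (cos (u * l) * u) + (- e) * (- sin (u * l) * u))).
    rewrite /G (mulrC l).
    by field; rewrite !gt_eqF.
  exact: is_derive_mul.
have f0 l : 0 <= expR (- e * `|l|) * (1 + cos (l * u)).
  by rewrite mulr_ge0 ?expR_ge0// -lerBlDl sub0r cos_geN1.
have fe l : expR (- e * `|- l|) * (1 + cos (- l * u)) = expR (- e * `|l|) * (1 + cos (l * u)).
  by rewrite normrN (mulNr l) cosN.
have cf : continuous (fun l => expR (- e * `|l|) * (1 + cos (l * u))).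
  move=> l; apply: cvgM.
    apply: (@continuous_comp _ _ _ (fun l => - e * `|l|) expR); last exact: continuous_expR.
    by apply: cvgMr; exact: norm_continuous.
  apply: cvgD; first exact: cvg_cst.
  apply: (@continuous_comp _ _ _ (fun l => l * u) cos); last exact: continuous_cos.
  by apply: cvgMl; exact: cvg_id.
have dF' (l : R) : 0 < l -> is_derive l 1 (fun l => expR (- e * l) * G l) (expR (- e * `|l|) * (1 + cos (l * u))).
  by move=> l0; rewrite gtr0_norm.
rewrite (integralT_even_derive (l := 0) f0 cf fe dF').
- rewrite /G !mulr0 sin0 cos0 mulr0 expR0 /poisson; congr EFin.
  by field; rewrite !gt_eqF.
- by apply: cvg_at_right_filter; exact: (is_derive_continuous dF).
(* [G] is bounded, so [exp (- e l) * G l] vanishes at infinity. *)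
- apply/cvgrPdist_le => /= d dd0.
  pose M := e^-1 + (e ^+ 2 + u ^+ 2)^-1 * (`|u| + e).
  have M0 : 0 < M.
    rewrite /M ltr_pwDl ?invr_gt0// mulr_ge0//; first by rewrite invr_ge0 ltW.
    by rewrite addr_ge0// ltW.
  have GM l : `|G l| <= M.
    apply: (le_trans (ler_normD _ _)); rewrite normrN gtr0_norm ?invr_gt0// lerD2l.
    rewrite normrM gtr0_norm ?invr_gt0// ler_pM2l ?invr_gt0//.
    apply: (le_trans (ler_normD _ _)); rewrite !normrM normrN (gtr0_norm e0).
    by apply: lerD; apply: ler_piMr; rewrite ?normr_ge0 ?(ltW e0)// ler_norml ?sin_geN1 ?sin_le1 ?cos_geN1 ?cos_le1.
  have : expR (- e * l) @[l --> +oo] --> 0.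
    rewrite (_ : (fun l => _) = (fun y => expR (- y)) \o (fun l => e * l)); last first.
      by apply/funext => y /=; rewrite mulNr.
    apply: cvg_comp; last exact: cvgr_expR.
    apply/cvgryPge => A; apply: filterS (nbhs_pinfty_ge (num_real (e^-1 * A))) => y.
    by rewrite ler_pdivrMl.
  move/cvgrPdist_le => /(_ (d / M)); rewrite divr_gt0// => /(_ isT).
  apply: filterS => l; rewrite !sub0r !normrN normrM => h.
  by rewrite (le_trans (ler_pM _ _ h (GM l)))// divfK// gt_eqF.
Qed.

Definition damp e l := expR (- e * `|l|).

Lemma damp_ge0 e l : 0 <= damp e l. Proof. exact: expR_ge0. Qed.

Lemma measurable_damp e : measurable_fun setT (damp e).
Proof.
apply: measurableT_comp; first exact: measurable_expR.
by apply: measurable_funM => //; exact: normr_measurable.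
Qed.

Lemma measurable_cosM u : measurable_fun setT (fun l => cos (l * u)).
Proof.
apply: (measurableT_comp (f := cos)); first by apply: continuous_measurable_fun; exact: continuous_cos.
by apply: measurable_funM.
Qed.

Lemma integrable_damp e : 0 < e -> mu.-integrable setT (EFin \o damp e).
Proof.
move=> e0; apply/integrableP; split.
  by apply/measurable_EFinP; exact: measurable_damp.
apply: (@le_lt_trans _ _ (2 / e + poisson e 0)%:E); last exact: ltry.
rewrite -integral_exp_cos1//; apply: ge0_le_integral => //=.
- by apply/measurable_EFinP; apply: measurableT_comp => //; exact: measurable_damp.
- by apply/measurable_EFinP; apply: measurable_funM; [exact: measurable_damp|apply: measurable_funD => //; exact: measurable_cosM].
- by move=> x _; rewrite mulr0 cos0 ger0_norm ?damp_ge0// lee_fin -/(damp e x) ler_peMr ?damp_ge0// lerDl.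
Qed.

Lemma integrable_mul_bounded (a m : R -> R) (M : R) :
  mu.-integrable setT (EFin \o a) -> measurable_fun setT m ->
  (forall x, `|m x| <= M) -> mu.-integrable setT (fun x => (a x * m x)%:E).
Proof.
move=> ia mm mM.
have /integrableP[/measurable_EFinP ma _] := ia.
apply: (@le_integrable _ _ _ mu _ measurableT _ (fun x => (M * a x)%:E)).
- by apply/measurable_EFinP; exact: measurable_funM.
- move=> x _ /=; rewrite lee_fin !normrM mulrC ler_wpM2r//.
  by rewrite (le_trans (mM x))// ler_norm.
- by have := integrableZl measurableT M ia.
Qed.

Lemma norm_cos_le1 x : `|cos x| <= 1.
Proof. by rewrite ler_norml cos_geN1 cos_le1. Qed.

Lemma norm_sin_le1 x : `|sin x| <= 1.
Proof. by rewrite ler_norml sin_geN1 sin_le1. Qed.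

Lemma Rintegral_damp_cos e u : 0 < e ->
  \int[mu]_l (damp e l * cos (l * u)) = poisson e u.
Proof.
move=> e0.
have id := integrable_damp e0.
have ic v : mu.-integrable setT (fun l => (damp e l * cos (l * v))%:E).
  apply: integrable_mul_bounded => //; [exact: measurable_cosM|move=> x; exact: norm_cos_le1].
have H v : \int[mu]_l damp e l + \int[mu]_l (damp e l * cos (l * v)) = 2 / e + poisson e v.
  rewrite -RintegralD//; last exact: ic.
  rewrite /Rintegral; under eq_integral do rewrite -{1}[damp e _]mulr1 -mulrDr.
  by rewrite integral_exp_cos1.
have := H 0; under [X in _ + X]eq_Rintegral do rewrite mulr0 cos0 mulr1.
have -> : poisson e 0 = 2 / e by rewrite /poisson expr0n/= addr0; field; rewrite gt_eqF.
move: (H u); move: (\int[mu]_l damp e l) (\int[mu]_l (damp e l * cos (l * u))).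
by move=> A B; lra.
Qed.

End poisson.

(** * Cosine and sine transforms *)

Section trig.
Context {R : realType}.
Local Notation mu := (@lebesgue_measure R).
Implicit Types (a b : R -> R) (e l x y : R).

Definition costr a l := \int[mu]_x (a x * cos (l * x)).
Definition sintr a l := \int[mu]_x (a x * sin (l * x)).

Lemma continuous_Rintegral_mul a (m : R -> R -> R) :
  mu.-integrable setT (EFin \o a) ->
  (forall l, measurable_fun setT (m l)) -> (forall l x, `|m l x| <= 1) ->
  (forall x, continuous (m ^~ x)) ->
  continuous (fun l => \int[mu]_x (a x * m l x)).
Proof.
move=> ia mm m1 cm l.
have /integrableP[/measurable_EFinP ma _] := ia.
apply: (@continuity_under_integral _ _ _ mu (fun l x => a x * m l x) setT measurableT (l - 1) (l + 1) _ _ (fun x => `|a x|)).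
- by move=> z _; apply: (integrable_mul_bounded ia (mm z) (m1 z)).
- by apply: nearW => y _ z _; apply: cvgM; [exact: cvg_cst|exact: cm].
- exact: integrable_norm.
- by move=> z _; apply: nearW => y _; rewrite normrM ler_piMr.
- by rewrite inE/= in_itv/=; apply/andP; split; lra.
Qed.

Lemma measurable_cosMl l : measurable_fun setT (fun x => cos (l * x)).
Proof.
apply: (measurableT_comp (f := cos)); first by apply: continuous_measurable_fun; exact: continuous_cos.
by apply: measurable_funM.
Qed.

Lemma measurable_sinMl l : measurable_fun setT (fun x => sin (l * x)).
Proof.
apply: (measurableT_comp (f := sin)); first by apply: continuous_measurable_fun; exact: continuous_sin.
by apply: measurable_funM.
Qed.

Lemma integrable_cosM a l : mu.-integrable setT (EFin \o a) ->
  mu.-integrable setT (fun x => (a x * cos (l * x))%:E).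
Proof.
by move=> ia; apply: (integrable_mul_bounded ia (measurable_cosMl l)) => x; exact: norm_cos_le1.
Qed.

Lemma integrable_sinM a l : mu.-integrable setT (EFin \o a) ->
  mu.-integrable setT (fun x => (a x * sin (l * x))%:E).
Proof.
by move=> ia; apply: (integrable_mul_bounded ia (measurable_sinMl l)) => x; exact: norm_sin_le1.
Qed.

Lemma continuous_costr a : mu.-integrable setT (EFin \o a) -> continuous (costr a).
Proof.
move=> ia; apply: (continuous_Rintegral_mul (m := fun l x => cos (l * x)) ia).
- exact: measurable_cosMl.
- by move=> l x; exact: norm_cos_le1.
- move=> x l; apply: (@continuous_comp _ _ _ (fun l => l * x) cos); last exact: continuous_cos.
  by apply: cvgMl; exact: cvg_id.
Qed.

Lemma continuous_sintr a : mu.-integrable setT (EFin \o a) -> continuous (sintr a).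
Proof.
move=> ia; apply: (continuous_Rintegral_mul (m := fun l x => sin (l * x)) ia).
- exact: measurable_sinMl.
- by move=> l x; exact: norm_sin_le1.
- move=> x l; apply: (@continuous_comp _ _ _ (fun l => l * x) sin); last exact: continuous_sin.
  by apply: cvgMl; exact: cvg_id.
Qed.

Lemma norm_Rintegral_mul_le a (m : R -> R) : mu.-integrable setT (EFin \o a) ->
  measurable_fun setT m -> (forall x, `|m x| <= 1) ->
  `|\int[mu]_x (a x * m x)| <= \int[mu]_x `|a x|.
Proof.
move=> ia mm m1; have iam := integrable_mul_bounded ia mm m1.
apply: (le_trans (le_normr_Rintegral measurableT iam)).
apply: le_Rintegral => //; [exact: integrable_norm iam|exact: integrable_norm ia|].
by move=> x _; rewrite normrM ler_piMr.
Qed.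

Lemma norm_costr_le a l : mu.-integrable setT (EFin \o a) ->
  `|costr a l| <= \int[mu]_x `|a x|.
Proof.
move=> ia; apply: norm_Rintegral_mul_le => //; first exact: measurable_cosMl.
by move=> x; exact: norm_cos_le1.
Qed.

Lemma norm_sintr_le a l : mu.-integrable setT (EFin \o a) ->
  `|sintr a l| <= \int[mu]_x `|a x|.
Proof.
move=> ia; apply: norm_Rintegral_mul_le => //; first exact: measurable_sinMl.
by move=> x; exact: norm_sin_le1.
Qed.

(** For real [a] the Fourier transform is [costr a - i * sintr a]; this is its
    squared modulus. *)
Definition trpower a l := costr a l ^+ 2 + sintr a l ^+ 2.

Lemma trpower_ge0 a l : 0 <= trpower a l.
Proof. by rewrite addr_ge0// sqr_ge0. Qed.

Lemma continuous_trpower a : mu.-integrable setT (EFin \o a) -> continuous (trpower a).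
Proof.
move=> ia l; rewrite /trpower; apply: cvgD.
  by apply: (@continuous_comp _ _ _ (costr a) (fun x => x ^+ 2)); [exact: continuous_costr|exact: exprn_continuous].
by apply: (@continuous_comp _ _ _ (sintr a) (fun x => x ^+ 2)); [exact: continuous_sintr|exact: exprn_continuous].
Qed.

(** The addition formula for the cosine; the left-hand side is the real part of
    the transform of [a] at [l] times [exp (i l x)]. *)
Lemma trkernelE a l x : mu.-integrable setT (EFin \o a) ->
  costr a l * cos (l * x) + sintr a l * sin (l * x) = \int[mu]_y (a y * cos (l * (x - y))).
Proof.
move=> ia.
rewrite -!RintegralZr//; [|exact: integrable_sinM|exact: integrable_cosM].
rewrite -RintegralD//.
- apply: eq_Rintegral => y _; rewrite mulrBr cosB; ring.
- by have := integrableZr measurableT (cos (l * x)) (integrable_cosM l ia).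
- by have := integrableZr measurableT (sin (l * x)) (integrable_sinM l ia).
Qed.

Lemma trpowerE a l : mu.-integrable setT (EFin \o a) ->
  trpower a l = \int[mu]_x (a x * (costr a l * cos (l * x) + sintr a l * sin (l * x))).
Proof.
move=> ia; rewrite /trpower !expr2 {1}/costr {1}/sintr.
rewrite -!RintegralZr//; [|exact: integrable_sinM|exact: integrable_cosM].
rewrite -RintegralD//.
- apply: eq_Rintegral => y _; ring.
- by have := integrableZr measurableT (costr a l) (integrable_cosM l ia).
- by have := integrableZr measurableT (sintr a l) (integrable_sinM l ia).
Qed.

Let mcos2 : measurable_fun setT (fun z : R * R => cos (z.1 * z.2)).
Proof.
apply: (measurableT_comp (f := cos)); first by apply: continuous_measurable_fun; exact: continuous_cos.
by apply: measurable_funM.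
Qed.

Let msin2 : measurable_fun setT (fun z : R * R => sin (z.1 * z.2)).
Proof.
apply: (measurableT_comp (f := sin)); first by apply: continuous_measurable_fun; exact: continuous_sin.
by apply: measurable_funM.
Qed.

(** The damping factor is integrable in [l], which allows Fubini's theorem
    twice. The innermost integral is then that of the damping factor against
    [cos (l * (x - y))], that is, the Poisson kernel at [x - y]. *)
Lemma Rintegral_damp_trpower a e : 0 < e -> mu.-integrable setT (EFin \o a) ->
  \int[mu]_l (damp e l * trpower a l) =
  \int[mu]_x (a x * \int[mu]_y (a y * poisson e (x - y))).
Proof.
move=> e0 ia.
have /integrableP[/measurable_EFinP ma _] := ia.
pose A := \int[mu]_x `|a x|.
have A0 : 0 <= A by apply: Rintegral_ge0.
pose D l x := costr a l * cos (l * x) + sintr a l * sin (l * x).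
have DA l x : `|D l x| <= 2 * A.
  apply: (le_trans (ler_normD _ _)); rewrite !normrM mulr2n mulrDl mul1r; apply: lerD.
    by rewrite (le_trans (ler_piMr _ (norm_cos_le1 _)))// norm_costr_le.
  by rewrite (le_trans (ler_piMr _ (norm_sin_le1 _)))// norm_sintr_le.
have mc : measurable_fun setT (costr a) by apply: continuous_measurable_fun; exact: continuous_costr.
have ms : measurable_fun setT (sintr a) by apply: continuous_measurable_fun; exact: continuous_sintr.
have md := @measurable_damp R e.
have mD : measurable_fun setT (fun z : R * R => D z.1 z.2).
  apply: measurable_funD; apply: measurable_funM => //; first exact: (measurableT_comp mc).
  exact: (measurableT_comp ms).
have ic x : mu.-integrable setT (fun l => (damp e l * D l x)%:E).
  apply: (integrable_mul_bounded (integrable_damp e0) _ (fun l => DA l x)).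
  exact: (measurableT_comp mD (measurable_pair2 x)).
under eq_Rintegral => l _.
  rewrite (trpowerE l ia) -RintegralZl//; last first.
    apply: (integrable_mul_bounded ia _ (DA l)).
    exact: (measurableT_comp mD (measurable_pair1 l)).
  over.
rewrite (Rintegral_fubini (F := fun l x => damp e l * (a x * D l x))); last first.
  apply: (integrable_prod_dominated (F := fun l x => damp e l * (a x * D l x)) (u := fun l => damp e l) (v := fun x => 2 * A * a x)).
  - apply: measurable_funM; first exact: (measurableT_comp md).
    by apply: measurable_funM => //; exact: (measurableT_comp ma).
  - exact: integrable_damp.
  - by have := integrableZl measurableT (2 * A) ia.
  - by move=> l x; rewrite normrM ler_wpM2l// normrM [leRHS]normrM mulrC ler_wpM2r// (le_trans (DA l x))// ler_norm.
apply: eq_Rintegral => x _.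
under eq_Rintegral do rewrite mulrCA.
rewrite RintegralZl//; last exact: ic.
congr (_ * _).
under eq_Rintegral => l _.
  rewrite /D (trkernelE l x ia) -RintegralZl//; last first.
    apply: (integrable_mul_bounded (M := 1) ia) => [|y]; last exact: norm_cos_le1.
    apply: (measurableT_comp (f := cos)); first by apply: continuous_measurable_fun; exact: continuous_cos.
    by apply: measurable_funM => //; exact: measurable_reflect.
  over.
rewrite (Rintegral_fubini (F := fun l y => damp e l * (a y * cos (l * (x - y))))); last first.
  apply: (integrable_prod_dominated (F := fun l y => damp e l * (a y * cos (l * (x - y)))) (u := fun l => damp e l) (v := a)).
  - apply: measurable_funM; first exact: (measurableT_comp md).
    apply: measurable_funM; first exact: (measurableT_comp ma).
    apply: (measurableT_comp (f := cos)); first by apply: continuous_measurable_fun; exact: continuous_cos.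
    apply: measurable_funM => //.
    exact: (measurableT_comp (measurable_reflect x)).
  - exact: integrable_damp.
  - exact: ia.
  - move=> l y; rewrite !normrM ler_wpM2l// ler_piMr//; exact: norm_cos_le1.
apply: eq_Rintegral => y _.
under eq_Rintegral do rewrite mulrCA.
rewrite RintegralZl//; first by rewrite Rintegral_damp_cos.
apply: (integrable_mul_bounded (M := 1) (integrable_damp e0)) => [|l]; last exact: norm_cos_le1.
exact: measurable_cosM.
Qed.

End trig.

(** * Bessel's inequality *)

Section bessel.
Context {R : realType}.
Local Notation mu := (@lebesgue_measure R).
Implicit Types (a b : R -> R) (e l x y : R).

Definition L12 a := mu.-integrable setT (EFin \o a) /\
  mu.-integrable setT (fun x => (a x ^+ 2)%:E).

Definition nsq a := \int[mu]_x (a x ^+ 2).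

Lemma integrable_measurable a : mu.-integrable setT (EFin \o a) -> measurable_fun setT a.
Proof. by move=> /integrableP[/measurable_EFinP]. Qed.

Lemma nsqE a : mu.-integrable setT (fun x => (a x ^+ 2)%:E) ->
  (\int[mu]_x (a x ^+ 2)%:E = (nsq a)%:E)%E.
Proof. by move=> ia; rewrite /nsq /Rintegral fineK//; exact: integrable_fin_num. Qed.

Lemma Rintegral_prod (F : R -> R -> R) :
  (mu \x mu)%E.-integrable setT (fun z => (F z.1 z.2)%:E) ->
  \int[mu]_x \int[mu]_y F x y = Rintegral (mu \x mu)%E setT (fun z => F z.1 z.2).
Proof.
move=> iF; rewrite /Rintegral ae_Rintegral1//.
by rewrite (integral12_prod_meas1 iF).
Qed.

Lemma poisson_le e l : 0 < e -> poisson e l <= 2 / e.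
Proof.
move=> e0; rewrite /poisson ler_pdivrMr ?poisson_den_gt0//.
rewrite [leRHS](_ : _ = 2 * e + 2 / e * l ^+ 2); last by field; rewrite gt_eqF.
by rewrite lerDl mulr_ge0// ?sqr_ge0// divr_ge0// ltW.
Qed.

Lemma measurable_poisson e : 0 < e -> measurable_fun setT (poisson e).
Proof. by move=> e0; apply: continuous_measurable_fun; exact: continuous_poisson. Qed.

Lemma integral_poisson_reflect e x : 0 < e ->
  (\int[mu]_y (poisson e (x - y))%:E = (2 * pi)%:E)%E.
Proof.
move=> e0; rewrite (@ge0_integral_reflect R x (fun u => (poisson e u)%:E)).
- exact: integral_poisson.
- by apply/measurable_EFinP; exact: measurable_poisson.
- by move=> u; rewrite lee_fin poisson_ge0.
Qed.

Lemma measurable_poisson2 e : 0 < e ->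
  measurable_fun setT (fun z : R * R => poisson e (z.1 - z.2)).
Proof.
move=> e0; apply: (measurableT_comp (measurable_poisson e0)).
exact: measurable_funB.
Qed.

(** Schur's test: the kernel is nonnegative and symmetric, and has integral [2 *
    pi] in each variable, while [a x * a y <= (a x ^+ 2 + a y ^+ 2) / 2]. *)
Lemma damped_energy a e : 0 < e -> L12 a ->
  (\int[mu]_l (damp e l * trpower a l)%:E <= (2 * pi * nsq a)%:E)%E.
Proof.
move=> e0 [ia ia2].
have ma := integrable_measurable ia.
have e20 : 0 <= 2 / e by rewrite divr_ge0// ltW.
pose A := \int[mu]_x `|a x|.
have idt : mu.-integrable setT (fun l => (damp e l * trpower a l)%:E).
  apply: (integrable_mul_bounded (M := A ^+ 2 + A ^+ 2) (integrable_damp e0)).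
    by apply: continuous_measurable_fun; exact: continuous_trpower.
  move=> l; rewrite ger0_norm ?trpower_ge0//.
  by apply: lerD; rewrite -real_normK ?num_real// lerXn2r ?nnegrE ?norm_costr_le ?norm_sintr_le//; apply: Rintegral_ge0.
rewrite -[leLHS]fineK; last exact: integrable_fin_num.
rewrite lee_fin -/(Rintegral _ _ _) Rintegral_damp_trpower//.
have mK := measurable_poisson2 e0.
have ma1 : measurable_fun setT (fun z : R * R => a z.1) by exact: (measurableT_comp ma).
have ma2 : measurable_fun setT (fun z : R * R => a z.2) by exact: (measurableT_comp ma).
have ip : (mu \x mu)%E.-integrable setT (fun z => (a z.1 * (a z.2 * poisson e (z.1 - z.2)))%:E).
  apply: (integrable_prod_dominated (F := fun x y => a x * (a y * poisson e (x - y))) (u := a) (v := fun x => 2 / e * a x)).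
  - by do 2 apply: measurable_funM => //.
  - exact: ia.
  - by have := integrableZl measurableT (2 / e) ia.
  - move=> x y; rewrite normrM ler_wpM2l// normrM [leRHS]normrM mulrC ler_wpM2r//.
    by rewrite (ger0_norm (poisson_ge0 _ e0)) (le_trans (poisson_le _ e0))// ler_norm.
have ik x : mu.-integrable setT (fun y => (a y * poisson e (x - y))%:E).
  apply: (integrable_mul_bounded (M := 2 / e) ia).
    exact: (measurableT_comp mK (measurable_pair1 x)).
  by move=> y; rewrite ger0_norm ?poisson_ge0 ?poisson_le.
under eq_Rintegral => x _.
  rewrite -RintegralZl//; last exact: ik.
  over.
rewrite (Rintegral_prod ip).
(* The two halves of Schur's test, integrated in either order. *)
pose H (z : R * R) := ((a z.1 ^+ 2 * poisson e (z.1 - z.2))%:E).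
pose H' (z : R * R) := ((a z.2 ^+ 2 * poisson e (z.1 - z.2))%:E).
have mH : measurable_fun setT H.
  by apply/measurable_EFinP; apply: measurable_funM => //; exact: measurable_funX.
have mH' : measurable_fun setT H'.
  by apply/measurable_EFinP; apply: measurable_funM => //; exact: measurable_funX.
have H0 z : (0 <= H z)%E by rewrite lee_fin mulr_ge0 ?sqr_ge0 ?poisson_ge0.
have H'0 z : (0 <= H' z)%E by rewrite lee_fin mulr_ge0 ?sqr_ge0 ?poisson_ge0.
have HE : (\int[mu \x mu]_z H z = (2 * pi * nsq a)%:E)%E.
  rewrite (@fubini_tonelli1 _ _ _ _ _ mu mu H mH H0) /fubini_F /H /=.
  under eq_integral => x _.
    rewrite (_ : (fun _ => _) = (fun y => (a x ^+ 2)%:E * (poisson e (x - y))%:E)%E)//.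
    rewrite ge0_integralZl//; last 3 first.
    - by apply/measurable_EFinP; exact: (measurableT_comp mK (measurable_pair1 x)).
    - by move=> y _; rewrite lee_fin poisson_ge0.
    - by rewrite lee_fin sqr_ge0.
    rewrite integral_poisson_reflect//.
    over.
  rewrite ge0_integralZr//.
  - by rewrite nsqE// -EFinM mulrC.
  - by apply/measurable_EFinP; exact: measurable_funX.
  - by move=> x _; rewrite lee_fin sqr_ge0.
  - by rewrite lee_fin mulr_ge0// pi_ge0.
have H'E : (\int[mu \x mu]_z H' z = (2 * pi * nsq a)%:E)%E.
  rewrite (@fubini_tonelli2 _ _ _ _ _ mu mu H' mH' H'0) /fubini_G /H' /=.
  under eq_integral => y _.
    rewrite (_ : (fun _ => _) = (fun x => (a y ^+ 2)%:E * (poisson e (y - x))%:E)%E); last first.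
      by apply/funext => x; rewrite -poissonN opprB.
    rewrite ge0_integralZl//; last 3 first.
    - by apply/measurable_EFinP; exact: (measurableT_comp mK (measurable_pair1 y)).
    - by move=> x _; rewrite lee_fin poisson_ge0.
    - by rewrite lee_fin sqr_ge0.
    rewrite integral_poisson_reflect//.
    over.
  rewrite ge0_integralZr//.
  - by rewrite nsqE// -EFinM mulrC.
  - by apply/measurable_EFinP; exact: measurable_funX.
  - by move=> x _; rewrite lee_fin sqr_ge0.
  - by rewrite lee_fin mulr_ge0// pi_ge0.
have iH : (mu \x mu)%E.-integrable setT H.
  by apply/integrableP; split=> //; under eq_integral do rewrite gee0_abs//; rewrite HE ltry.
have iH' : (mu \x mu)%E.-integrable setT H'.
  by apply/integrableP; split=> //; under eq_integral do rewrite gee0_abs//; rewrite H'E ltry.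
have iHH : (mu \x mu)%E.-integrable setT (fun z => (2^-1%:E * (H z + H' z))%E).
  by apply: integrableZl => //; exact: integrableD.
rewrite -lee_fin /Rintegral fineK; last exact: integrable_fin_num.
apply: (@le_trans _ _ (\int[mu \x mu]_z (2^-1%:E * (H z + H' z)))%E).
  apply: le_integral => // z _; rewrite /H /H' -EFinD -EFinM lee_fin.
  have := poisson_ge0 (z.1 - z.2) e0; move: (poisson _ _) (a z.1) (a z.2) => k p q k0.
  rewrite -mulrDl 2!mulrA ler_wpM2r//; have := sqr_ge0 (p - q); rewrite sqrrB !expr2.
  by move: (p * p) (q * q) (p * q) => *; lra.
rewrite integralZl//; last exact: integrableD.
rewrite integralD// HE H'E -EFinD -EFinM lee_fin.
by move: (2 * pi * nsq a) => r; lra.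
Qed.

(** The damping factors increase to 1 as [e] decreases to 0. *)
Lemma bessel a : L12 a -> (\int[mu]_l (trpower a l)%:E <= (2 * pi * nsq a)%:E)%E.
Proof.
move=> La; have [ia ia2] := La.
have mt : measurable_fun setT (trpower a).
  by apply: continuous_measurable_fun; exact: continuous_trpower.
pose f (n : nat) (l : R) := (damp n.+1%:R^-1 l * trpower a l)%:E.
have cf l : f n l @[n --> \oo] --> (trpower a l)%:E.
  apply: cvg_EFin; first exact: nearW.
  rewrite -[X in _ --> X]mul1r; apply: cvgMl.
  have h : (- n.+1%:R^-1 * `|l|) @[n --> \oo] --> (0 : R).
    have : (- n.+1%:R^-1 * `|l|) @[n --> \oo] --> (- 0 * `|l|).
      by apply: cvgMl; apply: cvgN; exact: cvg_harmonic.
    by rewrite oppr0 mul0r.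
  by have := cvg_comp _ _ h (@continuous_expR R 0); rewrite expR0.
have mf n : measurable_fun setT (f n).
  by apply/measurable_EFinP; apply: measurable_funM => //; exact: measurable_damp.
have f0 n l : setT l -> (0 <= f n l)%E.
  by move=> _; rewrite lee_fin mulr_ge0 ?damp_ge0 ?trpower_ge0.
have ndf l : setT l -> nondecreasing_seq (f ^~ l).
  move=> _ m n mn; rewrite lee_fin ler_wpM2r ?trpower_ge0// ler_expR !mulNr lerN2.
  by rewrite ler_wpM2r// lef_pV2 ?posrE// ler_nat ltnS.
have := @cvg_monotone_convergence _ _ R mu setT measurableT f mf f0 ndf.
under eq_integral => l _ do rewrite (cvg_lim (@ereal_hausdorff R) (cf l)).
move=> h; rewrite -(cvg_lim (@ereal_hausdorff R) h).
apply: lime_le; first by apply/cvg_ex; eexists; exact: h.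
by apply: nearW => n; exact: damped_energy.
Qed.

End bessel.

(** * The defect in Bessel's inequality *)

Section plancherel.
Context {R : realType}.
Local Notation mu := (@lebesgue_measure R).
Implicit Types (a b : R -> R) (e l x y : R).

Lemma L12_le a b : measurable_fun setT b -> (forall x, `|b x| <= `|a x|) -> L12 a -> L12 b.
Proof.
move=> mb ba [ia ia2]; split.
  apply: (le_integrable measurableT _ _ ia); first exact/measurable_EFinP.
  by move=> x _ /=; rewrite lee_fin.
apply: (le_integrable measurableT _ _ ia2).
  by apply/measurable_EFinP; exact: measurable_funX.
by move=> x _ /=; rewrite lee_fin !normrX lerXn2r// nnegrE.
Qed.

Lemma L12Z c a : L12 a -> L12 (fun x => c * a x).
Proof.
move=> [ia ia2]; split; first by have := integrableZl measurableT c ia.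
have := integrableZl measurableT (c ^+ 2) ia2.
by under eq_fun do rewrite -EFinM -exprMn.
Qed.

Lemma L12D a b : L12 a -> L12 b -> L12 (fun x => a x + b x).
Proof.
move=> [ia ia2] [ib ib2]; split; first by have := integrableD measurableT ia ib.
have ma := integrable_measurable ia; have mb := integrable_measurable ib.
apply: (le_integrable measurableT _ _ (integrableZl measurableT 2 (integrableD measurableT ia2 ib2))).
  by apply/measurable_EFinP; apply: measurable_funX; exact: measurable_funD.
move=> x _ /=; rewrite lee_fin !ger0_norm ?sqr_ge0 ?mulr_ge0 ?addr_ge0 ?sqr_ge0//.
by have := sqr_ge0 (a x - b x); rewrite sqrrB sqrrD !expr2; move: (a x * a x) (b x * b x) (a x * b x) => *; lra.
Qed.

Lemma L12B a b : L12 a -> L12 b -> L12 (fun x => a x - b x).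
Proof.
move=> La Lb; have := L12D La (L12Z (-1) Lb).
by under eq_fun do rewrite mulN1r.
Qed.

Lemma L12_0 : L12 (fun _ : R => 0 : R).
Proof. by split; [|under eq_fun do rewrite expr0n/=]; exact: integrable0. Qed.

Lemma costrD a b l : mu.-integrable setT (EFin \o a) -> mu.-integrable setT (EFin \o b) ->
  costr (fun x => a x + b x) l = costr a l + costr b l.
Proof.
move=> ia ib; rewrite /costr -RintegralD//; [|exact: integrable_cosM|exact: integrable_cosM].
by apply: eq_Rintegral => x _; rewrite mulrDl.
Qed.

Lemma sintrD a b l : mu.-integrable setT (EFin \o a) -> mu.-integrable setT (EFin \o b) ->
  sintr (fun x => a x + b x) l = sintr a l + sintr b l.
Proof.
move=> ia ib; rewrite /sintr -RintegralD//; [|exact: integrable_sinM|exact: integrable_sinM].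
by apply: eq_Rintegral => x _; rewrite mulrDl.
Qed.

Lemma costrZ c a l : mu.-integrable setT (EFin \o a) ->
  costr (fun x => c * a x) l = c * costr a l.
Proof.
move=> ia; rewrite /costr -RintegralZl//; last exact: integrable_cosM.
by apply: eq_Rintegral => x _; rewrite mulrA.
Qed.

Lemma sintrZ c a l : mu.-integrable setT (EFin \o a) ->
  sintr (fun x => c * a x) l = c * sintr a l.
Proof.
move=> ia; rewrite /sintr -RintegralZl//; last exact: integrable_sinM.
by apply: eq_Rintegral => x _; rewrite mulrA.
Qed.

Lemma costrB a b l : mu.-integrable setT (EFin \o a) -> mu.-integrable setT (EFin \o b) ->
  costr (fun x => a x - b x) l = costr a l - costr b l.
Proof.
move=> ia ib; rewrite /costr -RintegralB//; [|exact: integrable_cosM|exact: integrable_cosM].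
by apply: eq_Rintegral => x _; rewrite mulrBl.
Qed.

Lemma sintrB a b l : mu.-integrable setT (EFin \o a) -> mu.-integrable setT (EFin \o b) ->
  sintr (fun x => a x - b x) l = sintr a l - sintr b l.
Proof.
move=> ia ib; rewrite /sintr -RintegralB//; [|exact: integrable_sinM|exact: integrable_sinM].
by apply: eq_Rintegral => x _; rewrite mulrBl.
Qed.

Lemma integrable_trpower a : L12 a -> mu.-integrable setT (EFin \o trpower a).
Proof.
move=> La; have [ia _] := La.
apply/integrableP; split.
  by apply/measurable_EFinP; apply: continuous_measurable_fun; exact: continuous_trpower.
under eq_integral do rewrite /= ger0_norm ?trpower_ge0//.
by apply: (le_lt_trans (bessel La)); exact: ltry.
Qed.

(** Both terms are quadratic in [a], so that the defect is homogeneous of degree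
    2 and satisfies the parallelogram law. By [bessel] it lies between 0 and
    [2 * pi * nsq a], which makes its zero set a vector space that is closed in
    the L2 norm. *)
Definition defect a := 2 * pi * nsq a - \int[mu]_l trpower a l.

Lemma defect_ge0 a : L12 a -> 0 <= defect a.
Proof.
move=> La; rewrite subr_ge0 -lee_fin; apply: (le_trans _ (bessel La)).
rewrite /Rintegral fineK//.
by apply: integrable_fin_num => //; exact: integrable_trpower.
Qed.

Lemma defectZ c a : L12 a -> defect (fun x => c * a x) = c ^+ 2 * defect a.
Proof.
move=> La; have [ia ia2] := La; rewrite /defect.
have -> : nsq (fun x => c * a x) = c ^+ 2 * nsq a.
  by rewrite /nsq -RintegralZl//; apply: eq_Rintegral => x _; rewrite exprMn.
have -> : \int[mu]_l trpower (fun x => c * a x) l = c ^+ 2 * \int[mu]_l trpower a l.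
  rewrite -RintegralZl//; last exact: integrable_trpower.
  by apply: eq_Rintegral => l _; rewrite /trpower costrZ// sintrZ//; ring.
ring.
Qed.

Lemma defect_parallelogram a b : L12 a -> L12 b ->
  defect (fun x => a x + b x) + defect (fun x => a x - b x) = 2 * defect a + 2 * defect b.
Proof.
move=> La Lb; have LD := L12D La Lb; have LB := L12B La Lb.
have [ia ia2] := La; have [ib ib2] := Lb.
have [_ iD] := LD; have [_ iB] := LB.
have H1 : nsq (fun x => a x + b x) + nsq (fun x => a x - b x) = 2 * (nsq a + nsq b).
  rewrite /nsq -!RintegralD// -RintegralZl//; last by have := integrableD measurableT ia2 ib2.
  by apply: eq_Rintegral => x _; ring.
have H2 : \int[mu]_l trpower (fun x => a x + b x) l + \int[mu]_l trpower (fun x => a x - b x) l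
    = 2 * (\int[mu]_l trpower a l + \int[mu]_l trpower b l).
  have ita := integrable_trpower La; have itb := integrable_trpower Lb.
  rewrite -!RintegralD//; [|exact: integrable_trpower|exact: integrable_trpower].
  rewrite -RintegralZl//; last by have := integrableD measurableT ita itb.
  apply: eq_Rintegral => l _; rewrite /trpower (costrD l ia ib) (sintrD l ia ib).
  rewrite (costrB l ia ib) (sintrB l ia ib); ring.
rewrite /defect -addrACA -mulrDr H1 -opprD H2; ring.
Qed.

Definition exact_energy a := L12 a /\ defect a = 0.

(** By the parallelogram law the defects of [a + b] and [a - b] add up to 0, and
    both are nonnegative. *)
Lemma exact_energyD a b : exact_energy a -> exact_energy b -> exact_energy (fun x => a x + b x).
Proof.
move=> [La da] [Lb db]; split; first exact: L12D.
have := defect_parallelogram La Lb; rewrite da db mulr0 addr0.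
have := defect_ge0 (L12D La Lb); have := defect_ge0 (L12B La Lb).
by move: (defect _) (defect _) => p q; lra.
Qed.

Lemma exact_energyZ c a : exact_energy a -> exact_energy (fun x => c * a x).
Proof. by move=> [La da]; split; [exact: L12Z|rewrite defectZ// da mulr0]. Qed.

Lemma exact_energyB a b : exact_energy a -> exact_energy b -> exact_energy (fun x => a x - b x).
Proof.
move=> Ea Eb; have := exact_energyD Ea (exact_energyZ (-1) Eb).
by under eq_fun do rewrite mulN1r.
Qed.

Lemma exact_energy0 : exact_energy (fun _ => 0 : R).
Proof.
split; first exact: L12_0.
have -> : (fun _ => 0 : R) = (fun x => 0 * 0) by apply/funext => x; rewrite mul0r.
by rewrite (defectZ 0 L12_0) expr0n/= mul0r.
Qed.

Lemma exact_energy_sum n (f : 'I_n -> R -> R) : (forall i, exact_energy (f i)) ->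
  exact_energy (fun x => \sum_(i < n) f i x).
Proof.
elim: n f => [f _|n IH f hf].
  by under eq_fun do rewrite big_ord0; exact: exact_energy0.
under eq_fun do rewrite big_ord_recr/=.
by apply: exact_energyD => //; exact: (IH (fun i => f (widen_ord (leqnSn n) i))).
Qed.

(** With [r = a - b], the parallelogram law for [b] and [r] bounds the defect of
    [a] by twice that of [r], hence by [4 * pi * nsq r]. *)
Lemma exact_energy_approx a : L12 a ->
  (forall d : R, 0 < d -> exists2 b, exact_energy b & nsq (fun x => a x - b x) <= d) ->
  exact_energy a.
Proof.
move=> La h; split => //; apply/eqP; rewrite eq_le defect_ge0// andbT.
apply/ler_addgt0Pl => d d0; rewrite addr0.
have pi40 : 0 < 4 * pi :> R by rewrite mulr_gt0// pi_gt0.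
have [b [Lb db] nb] := h (d / (4 * pi)) (divr_gt0 d0 pi40).
have Lr := L12B La Lb.
have := defect_parallelogram Lb Lr; rewrite db mulr0 add0r.
have -> : (fun x => b x + (a x - b x)) = a by apply/funext => x; ring.
have := defect_ge0 (L12B Lb Lr).
have : defect (fun x => a x - b x) <= d / 2.
  have pi0 : (pi : R) != 0 by rewrite gt_eqF ?pi_gt0.
  have -> : d / 2 = 2 * pi * (d / (4 * pi)) by move: (pi : R) pi0 => p p0; field.
  rewrite /defect; apply: (@le_trans _ _ (2 * pi * nsq (fun x => a x - b x))).
    by rewrite lerBlDr lerDl; apply: Rintegral_ge0 => x _; exact: trpower_ge0.
  by rewrite ler_wpM2l// mulr_ge0// pi_ge0.
move: (defect _) (defect a) (defect _) => p q r; lra.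
Qed.

Lemma exact_energy_dominated a (b : nat -> R -> R) : L12 a ->
  (forall n, exact_energy (b n)) -> (forall n x, `|b n x| <= `|a x|) ->
  (forall x, b n x @[n --> \oo] --> a x) -> exact_energy a.
Proof.
move=> La Eb ba bc; apply: exact_energy_approx => // d d0.
have [ia ia2] := La; have ma := integrable_measurable ia.
have mb n := integrable_measurable (Eb n).1.1.
have ig : mu.-integrable setT (fun x => (4%:E * (a x ^+ 2)%:E)%E) by exact: integrableZl.
have mF n : measurable_fun setT (fun x => ((a x - b n x) ^+ 2)%:E).
  by apply/measurable_EFinP; apply: measurable_funX; exact: measurable_funB.
have cF : {ae mu, forall x, setT x -> (fun n => ((a x - b n x) ^+ 2)%:E) n @[n --> \oo] --> 0%E}.
  apply: nearW => x _; apply: cvg_EFin; first exact: nearW.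
  have h : a x - b n x @[n --> \oo] --> 0.
    by rewrite -(subrr (a x)); apply: cvgB (bc x); exact: cvg_cst.
  by have := cvgM h h; rewrite mulr0 => hh; exact: hh.
have dF : {ae mu, forall x n, setT x -> (`|((a x - b n x) ^+ 2)%:E| <= 4%:E * (a x ^+ 2)%:E)%E}.
  apply: nearW => x n _; rewrite -EFinM lee_fin ger0_norm ?sqr_ge0//.
  rewrite -[leLHS]real_normK ?num_real// -[X in _ <= _ * X]real_normK ?num_real//.
  have : `|a x - b n x| <= 2 * `|a x|.
    by rewrite (le_trans (ler_normB _ _))// mulr2n mulrDl mul1r lerD2l.
  by move: (normr_ge0 (a x)) (normr_ge0 (a x - b n x)); move: `|a x| `|a x - b n x| => p q; nra.
have [_ _ ] := @dominated_convergence _ _ R mu setT measurableT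
   (fun n x => ((a x - b n x) ^+ 2)%:E) (fun=> 0%E) (fun x => (4%:E * (a x ^+ 2)%:E)%E)
   mF (measurable_cst _) cF ig dF.
rewrite integral0 => /fine_cvgP [_ /cvgrPdist_le /(_ _ d0)] [N _ /(_ N (leqnn N))].
rewrite /= sub0r normrN => h; exists (b N) => //.
by apply: le_trans h; exact: ler_norm.
Qed.

End plancherel.

(** * Plancherel's identity for real functions *)

Section density.
Import HBNNSimple.
Context {R : realType}.
Local Notation mu := (@lebesgue_measure R).
Implicit Types (a b : R -> R) (e l x y p q : R).

Lemma L12_indic (A : set R) : measurable A -> (mu A < +oo)%E -> L12 (\1_A : R -> R).
Proof.
move=> mA Aoo.
have i1 : mu.-integrable setT (EFin \o (\1_A : R -> R)).
  apply/integrableP; split; first exact/measurable_EFinP.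
  by under eq_integral do rewrite /= ger0_norm//; rewrite integral_indic// setIT.
split=> //.
have -> : (fun x => ((\1_A x : R) ^+ 2)%:E) = (EFin \o (\1_A : R -> R)) => //.
by apply/funext => x /=; rewrite indicE; case: (_ \in _); rewrite ?expr1n ?expr0n.
Qed.

Lemma integral_oo_cc (f : R -> R) p q : p <= q -> measurable_fun setT f ->
  (\int[mu]_(x in `]p, q[) (f x)%:E = \int[mu]_(x in `[p, q]) (f x)%:E)%E.
Proof.
move=> pq mf.
rewrite integral_itv_obnd_cbnd//; last by apply/measurable_EFinP; exact: measurable_funTS.
by rewrite integral_itv_bndo_bndc//; apply/measurable_EFinP; exact: measurable_funTS.
Qed.

Lemma cvg_atan_scale (c : R) : 0 < c -> atan (c / n.+1%:R^-1) @[n --> \oo] --> pi / 2.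
Proof.
move=> c0.
have h : c / n.+1%:R^-1 @[n --> \oo] --> +oo.
  apply/cvgryPge => A; apply: filterS (nbhs_infty_ger (A / c)) => n h.
  by rewrite invrK mulrC -ler_pdivrMr// (le_trans h)// ler_nat.
exact: (cvg_comp _ _ h (@cvgy_atan R)).
Qed.

(** For the indicator of an interval the convolution with the Poisson kernel is
    a sum of two arctangents. At each interior point both tend to [pi / 2] as
    the damping disappears, so the damped energies, which never exceed the
    undamped one, tend to [2 * pi] times the length of the interval. This is the
    converse of [bessel]. The interval is open because the limit is only half as
    large at the endpoints. *)
Lemma exact_energy_itv p q : exact_energy (\1_`]p, q[%classic : R -> R).
Proof.
have [qp|pq] := leP q p.
  by rewrite set_itv_ge ?bnd_simp -?leNgt// indic0; exact: exact_energy0.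
have Lpq : L12 (\1_`]p, q[%classic : R -> R).
  by apply: L12_indic => //; rewrite lebesgue_measure_itv/= lte_fin pq -EFinB ltry.
split=> //; apply/eqP; rewrite eq_le defect_ge0// andbT subr_le0.
set a := (\1_ _ : R -> R) in Lpq *; have [ia ia2] := Lpq.
have ma := integrable_measurable ia.
have -> : 2 * pi * nsq a = \int[mu]_x (2 * pi * a x).
  rewrite RintegralZl//; congr (_ * _); rewrite /nsq; apply: eq_Rintegral => x _.
  by rewrite /a indicE; case: (_ \in _); rewrite ?expr1n ?expr0n.
pose g (n : nat) x := 2 * atan ((q - x) / n.+1%:R^-1) + 2 * atan ((x - p) / n.+1%:R^-1).
have mg n : measurable_fun setT (g n).
  have mat : measurable_fun setT (@atan R).
    by apply: continuous_measurable_fun => x; exact: continuous_atan.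
  apply: measurable_funD; apply: measurable_funM => //.
    apply: (measurableT_comp mat); apply: measurable_funM => //.
    exact: measurable_reflect.
  apply: (measurableT_comp mat); apply: measurable_funM => //.
  exact: measurable_funB.
have gb n x : `|g n x| <= 2 * pi.
  have h (y : R) : `|atan y| <= pi / 2.
    by rewrite ler_norml (ltW (atan_gtNpi2 _)) (ltW (atan_ltpi2 _)).
  apply: (le_trans (ler_normD _ _)); rewrite !normrM (ger0_norm (ler0n _ 2)).
  by have := h ((q - x) / n.+1%:R^-1); have := h ((x - p) / n.+1%:R^-1); lra.
have gE n x : \int[mu]_y (a y * poisson n.+1%:R^-1 (x - y)) = g n x.
  have n0 : 0 < n.+1%:R^-1 :> R by rewrite invr_gt0.
  have := integral_itv_poisson x n0 (ltW pq).
  rewrite -integral_oo_cc ?(ltW pq)//; last first.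
    exact: (measurableT_comp (measurable_poisson2 n0) (measurable_pair1 x)).
  rewrite /Rintegral => H.
  have -> : (\int[mu]_y (a y * poisson n.+1%:R^-1 (x - y))%:E = (g n x)%:E)%E => //.
  rewrite -H [RHS]integral_mkcond; apply: eq_integral => y _.
  by rewrite patchE /a indicE; case: ifPn => _; rewrite ?mul1r ?mul0r.
have mF n : measurable_fun setT (fun x => (a x * g n x)%:E).
  by apply/measurable_EFinP; exact: measurable_funM.
have cF : {ae mu, forall x, setT x -> (fun n => (a x * g n x)%:E) n @[n --> \oo] --> (2 * pi * a x)%:E}.
  apply: nearW => x _; apply: cvg_EFin; first exact: nearW.
  rewrite /a indicE; have [|xN] := boolP (x \in `]p, q[%classic); last first.
    rewrite mulr0; have -> : (fine \o (fun n => (false%:R * g n x)%:E)) = (fun=> 0).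
      by apply/funext => n /=; rewrite mul0r.
    exact: cvg_cst.
  rewrite inE/= in_itv/= => /andP[px xq]; rewrite mulr1.
  have -> : (fine \o (fun n => (true%:R * g n x)%:E)) = g ^~ x.
    by apply/funext => n /=; rewrite mul1r.
  have -> : 2 * pi = 2 * (pi / 2) + 2 * (pi / 2) :> R by lra.
  by apply: cvgD; apply: cvgMr; apply: cvg_atan_scale; rewrite subr_gt0.
have ig : mu.-integrable setT (fun x => (2 * pi * a x)%:E).
  by have := integrableZl measurableT (2 * pi) ia.
have a0 x : 0 <= a x by rewrite /a indicE.
have dF : {ae mu, forall x n, setT x -> (`|(a x * g n x)%:E| <= (2 * pi * a x)%:E)%E}.
  by apply: nearW => x n _; rewrite lee_fin normrM (ger0_norm (a0 x)) mulrC ler_wpM2r.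
have [_ _ h] := @dominated_convergence _ _ R mu setT measurableT
   (fun n x => (a x * g n x)%:E) (fun x => (2 * pi * a x)%:E) (fun x => (2 * pi * a x)%:E)
   mF (measurable_int _ ig) cF ig dF.
have {}h : \int[mu]_x (a x * g n x) @[n --> \oo] --> \int[mu]_x (2 * pi * a x).
  apply: (fine_cvg (f := fun n => (\int[mu]_x (a x * g n x)%:E)%E)).
  by rewrite fineK//; exact: integrable_fin_num.
(* The limit is bounded by the undamped energy, as every damped energy is. *)
rewrite -(cvg_lim (@Rhausdorff R) h); apply: limr_le.
  by apply/cvg_ex; eexists; exact: h.
apply: nearW => n.
have n0 : 0 < n.+1%:R^-1 :> R by rewrite invr_gt0.
under eq_Rintegral do rewrite -gE.
rewrite -Rintegral_damp_trpower//.
have it := integrable_trpower Lpq.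
have d1 l : `|damp n.+1%:R^-1 l| <= 1.
  by rewrite ger0_norm ?damp_ge0// -expR0 ler_expR mulNr oppr_le0 mulr_ge0// ltW.
apply: le_Rintegral => //.
- have := integrable_mul_bounded it (@measurable_damp R _) d1.
  by under eq_fun do rewrite mulrC.
- move=> l _; rewrite ler_piMl ?trpower_ge0//.
  by rewrite (le_trans _ (d1 l))// ler_norm.
Qed.

Lemma indicU (A B : set R) x : A `&` B = set0 ->
  \1_(A `|` B) x = \1_A x + \1_B x :> R.
Proof.
move=> AB; rewrite !indicE in_setU.
have [xA|] := boolP (x \in A); have [xB|] := boolP (x \in B); rewrite ?addr0 ?add0r//=.
by exfalso; rewrite !inE in xA xB; have : set0 x by rewrite -AB.
Qed.

(** Dynkin's lemma for the rays [`]x, +oo[], which generate the Borel sets.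
    Linearity of [exact_energy] handles complements and finite disjoint unions,
    and dominated convergence the countable ones. Cutting with a bounded
    interval keeps all the indicators in L1 and L2. *)
Lemma exact_energy_bounded (N : nat) (A : set R) : measurable A ->
  exact_energy (\1_(A `&` `]- N%:R, N%:R[%classic) : R -> R).
Proof.
pose J : set R := `]- N%:R, N%:R[%classic.
rewrite -/J => mA.
have mJ : measurable J by exact: measurable_itv.
have EJ : exact_energy (\1_J : R -> R) by exact: exact_energy_itv.
have Joo : (mu J < +oo)%E.
  by rewrite /J lebesgue_measure_itv/=; case: ifP => // _; rewrite -EFinB ltry.
have LJ B : measurable B -> L12 (\1_(B `&` J) : R -> R).
  move=> mB; apply: L12_indic; first exact: measurableI.
  by rewrite (le_lt_trans _ Joo)// le_measure// ?inE//; exact: measurableI.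
have : <<s @RGenOInfty.G R >> A.
  by have : (@ocitv R).-sigma.-measurable A := mA; rewrite RGenOInfty.measurableE.
apply: (dynkin_induction (P := fun B => exact_energy (\1_(B `&` J) : R -> R))) => {A mA}.
- exact: RGenOInfty.measurableE.
- move=> _ _ [x ->] [y ->]; exists (Num.max x y).
  by apply/seteqP; split => z /=; rewrite !in_itv/= !andbT gt_max => /andP.
- by rewrite setTI.
- move=> _ [x ->].
  rewrite (_ : _ `&` J = `]Num.max x (- N%:R), N%:R[%classic); first exact: exact_energy_itv.
  apply/seteqP; split => z /=; rewrite !in_itv/= andbT gt_max.
    by move=> [xz /andP[nz zn]]; apply/andP; split=> //; apply/andP; split.
  by move=> /andP[/andP[xz nz] zn]; split=> //; apply/andP; split.
- move=> S mS ES.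
  rewrite (_ : \1_(~` S `&` J) = (fun x => \1_J x - \1_(S `&` J) x)); first exact: exact_energyB.
  apply/funext => x.
  rewrite (_ : \1_J x = \1_(S `&` J) x + \1_(~` S `&` J) x); first by rewrite addrAC subrr add0r.
  rewrite -indicU -?setIUl ?setUv ?setTI//.
  by rewrite setIACA setICr set0I.
- move=> F mF tF EF.
  have mU k : measurable (\big[setU/set0]_(i < k) F i) by exact: bigsetU_measurable.
  apply: (@exact_energy_dominated _ _ (fun k => \1_(\big[setU/set0]_(i < k) F i `&` J) : R -> R)).
  + by apply: LJ; exact: bigcup_measurable.
  + elim=> [|n IH]; first by rewrite big_ord0 set0I indic0; exact: exact_energy0.
    rewrite big_ord_recr/= setIUl.
    rewrite (_ : \1_ _ = (fun x => \1_(\big[setU/set0]_(i < n) F i `&` J) x + \1_(F n `&` J) x)).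
      exact: (exact_energyD IH (EF n)).
    apply/funext => x; apply: indicU; rewrite setIACA setIid.
    rewrite (_ : _ `&` F n = set0) ?set0I//.
    have tF' : trivIset xpredT F.
      by apply/trivIsetP => i j _ _ ij; move/trivIsetP : tF; apply.
    exact: (trivIset_bigsetUI tF').
  + move=> n x; rewrite !indicE.
    have [xn|] := boolP (x \in \big[setU/set0]_(i < n) F i `&` J); last by rewrite normr0.
    suff -> : x \in \bigcup_k F k `&` J by [].
    move: xn; rewrite !inE => -[h Jx]; split => //.
    by move: h; rewrite -bigcup_mkord => -[i _ Fx]; exists i.
  + move=> x; rewrite indicE.
    have [|] := boolP (x \in \bigcup_k F k `&` J).
      rewrite inE => -[[k _ Fkx] Jx].
      apply: cvg_near_cst; exists k.+1 => // n /= kn.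
      rewrite indicE mem_set//; split => //.
      by rewrite -bigcup_mkord; exists k.
    move=> xN; apply: cvg_near_cst; apply: nearW => n.
    rewrite indicE memNset// => -[h Jx]; move/negP: xN; apply; rewrite inE; split => //.
    by move: h; rewrite -bigcup_mkord => -[i _ Fx]; exists i.
Qed.

(** Simple functions increase to [a]; they are cut to bounded intervals in order
    to be combinations of the indicators of [exact_energy_bounded]. *)
Lemma exact_energy_ge0 a : L12 a -> (forall x, 0 <= a x) -> exact_energy a.
Proof.
move=> La a0; have [ia ia2] := La; have ma := integrable_measurable ia.
have mEa : measurable_fun setT (EFin \o a) by exact/measurable_EFinP.
pose g := nnsfun_approx measurableT mEa.
pose J (n : nat) : set R := `]- n%:R, n%:R[%classic.
have a0E x : setT x -> (0 <= (EFin \o a) x)%E by move=> _; rewrite lee_fin.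
have gc x : g n x @[n --> \oo] --> a x.
  by have /fine_cvgP[_] := cvg_nnsfun_approx measurableT mEa a0E (I : setT x).
apply: (@exact_energy_dominated _ _ (fun n x => g n x * \1_(J n) x)) => //.
- move=> n.
  rewrite (_ : (fun x => _) = fun x => \sum_(i < #|` fset_set (range (g n))|)
    ((fset_set (range (g n)))`_i * \1_(g n @^-1` [set (fset_set (range (g n)))`_i] `&` J n) x)).
    apply: exact_energy_sum => i; apply: exact_energyZ; apply: exact_energy_bounded.
    exact: measurable_sfunP.
  apply/funext => x; rewrite fimfunEord big_distrl/=; apply: eq_bigr => i _.
  by rewrite indicI mulrA.
- move=> n x; rewrite normrM indicE (_ : `|_%:R| = (x \in J n)%:R); last by case: (_ \in _); rewrite ?normr1 ?normr0.
  apply: (@le_trans _ _ `|g n x|); first by case: (_ \in _); rewrite ?mulr1 ?mulr0.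
  rewrite !ger0_norm//.
  by have := le_approx n a0E (I : setT x); rewrite -nnsfun_approxE lee_fin.
- move=> x; rewrite -[X in _ --> X]mulr1; apply: cvgM; first exact: gc.
  apply: cvg_near_cst; have [N _ hN] := nbhs_infty_gtr `|x|.
  exists N => // n /hN /= h.
  by rewrite indicE mem_set// /J/= in_itv/= -ltr_norml.
Qed.

(** [a] is the difference of its positive and negative parts, and [exact_energy]
    is stable under differences. *)
Theorem trig_plancherel a : L12 a -> \int[mu]_l trpower a l = 2 * pi * nsq a.
Proof.
move=> La; have [ia ia2] := La; have ma := integrable_measurable ia.
have h (s : R) : exact_energy (fun x => Num.max (s * a x) 0).
  apply: exact_energy_ge0 => [|x]; last by rewrite le_max lexx orbT.
  apply: (L12_le _ _ (L12Z s La)).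
    by apply: measurable_maxr => //; exact: measurable_funM.
  by move=> x; case: (leP (s * a x) 0) => // _; rewrite normr0.
have [_] := exact_energyB (h 1) (h (-1)).
have -> : (fun x => Num.max (1 * a x) 0 - Num.max (-1 * a x) 0) = a.
  by apply/funext => x; rewrite mul1r mulN1r; case: (leP (a x) 0); case: (leP (- a x) 0) => *; lra.
by move/eqP; rewrite subr_eq0 => /eqP.
Qed.

End density.

(** * Integrals and norms of complex functions *)

Section complex_toolkit.
Context {R : realType}.
Local Notation mu := (@lebesgue_measure R).
Implicit Types (h k : R -> R[i]) (z w : R[i]).

Lemma normc_sqE z : Normc.normc z ^+ 2 = complex.Re z ^+ 2 + complex.Im z ^+ 2.
Proof. by case: z => a b /=; rewrite sqr_sqrtr// addr_ge0 ?sqr_ge0. Qed.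

Lemma normc_ge0 z : 0 <= Normc.normc z.
Proof. by case: z => a b; exact: sqrtr_ge0. Qed.

Lemma normcD_le z w : Normc.normc (z + w) <= Normc.normc z + Normc.normc w.
Proof. exact: le_normcD. Qed.

Lemma normc_opp z : Normc.normc (- z) = Normc.normc z.
Proof. by case: z => a b /=; rewrite !sqrrN. Qed.

Lemma normcB_le z w : Normc.normc (z - w) <= Normc.normc z + Normc.normc w.
Proof. by rewrite (le_trans (normcD_le _ _))// normc_opp. Qed.

Lemma normRe_le z : `|complex.Re z| <= Normc.normc z.
Proof.
rewrite -(@ler_pXn2r _ 2)// ?nnegrE ?normc_ge0//.
by rewrite normc_sqE real_normK ?num_real// lerDl sqr_ge0.
Qed.

Lemma normIm_le z : `|complex.Im z| <= Normc.normc z.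
Proof.
rewrite -(@ler_pXn2r _ 2)// ?nnegrE ?normc_ge0//.
by rewrite normc_sqE real_normK ?num_real// lerDr sqr_ge0.
Qed.

Lemma normc_le z : Normc.normc z <= `|complex.Re z| + `|complex.Im z|.
Proof.
rewrite -(@ler_pXn2r _ 2)// ?nnegrE ?normc_ge0 ?addr_ge0//.
by rewrite normc_sqE sqrrD !real_normK ?num_real// -addrA lerD2l lerDr mulrn_wge0// mulr_ge0.
Qed.

Lemma normc_real (x : R) : Normc.normc (real_complex R x) = `|x|.
Proof. by rewrite /= expr0n/= addr0 sqrtr_sqr. Qed.

Lemma cReD z w : complex.Re (z + w) = complex.Re z + complex.Re w.
Proof. by case: z; case: w. Qed.
Lemma cImD z w : complex.Im (z + w) = complex.Im z + complex.Im w.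
Proof. by case: z; case: w. Qed.
Lemma cReB z w : complex.Re (z - w) = complex.Re z - complex.Re w.
Proof. by case: z; case: w. Qed.
Lemma cImB z w : complex.Im (z - w) = complex.Im z - complex.Im w.
Proof. by case: z; case: w. Qed.
Lemma cReM z w : complex.Re (z * w) = complex.Re z * complex.Re w - complex.Im z * complex.Im w.
Proof. by case: z; case: w. Qed.
Lemma cImM z w : complex.Im (z * w) = complex.Re z * complex.Im w + complex.Im z * complex.Re w.
Proof. by case: z => a b; case: w => c d /=; rewrite [b * c]mulrC [c * b]mulrC. Qed.

Definition cmeas {d} {T : measurableType d} (h : T -> R[i]) :=
  measurable_fun setT (fun x => complex.Re (h x)) /\
  measurable_fun setT (fun x => complex.Im (h x)).

Lemma cmeasD {d} {T : measurableType d} (h k : T -> R[i]) :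
  cmeas h -> cmeas k -> cmeas (fun x => h x + k x).
Proof.
move=> [h1 h2] [k1 k2]; split.
  by under eq_fun do rewrite cReD; exact: measurable_funD.
by under eq_fun do rewrite cImD; exact: measurable_funD.
Qed.

Lemma cmeasB {d} {T : measurableType d} (h k : T -> R[i]) :
  cmeas h -> cmeas k -> cmeas (fun x => h x - k x).
Proof.
move=> [h1 h2] [k1 k2]; split.
  by under eq_fun do rewrite cReB; exact: measurable_funB.
by under eq_fun do rewrite cImB; exact: measurable_funB.
Qed.

Lemma cmeasM {d} {T : measurableType d} (h k : T -> R[i]) :
  cmeas h -> cmeas k -> cmeas (fun x => h x * k x).
Proof.
move=> [h1 h2] [k1 k2]; split.
  by under eq_fun do rewrite cReM; apply: measurable_funB; exact: measurable_funM.
by under eq_fun do rewrite cImM; apply: measurable_funD; exact: measurable_funM.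
Qed.

Lemma cmeas_comp {d d'} {T : measurableType d} {T' : measurableType d'} (h : T' -> R[i]) (f : T -> T') :
  cmeas h -> measurable_fun setT f -> cmeas (fun x => h (f x)).
Proof.
move=> [h1 h2] mf; split; [exact: (measurableT_comp h1 mf)|exact: (measurableT_comp h2 mf)].
Qed.

Lemma measurable_normc_sq {d} {T : measurableType d} (h : T -> R[i]) :
  cmeas h -> measurable_fun setT (fun x => Normc.normc (h x) ^+ 2).
Proof.
move=> [h1 h2]; under eq_fun do rewrite normc_sqE.
by apply: measurable_funD; exact: measurable_funX.
Qed.

Lemma measurable_normc {d} {T : measurableType d} (h : T -> R[i]) :
  cmeas h -> measurable_fun setT (fun x => Normc.normc (h x)).
Proof.
move=> mh.
have -> : (fun x => Normc.normc (h x)) = (fun x => Num.sqrt (Normc.normc (h x) ^+ 2)).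
  by apply/funext => x; rewrite sqrtr_sqr ger0_norm ?normc_ge0.
have ms : measurable_fun setT (@Num.sqrt R).
  by apply: continuous_measurable_fun; exact: sqrt_continuous.
exact: (measurableT_comp ms (measurable_normc_sq mh)).
Qed.

(** The squared L2 norm as an extended real number, which is meaningful before
    [h] is known to be in L2. *)
Definition energy h : \bar R := (\int[mu]_x (Normc.normc (h x) ^+ 2)%:E)%E.

Lemma energy_ge0 h : (0 <= energy h)%E.
Proof. by apply: integral_ge0 => x _; rewrite lee_fin sqr_ge0. Qed.

Lemma CLnorm1E h : CLnorm 1%E h = (\int[mu]_x (Normc.normc (h x))%:E)%E.
Proof.
rewrite /CLnorm Lnorm1; apply: eq_integral => x _.
by rewrite gee0_abs// lee_fin normc_ge0.
Qed.

Lemma CLnorm2E h : CLnorm 2%:E h = (energy h `^ 2^-1)%E.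
Proof.
rewrite /CLnorm unlock; congr (_ `^ _)%E; apply: eq_integral => x _ /=.
by rewrite ger0_norm ?normc_ge0// powR_mulrn ?normc_ge0.
Qed.

Lemma CLnorm2_sqr h : (CLnorm 2%:E h ^+ 2 = energy h)%E.
Proof.
have h1 : 2^-1 + 2^-1 = 1 :> R by lra.
rewrite CLnorm2E expe2 -poweRD; last by apply: add_neq0_poweRD_def; rewrite h1 oner_neq0.
by rewrite h1 poweRe1//; exact: energy_ge0.
Qed.

Definition cL2 h := cmeas h /\ (energy h < +oo)%E.

Lemma in_CLp2P h : in_CLp 2%:E h <-> cL2 h.
Proof.
split=> [[h1 h2 hoo]|[[h1 h2] hoo]]; split=> //.
  by move: hoo; rewrite CLnorm2E => /lty_poweRy; apply; rewrite invr_eq0.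
by rewrite CLnorm2E poweR_lty.
Qed.

Definition cint h := mu.-integrable setT (fun x => (complex.Re (h x))%:E) /\
  mu.-integrable setT (fun x => (complex.Im (h x))%:E).

Lemma cint_meas h : cint h -> cmeas h.
Proof. by move=> [/integrableP[/measurable_EFinP ? _] /integrableP[/measurable_EFinP ? _]]. Qed.

Lemma cintP h : cmeas h -> (\int[mu]_x (Normc.normc (h x))%:E < +oo)%E <-> cint h.
Proof.
move=> mh; have [h1 h2] := mh; have mn := measurable_normc mh; split.
  move=> hoo.
  have iN : mu.-integrable setT (fun x => (Normc.normc (h x))%:E).
    apply/integrableP; split; first exact/measurable_EFinP.
    by under eq_integral do rewrite gee0_abs ?lee_fin ?normc_ge0//.
  split; apply: (le_integrable measurableT _ _ iN); try exact/measurable_EFinP.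
    by move=> x _ /=; rewrite lee_fin (le_trans (normRe_le _))// ler_norm.
  by move=> x _ /=; rewrite lee_fin (le_trans (normIm_le _))// ler_norm.
move=> [i1 i2].
have := integrableD measurableT (integrable_norm i1) (integrable_norm i2) => /integrableP[_].
apply: le_lt_trans; apply: ge0_le_integral => //.
- by move=> x _; rewrite lee_fin normc_ge0.
- exact/measurable_EFinP.
- by apply: measurableT_comp => //; apply/measurable_EFinP; apply: measurable_funD; exact: measurableT_comp.
- by move=> x _ /=; rewrite lee_fin ger0_norm ?addr_ge0// normc_le.
Qed.

Lemma in_CLp1P h : in_CLp 1%E h <-> cint h.
Proof.
split=> [[h1 h2 hoo]|ih].
  by apply/cintP; rewrite -?CLnorm1E//; split.
have mh := cint_meas ih; have [h1 h2] := mh.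
by split=> //; rewrite CLnorm1E; apply/cintP.
Qed.

Lemma cintD h k : cint h -> cint k -> cint (fun x => h x + k x).
Proof.
move=> [h1 h2] [k1 k2]; split.
  by have := integrableD measurableT h1 k1; under eq_fun do rewrite -EFinD -cReD.
by have := integrableD measurableT h2 k2; under eq_fun do rewrite -EFinD -cImD.
Qed.

Lemma cintZ z h : cint h -> cint (fun x => z * h x).
Proof.
move=> [h1 h2]; split.
  have := integrableB measurableT (integrableZl measurableT (complex.Re z) h1) (integrableZl measurableT (complex.Im z) h2).
  by under eq_fun do rewrite -!EFinM -EFinB -cReM.
have := integrableD measurableT (integrableZl measurableT (complex.Re z) h2) (integrableZl measurableT (complex.Im z) h1).
by under eq_fun do rewrite -!EFinM -EFinD -cImM.
Qed.

Lemma cintB h k : cint h -> cint k -> cint (fun x => h x - k x).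
Proof.
move=> ih ik; have := cintD ih (cintZ (-1) ik).
by under eq_fun do rewrite mulN1r.
Qed.

Lemma CintegralD h k : cint h -> cint k ->
  Cintegral setT (fun x => h x + k x) = Cintegral setT h + Cintegral setT k.
Proof.
move=> [h1 h2] [k1 k2]; rewrite /Cintegral.
under eq_Rintegral do rewrite cReD.
under [X in Complex _ X]eq_Rintegral do rewrite cImD.
by rewrite !RintegralD.
Qed.

Lemma CintegralZ z h : cint h ->
  Cintegral setT (fun x => z * h x) = z * Cintegral setT h.
Proof.
move=> [h1 h2]; rewrite /Cintegral; case: z => a b.
under eq_Rintegral do rewrite cReM /=.
under [X in Complex _ X]eq_Rintegral do rewrite cImM /=.
have zl c (f : R -> R) : mu.-integrable setT (fun x => (f x)%:E) -> mu.-integrable setT (fun x => (c * f x)%:E).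
  by move=> fi; have := integrableZl measurableT c fi.
rewrite RintegralB ?RintegralD//; try exact: zl.
rewrite !RintegralZl//= mulrC.
Qed.

Lemma CintegralB h k : cint h -> cint k ->
  Cintegral setT (fun x => h x - k x) = Cintegral setT h - Cintegral setT k.
Proof.
move=> ih ik.
rewrite -[in RHS]mulN1r -CintegralZ// -CintegralD//; last exact: cintZ.
by congr Cintegral; apply/funext => x; rewrite mulN1r.
Qed.

(** With [w] the conjugate of the integral [I] of [h], [|I|^2] is the integral
    of the real part of [w * h], which is at most [|I| * |h|]. When [|h|] is not
    integrable the right-hand side is infinite. *)
Lemma normc_Cintegral_le h : cmeas h ->
  ((Normc.normc (Cintegral setT h))%:E <= \int[mu]_x (Normc.normc (h x))%:E)%E.
Proof.
move=> mh; have [hoo|] := boolP (\int[mu]_x (Normc.normc (h x))%:E < +oo)%E; last first.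
  by rewrite -leNgt leye_eq => /eqP ->; rewrite leey.
have ih : cint h by apply/cintP.
set I := Cintegral setT h; pose w := conjc I.
have mn := measurable_normc mh.
have [I0|In0] := eqVneq (Normc.normc I) 0.
  by rewrite I0; apply: integral_ge0 => x _; rewrite lee_fin normc_ge0.
have In : 0 < Normc.normc I by rewrite lt_neqAle eq_sym In0 normc_ge0.
rewrite -(@lee_pmul2l _ (Normc.normc I)%:E)//.
rewrite -ge0_integralZl//; last 3 first.
- exact/measurable_EFinP.
- by move=> x _; rewrite lee_fin normc_ge0.
- by rewrite lee_fin ltW.
have wI : Normc.normc w = Normc.normc I by rewrite /w; case: I {In0 In w} => a b /=; rewrite sqrrN.
have e : Normc.normc I * Normc.normc I = complex.Re (w * I).
  by rewrite -expr2 normc_sqE cReM /w; case: (I) => a b /=; ring.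
have [iw _] := cintZ w ih.
rewrite -EFinM e -CintegralZ//.
rewrite [X in (X%:E <= _)%E](_ : _ = \int[mu]_x complex.Re (w * h x))//.
rewrite /Rintegral fineK; last exact: (integrable_fin_num measurableT iw).
apply: le_integral => //.
  have := cintZ (real_complex R (Normc.normc I)) ih => icm.
  have /(cintP (cint_meas icm)) := icm => foo.
  apply/integrableP; split; first by apply/measurable_EFinP; exact: measurable_funM.
  apply: le_lt_trans foo; apply: ge0_le_integral => //.
  - by apply: measurableT_comp => //; apply/measurable_EFinP; exact: measurable_funM.
  - by apply/measurable_EFinP; apply: measurable_normc; exact: cint_meas.
  - by move=> x _; rewrite Normc.normcM normc_real -EFinM gee0_abs ?lee_fin ?mulr_ge0 ?normc_ge0// ger0_norm ?normc_ge0.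
move=> x _; rewrite -EFinM lee_fin.
by rewrite (le_trans (ler_norm _))// (le_trans (normRe_le _))// Normc.normcM wI.
Qed.

End complex_toolkit.

(** * Plancherel's identity for integrable complex functions *)

Section complex_plancherel.
Context {R : realType}.
Local Notation mu := (@lebesgue_measure R).
Implicit Types (h k : R -> R[i]) (z w : R[i]).

Lemma cint_mul_bounded h (m : R -> R[i]) (M : R) : cint h -> cmeas m ->
  (forall x, Normc.normc (m x) <= M) -> cint (fun x => h x * m x).
Proof.
move=> ih mm mM; have mh := cint_meas ih.
apply/cintP; first exact: cmeasM.
have M0 : 0 <= M by rewrite (le_trans _ (mM 0))// normc_ge0.
have mn := measurable_normc mh.
apply: (@le_lt_trans _ _ (\int[mu]_x (M%:E * (Normc.normc (h x))%:E))%E).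
  apply: ge0_le_integral => //.
  - by move=> x _; rewrite lee_fin normc_ge0.
  - by apply/measurable_EFinP/measurable_normc; exact: cmeasM.
  - by apply: emeasurable_funM => //; exact/measurable_EFinP.
  - by move=> x _; rewrite -EFinM lee_fin Normc.normcM mulrC ler_wpM2r ?normc_ge0.
rewrite ge0_integralZl//.
- by apply: lte_mul_pinfty => //; apply/cintP.
- exact/measurable_EFinP.
- by move=> x _; rewrite lee_fin normc_ge0.
Qed.

(** The character [exp (- i l x)]. *)
Definition wave (l x : R) : R[i] := Complex (cos (l * x)) (- sin (l * x)).

Lemma normc_wave l x : Normc.normc (wave l x) = 1.
Proof. by rewrite /= sqrrN cos2Dsin2 sqrtr1. Qed.

Lemma cmeas_wave l : cmeas (wave l).
Proof.
split; first exact: measurable_cosMl.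
by apply: measurable_funN; exact: measurable_sinMl.
Qed.

Lemma cint_wave h l : cint h -> cint (fun x => h x * wave l x).
Proof.
by move=> ih; apply: (cint_mul_bounded (M := 1) ih (cmeas_wave l)) => x; rewrite normc_wave.
Qed.

Lemma fourierB h k l : cint h -> cint k ->
  fourier (fun x => h x - k x) l = fourier h l - fourier k l.
Proof.
move=> ih ik; rewrite /fourier/fourier_on -CintegralB; [|exact: cint_wave|exact: cint_wave].
by congr Cintegral; apply/funext => x; rewrite mulrBl.
Qed.

Lemma fourierE h l : cint h -> fourier h l =
  Complex (costr (fun x => complex.Re (h x)) l + sintr (fun x => complex.Im (h x)) l)
          (costr (fun x => complex.Im (h x)) l - sintr (fun x => complex.Re (h x)) l).
Proof.
move=> [h1 h2]; rewrite /fourier/fourier_on/Cintegral/costr/sintr; congr Complex.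
  rewrite -RintegralD//; [|exact: integrable_cosM|exact: integrable_sinM].
  by apply: eq_Rintegral => x _; rewrite cReM /=; ring.
rewrite -RintegralB//; [|exact: integrable_cosM|exact: integrable_sinM].
by apply: eq_Rintegral => x _; rewrite cImM /=; ring.
Qed.

Lemma cmeas_fourier h : cint h -> cmeas (fourier h).
Proof.
move=> ih; have [h1 h2] := ih.
have mc (a : R -> R) : mu.-integrable setT (EFin \o a) -> measurable_fun setT (costr a).
  by move=> ia; apply: continuous_measurable_fun; exact: continuous_costr.
have ms (a : R -> R) : mu.-integrable setT (EFin \o a) -> measurable_fun setT (sintr a).
  by move=> ia; apply: continuous_measurable_fun; exact: continuous_sintr.
split; under eq_fun do rewrite (fourierE _ ih) /=.
  by apply: measurable_funD; [exact: mc|exact: ms].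
by apply: measurable_funB; [exact: mc|exact: ms].
Qed.

Lemma normc_fourier_le h l : cint h ->
  ((Normc.normc (fourier h l))%:E <= CLnorm 1%E h)%E.
Proof.
move=> ih; rewrite CLnorm1E; apply: (le_trans (normc_Cintegral_le (cint_meas (cint_wave l ih)))).
by under eq_integral do rewrite Normc.normcM normc_wave mulr1.
Qed.

Lemma cL2_L12 h : cint h -> cL2 h ->
  L12 (fun x => complex.Re (h x)) /\ L12 (fun x => complex.Im (h x)).
Proof.
move=> [h1 h2] [mh hoo]; have [mh1 mh2] := mh.
have i2 : mu.-integrable setT (fun x => (Normc.normc (h x) ^+ 2)%:E).
  apply/integrableP; split; first by apply/measurable_EFinP; exact: measurable_normc_sq.
  by under eq_integral do rewrite gee0_abs ?lee_fin ?sqr_ge0//.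
split; split => //; apply: (le_integrable measurableT _ _ i2);
  try by apply/measurable_EFinP; exact: measurable_funX.
  by move=> x _ /=; rewrite lee_fin !ger0_norm ?sqr_ge0// normc_sqE lerDl sqr_ge0.
by move=> x _ /=; rewrite lee_fin !ger0_norm ?sqr_ge0// normc_sqE lerDr sqr_ge0.
Qed.

Lemma costrN (a : R -> R) l : costr a (- l) = costr a l.
Proof. by apply: eq_Rintegral => x _; rewrite mulNr cosN. Qed.

Lemma sintrN (a : R -> R) l : mu.-integrable setT (EFin \o a) -> sintr a (- l) = - sintr a l.
Proof.
move=> ia; rewrite -[RHS]mulN1r /sintr -RintegralZl//; last exact: integrable_sinM.
by apply: eq_Rintegral => x _; rewrite mulNr sinN; ring.
Qed.

Lemma ge0_integral_neg (f : R -> \bar R) : measurable_fun setT f -> (forall x, 0 <= f x)%E ->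
  (\int[mu]_x f (- x)%R = \int[mu]_x f x)%E.
Proof.
move=> mf f0; rewrite -(ge0_integral_reflect 0 mf f0).
by apply: eq_integral => x _; rewrite sub0r.
Qed.

(** Let [h = a + i b]. In [|fourier h l|^2 + |fourier h (- l)|^2] the products
    of a transform of [a] with one of [b] cancel, since cosine transforms are
    even in [l] and sine transforms odd; what is left is twice the sum of the
    squared moduli of the transforms of [a] and [b]. *)
Theorem plancherel_L1L2 h : cint h -> cL2 h ->
  energy (fourier h) = ((2 * pi)%:E * energy h)%E.
Proof.
move=> ih Lh; have [La Lb] := cL2_L12 ih Lh.
set a := (fun x => complex.Re (h x)) in La; set b := (fun x => complex.Im (h x)) in Lb.
have [ia ia2] := La; have [ib ib2] := Lb.
pose F l := (Normc.normc (fourier h l) ^+ 2)%:E.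
have mF : measurable_fun setT F.
  by apply/measurable_EFinP; apply: measurable_normc_sq; exact: cmeas_fourier.
have F0 l : (0 <= F l)%E by rewrite lee_fin sqr_ge0.
have ita := integrable_trpower La; have itb := integrable_trpower Lb.
(* The integral is doubled, in order to average over [l] and [- l]. *)
have twoF : (energy (fourier h) + energy (fourier h) =
    2%:E * ((2 * pi * nsq a)%:E + (2 * pi * nsq b)%:E))%E.
  have mFN : measurable_fun setT (fun l : R => F (- l)).
    by apply: (measurableT_comp mF); exact: oppr_measurable.
  rewrite {2}/energy -(ge0_integral_neg mF F0) /energy.
  rewrite -(@ge0_integralD _ _ _ mu setT measurableT F (fun l : R => F (- l)) (fun l _ => F0 l) mF (fun (l : R) _ => F0 (- l)) mFN).
  transitivity (\int[mu]_l (2%:E * ((trpower a l)%:E + (trpower b l)%:E)))%E.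
    apply: eq_integral => l _; rewrite /F !fourierE// !normc_sqE/=.
    rewrite !costrN !sintrN//; rewrite -!EFinD -EFinM /trpower; congr EFin.
    by rewrite /a /b; move: (costr _ _) (costr _ _) (sintr _ _) (sintr _ _) => c c' s s'; ring.
  rewrite integralZl//; last exact: integrableD.
  rewrite integralD//; congr (_ * (_ + _))%E.
    by rewrite -trig_plancherel// /Rintegral fineK//; exact: integrable_fin_num.
  by rewrite -trig_plancherel// /Rintegral fineK//; exact: integrable_fin_num.
have eh : energy h = (nsq a + nsq b)%:E.
  rewrite EFinD -!nsqE// -integralD//.
  by apply: eq_integral => x _; rewrite -EFinD normc_sqE.
rewrite eh; move: twoF; rewrite -EFinD -!EFinM.
case: (energy (fourier h)) (energy_ge0 (fourier h)) => //= r _.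
rewrite -EFinD => -[]; move: (nsq a) (nsq b) (pi : R) => p q s e.
by congr EFin; lra.
Qed.

Lemma CLnorm2_leD h k : cmeas h -> cmeas k ->
  (CLnorm 2%:E (fun x => (h x + k x)%R) <= CLnorm 2%:E h + CLnorm 2%:E k)%E.
Proof.
move=> mh mk.
pose f : R -> R := (fun x => Normc.normc (h x)); pose g : R -> R := (fun x => Normc.normc (k x)).
have mf : measurable_fun setT f by exact: measurable_normc.
have mg : measurable_fun setT g by exact: measurable_normc.
have := @eminkowski _ _ _ mu f g 2%:E mf mg; rewrite lee_fin ler1n => /(_ isT).
apply: le_trans; rewrite CLnorm2E unlock.
have i0 : (0 <= \int[mu]_x (`|(EFin \o (f \+ g)%R) x| `^ 2))%E.
  by apply: integral_ge0 => x _; exact: poweR_ge0.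
apply: gt0_ler_poweR.
- by rewrite invr_ge0.
- by rewrite in_itv/= energy_ge0 leey.
- by rewrite in_itv/= i0 leey.
apply: ge0_le_integral => //.
- by move=> x _; rewrite lee_fin sqr_ge0.
- by apply/measurable_EFinP; apply: measurable_normc_sq; exact: cmeasD.
- have -> : (fun x => `|(EFin \o (f \+ g)%R) x| `^ 2)%E = (fun x => ((f x + g x) ^+ 2)%:E).
    by apply/funext => x /=; rewrite powR_mulrn// real_normK// num_real.
  by apply/measurable_EFinP; apply: measurable_funX; exact: measurable_funD.
- move=> x _ /=; rewrite lee_fin powR_mulrn// real_normK ?num_real//.
  by rewrite lerXn2r ?nnegrE ?addr_ge0 ?normc_ge0// normcD_le.
Qed.

Lemma energy_le h k (M : R) : cmeas h -> cmeas k -> 0 <= M ->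
  (forall x, Normc.normc (h x) <= M * Normc.normc (k x)) ->
  (energy h <= (M ^+ 2)%:E * energy k)%E.
Proof.
move=> mh mk M0 hk.
rewrite /energy -ge0_integralZl//; last 3 first.
- by apply/measurable_EFinP; exact: measurable_normc_sq.
- by move=> x _; rewrite lee_fin sqr_ge0.
- by rewrite lee_fin sqr_ge0.
apply: ge0_le_integral => //.
- by move=> x _; rewrite lee_fin sqr_ge0.
- by apply/measurable_EFinP; exact: measurable_normc_sq.
- by apply: emeasurable_funM => //; apply/measurable_EFinP; exact: measurable_normc_sq.
- by move=> x _; rewrite -EFinM lee_fin -exprMn lerXn2r ?nnegrE ?normc_ge0// mulr_ge0// normc_ge0.
Qed.

(** The L2 norm as a real number, to which limits and ring identities apply; it
    is faithful on L2 by [CLnorm2_nrm]. *)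
Definition nrm h : R := fine (CLnorm 2%:E h).

Lemma nrm_ge0 h : 0 <= nrm h.
Proof. by apply: fine_ge0; exact: Lnorm_ge0. Qed.

Lemma CLnorm2_nrm h : cL2 h -> CLnorm 2%:E h = (nrm h)%:E.
Proof.
move=> /in_CLp2P[_ _ hoo]; rewrite /nrm fineK// ge0_fin_numE//; exact: Lnorm_ge0.
Qed.

Lemma energy_nrm h : cL2 h -> energy h = (nrm h ^+ 2)%:E.
Proof. by move=> Lh; rewrite -CLnorm2_sqr CLnorm2_nrm// -EFin_expe. Qed.

Lemma cL2D h k : cL2 h -> cL2 k -> cL2 (fun x => h x + k x).
Proof.
move=> Lh Lk; have mh := Lh.1; have mk := Lk.1.
apply/in_CLp2P; have [? ?] := cmeasD mh mk; split=> //.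
apply: (le_lt_trans (CLnorm2_leD mh mk)).
by rewrite !CLnorm2_nrm// -EFinD ltry.
Qed.

Lemma nrmD_le h k : cL2 h -> cL2 k -> nrm (fun x => h x + k x) <= nrm h + nrm k.
Proof.
move=> Lh Lk; rewrite -lee_fin EFinD -!CLnorm2_nrm//; last exact: cL2D.
by apply: CLnorm2_leD; [exact: Lh.1|exact: Lk.1].
Qed.

Lemma cL2_le h k (M : R) : cmeas h -> 0 <= M ->
  (forall x, Normc.normc (h x) <= M * Normc.normc (k x)) -> cL2 k -> cL2 h.
Proof.
move=> mh M0 hk Lk; split=> //.
apply: (le_lt_trans (energy_le mh Lk.1 M0 hk)).
by rewrite energy_nrm// -EFinM ltry.
Qed.

Lemma nrm_le h k (M : R) : cmeas h -> 0 <= M ->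
  (forall x, Normc.normc (h x) <= M * Normc.normc (k x)) -> cL2 k -> nrm h <= M * nrm k.
Proof.
move=> mh M0 hk Lk; have Lh := cL2_le mh M0 hk Lk.
have := energy_le mh Lk.1 M0 hk; rewrite !energy_nrm// -EFinM lee_fin -exprMn.
by rewrite ler_pXn2r// nnegrE ?mulr_ge0 ?nrm_ge0.
Qed.

Lemma cmeasN h : cmeas h -> cmeas (fun x => - h x).
Proof.
move=> [h1 h2]; have ReN z : complex.Re (- z) = - complex.Re z by case: z.
have ImN z : complex.Im (- z) = - complex.Im z by case: z.
by split; [under eq_fun do rewrite ReN|under eq_fun do rewrite ImN]; exact: measurable_funN.
Qed.

Lemma cL2N h : cL2 h -> cL2 (fun x => - h x).
Proof.
move=> Lh; apply: (cL2_le (k := h) (M := 1)) => //; first exact: cmeasN Lh.1.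
by move=> x; rewrite normc_opp mul1r.
Qed.

Lemma nrmN h : nrm (fun x => - h x) = nrm h.
Proof.
rewrite /nrm !CLnorm2E; congr (fine (_ `^ _)).
by apply: eq_integral => x _; rewrite normc_opp.
Qed.

Lemma cL2B h k : cL2 h -> cL2 k -> cL2 (fun x => h x - k x).
Proof. by move=> Lh Lk; apply: cL2D => //; exact: cL2N. Qed.

Lemma nrmB_le h k : cL2 h -> cL2 k -> nrm (fun x => h x - k x) <= nrm h + nrm k.
Proof.
move=> Lh Lk; rewrite -(nrmN k); apply: nrmD_le => //; exact: cL2N.
Qed.

Lemma cL2_fourier h : cint h -> cL2 h -> cL2 (fourier h).
Proof.
move=> ih Lh; split; first exact: cmeas_fourier.
by rewrite plancherel_L1L2// energy_nrm// -EFinM ltry.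
Qed.

Lemma nrm_fourier h : cint h -> cL2 h -> nrm (fourier h) = Num.sqrt (2 * pi) * nrm h.
Proof.
move=> ih Lh; have := plancherel_L1L2 ih Lh.
rewrite !energy_nrm//; last exact: cL2_fourier.
rewrite -EFinM => -[e]; apply/eqP.
rewrite -(@eqrXn2 _ 2)// ?mulr_ge0 ?nrm_ge0 ?sqrtr_ge0//.
by rewrite e exprMn sqr_sqrtr// mulr_ge0// pi_ge0.
Qed.

End complex_plancherel.

(** * Completeness of L2 *)

Section completeness.
Context {R : realType}.
Local Notation mu := (@lebesgue_measure R).
Implicit Types (h k : R -> R[i]) (z w : R[i]).

Lemma sum_half_le (n : nat) : \sum_(0 <= j < n) (2^-1 : R) ^+ j <= 2.
Proof.
suff -> : \sum_(0 <= j < n) (2^-1 : R) ^+ j = 2 - 2 * 2^-1 ^+ n.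
  by rewrite lerBlDr lerDl mulr_ge0// exprn_ge0// invr_ge0.
elim: n => [|n IH]; first by rewrite big_geq// expr0; lra.
by rewrite big_nat_recr//= IH exprS; field.
Qed.

(** As [d <= 2^-j + 2^j * d^2], the increments of [w] are absolutely
    summable. *)
Lemma cvg_weighted_increments (w : nat -> R) (S : R) :
  (forall n, \sum_(0 <= j < n) (2 ^+ j * (w j.+1 - w j) ^+ 2) <= S) -> cvgn w.
Proof.
move=> hS.
have ht : cvgn (series (telescope w)).
  apply: (@normed_cvg R R^o); apply: nondecreasing_is_cvgn.
    by apply/nondecreasing_seqP => n; rewrite /series/= [leRHS]big_nat_recr//= lerDl.
  exists (2 + S); apply/ubP => _ [n _ <-]; rewrite /series/=.
  apply: (@le_trans _ _ (\sum_(0 <= j < n) (2^-1 ^+ j + 2 ^+ j * (w j.+1 - w j) ^+ 2))); last first.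
    by rewrite big_split/= lerD// sum_half_le.
  apply: ler_sum_nat => j _; rewrite /telescope.
  have a0 : 0 < (2 : R) ^+ j by rewrite exprn_gt0.
  rewrite exprVn -[(w _ - _) ^+ 2]real_normK ?num_real//.
  move: (2 ^+ j) a0 `|w j.+1 - w j| => a a0 b.
  rewrite -(ler_pM2l a0) mulrDr mulfV ?gt_eqF// expr2.
  (* [a * b <= 1 + (a * b)^2], where [a = 2^j] and [b] is the increment. *)
  by have := sqr_ge0 (a * b - 2^-1); rewrite expr2; nra.
have -> : w = (fun n => w 0%N + series (telescope w) n).
  by apply/funext => n; exact: eq_sum_telescope.
by apply: is_cvgD => //; exact: is_cvg_cst.
Qed.

Lemma limn_einf_le (u : nat -> \bar R) (c : \bar R) : (forall n, (u n <= c)%E) ->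
  (limn_einf u <= c)%E.
Proof.
move=> uc; rewrite limn_einf_lim; apply: lime_le; first exact: is_cvg_einfs.
apply: nearW => n; apply: (le_trans _ (uc n)).
by apply: ereal_inf_lbound; exists n => /=.
Qed.

Lemma energy_fatou (k : nat -> R -> R[i]) (v : R -> R[i]) (c : \bar R) :
  (forall n, cmeas (k n)) -> cmeas v ->
  {ae mu, forall x, Normc.normc (k n x) ^+ 2 @[n --> \oo] --> Normc.normc (v x) ^+ 2} ->
  (forall n, (energy (k n) <= c)%E) -> (energy v <= c)%E.
Proof.
move=> mk mv kv kc.
have mk2 n : measurable_fun setT (fun x => (Normc.normc (k n x) ^+ 2)%:E).
  by apply/measurable_EFinP; apply: measurable_normc_sq.
have -> : energy v = (\int[mu]_x limn_einf (fun n => (Normc.normc (k n x) ^+ 2)%:E))%E.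
  apply: ae_eq_integral => //.
  - by apply/measurable_EFinP; apply: measurable_normc_sq.
  - rewrite (_ : (fun x => _) = (fun x => - limn_esup (-%E \o (fun n => (Normc.normc (k n x) ^+ 2)%:E)))%E); last first.
      by apply/funext => x; rewrite limn_esupN oppeK.
    apply: measurableT_comp => //; apply: measurable_fun_limn_esup => n.
    by apply: measurableT_comp (mk2 n); exact: oppe_measurable.
  - move: kv; apply: (@filterS _ _ (ae_filter_ringOfSetsType mu)) => x h _.
    have /cvg_limn_einf_sup[-> _] // : (fun n => (Normc.normc (k n x) ^+ 2)%:E) n @[n --> \oo] --> (Normc.normc (v x) ^+ 2)%:E.
    by apply: cvg_EFin; [exact: nearW|exact: h].
apply: (le_trans (fatou _ _ _ _)) => //.
  by move=> n x _; rewrite lee_fin sqr_ge0.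
by apply: limn_einf_le => n; exact: kc.
Qed.

(** Riesz-Fischer. Along a subsequence whose [j]-th increment has norm at most
    [2^-j], the squared increments weighted by [2^j] have a finite total
    integral. The subsequence therefore converges almost everywhere
    ([cvg_weighted_increments]), and Fatou's lemma turns the Cauchy condition
    into convergence in norm. *)
Lemma cL2_complete (u : nat -> R -> R[i]) : (forall n, cL2 (u n)) ->
  (forall d : R, 0 < d -> exists N, forall n m, (N <= n)%N -> (N <= m)%N ->
     nrm (fun x => u n x - u m x) <= d) ->
  exists v, cL2 v /\ nrm (fun x => u n x - v x) @[n --> \oo] --> 0.
Proof.
move=> Lu hC.
have /choice[N hN] : forall j : nat, exists N, forall n m, (N <= n)%N -> (N <= m)%N ->
     nrm (fun x => u n x - u m x) <= 2^-1 ^+ j.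
  by move=> j; apply: hC; rewrite exprn_gt0// invr_gt0.
(* An increasing sequence of indices with [N j <= s j]. *)
pose s j := (\sum_(0 <= i < j.+1) (N i).+1)%N.
have sSE j : s j.+1 = (s j + (N j.+1).+1)%N by rewrite /s big_nat_recr.
have sS j : (s j <= s j.+1)%N by rewrite sSE leq_addr.
have sN j : (N j <= s j)%N.
  by rewrite /s big_nat_recr//= (leq_trans (leqnSn _))// leq_addl.
have sj j : (j <= s j)%N.
  by elim: j => // j IH; rewrite sSE addnS ltnS (leq_trans IH)// leq_addr.
pose d j x := u (s j.+1) x - u (s j) x.
have Ld j : cL2 (d j) by exact: cL2B.
have ed j : (energy (d j) <= (4^-1 ^+ j)%:E)%E.
  rewrite energy_nrm// lee_fin.
  have -> : (4^-1 : R) ^+ j = (2^-1 ^+ j) ^+ 2.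
    by rewrite -exprM mulnC exprM; congr (_ ^+ _); field.
  rewrite lerXn2r ?nnegrE ?nrm_ge0 ?exprn_ge0 ?invr_ge0//.
  by apply: hN => //; rewrite (leq_trans (sN j)).
pose T j x := ((2 ^+ j)%:E * (Normc.normc (d j x) ^+ 2)%:E)%E.
have mn j : measurable_fun setT (fun x => (Normc.normc (d j x) ^+ 2)%:E).
  by apply/measurable_EFinP; apply: measurable_normc_sq; exact: (Ld j).1.
have mT j : measurable_fun setT (T j) by apply: emeasurable_funM => //.
have T0 j x : (0 <= T j x)%E by rewrite /T -EFinM lee_fin mulr_ge0 ?sqr_ge0// exprn_ge0.
pose S x := (\sum_(0 <= j <oo) T j x)%E.
have mS : measurable_fun setT S.
  by apply: (ge0_emeasurable_sum (P := xpredT)) => // j x _ _; exact: T0.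
have S0 x : (0 <= S x)%E by exact: nneseries_ge0.
have iS : mu.-integrable setT S.
  apply/integrableP; split => //; under eq_integral do rewrite gee0_abs//.
  rewrite integral_nneseries//; apply: (@le_lt_trans _ _ 2%:E); last exact: ltry.
  apply: lime_le; first by apply: is_cvg_nneseries => n _ _; exact: integral_ge0.
  apply: nearW => n; apply: (@le_trans _ _ (\sum_(0 <= j < n) (2^-1 ^+ j)%:E)%E); last first.
    by rewrite sumEFin lee_fin sum_half_le.
  apply: lee_sum => j _; rewrite ge0_integralZl//.
  - apply: (@le_trans _ _ ((2 ^+ j)%:E * (4^-1 ^+ j)%:E)%E).
      by rewrite lee_pmul2l ?lte_fin ?exprn_gt0//; exact: ed.
    rewrite -EFinM lee_fin -exprMn.
    by have -> : 2 * 4^-1 = 2^-1 :> R by field.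
  - exact: mn.
  - by move=> x _; rewrite lee_fin sqr_ge0.
have aeS : {ae mu, forall x, S x \is a fin_num}.
  by have := integrable_ae measurableT iS; apply: (@filterS _ _ (ae_filter_ringOfSetsType mu)) => x; exact.
(* The upper limits are measurable in [x], and they are the limits wherever the
   subsequence converges. *)
pose v x : R[i] := Complex (fine (limn_esup (fun j => (complex.Re (u (s j) x))%:E)))
                    (fine (limn_esup (fun j => (complex.Im (u (s j) x))%:E))).
have mv : cmeas v.
  split; apply: measurableT_comp => //; apply: measurable_fun_limn_esup => j; apply/measurable_EFinP.
    exact: (Lu (s j)).1.1.
  exact: (Lu (s j)).1.2.
have cv : {ae mu, forall x, complex.Re (u (s j) x) @[j --> \oo] --> complex.Re (v x) /\
      complex.Im (u (s j) x) @[j --> \oo] --> complex.Im (v x)}.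
  move: aeS; apply: (@filterS _ _ (ae_filter_ringOfSetsType mu)) => x Sx.
  have hs n : \sum_(0 <= j < n) (2 ^+ j * Normc.normc (d j x) ^+ 2) <= fine (S x).
    rewrite -lee_fin fineK// -sumEFin.
    by apply: (nneseries_lim_ge (u_ := T ^~ x)) => j _ _; exact: T0.
  have esup_lim (w : nat -> R) : cvgn w -> w n @[n --> \oo] --> fine (limn_esup (EFin \o w)).
    move=> /cvg_ex[l wl].
    have /cvg_limn_einf_sup[_ ->] // : (EFin \o w) n @[n --> \oo] --> l%:E.
    by apply: cvg_EFin; [exact: nearW|exact: wl].
  split; apply: esup_lim; apply: (cvg_weighted_increments (S := fine (S x))) => n; apply: le_trans (hs n);
    apply: ler_sum_nat => j _; rewrite ler_wpM2l ?exprn_ge0// normc_sqE /d ?cReB ?cImB.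
    by rewrite lerDl sqr_ge0.
  by rewrite lerDr sqr_ge0.
have key n (e : R) (K : nat) : 0 <= e -> (forall j, (K <= j)%N -> nrm (fun x => u n x - u j x) <= e) ->
   (energy (fun x => (u n x - v x)%R) <= (e ^+ 2)%:E)%E.
  move=> e0 hK.
  have hK' j : (K <= j)%N -> nrm (fun x => u n x - u (s j) x) <= e.
    by move=> Kj; apply: hK; rewrite (leq_trans Kj).
  apply: (energy_fatou (k := fun j x => u n x - u (s (j + K)%N) x)).
  - by move=> j; apply: cmeasB; exact: (Lu _).1.
  - by apply: cmeasB => //; exact: (Lu _).1.
  - move: cv; apply: (@filterS _ _ (ae_filter_ringOfSetsType mu)) => x [c1 c2].
    under eq_fun do rewrite normc_sqE cReB cImB; rewrite normc_sqE cReB cImB.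
    have sq (w : nat -> R) (a l : R) : w n @[n --> \oo] --> l -> (a - w (n + K)%N) ^+ 2 @[n --> \oo] --> (a - l) ^+ 2.
      move=> wl; have h : a - w (n + K)%N @[n --> \oo] --> a - l.
        by apply: cvgB; [exact: cvg_cst|rewrite cvg_shiftn].
      exact: (cvgM h h).
    by apply: cvgD; [exact: (sq _ _ _ c1)|exact: (sq _ _ _ c2)].
  - move=> j; rewrite energy_nrm; last exact: cL2B.
    by rewrite lee_fin lerXn2r ?nnegrE ?nrm_ge0// hK'// leq_addl.
have Lv : cL2 v.
  have [N1 hN1] := hC 1 ltr01.
  have e1 := key N1 1 N1 ler01 (fun j => hN1 N1 j (leqnn N1)).
  have Lw : cL2 (fun x => u N1 x - v x).
    by split; [apply: cmeasB => //; exact: (Lu _).1|apply: le_lt_trans e1 _; exact: ltry].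
  have -> : v = (fun x => u N1 x - (u N1 x - v x)).
    by apply/funext => x; rewrite opprB addrCA subrr addr0.
  exact: cL2B.
exists v; split => //.
apply/cvgrPdist_le => e e0.
have [N1 hN1] := hC e e0.
exists N1 => // n /= N1n.
have := key n e N1 (ltW e0) (fun j => hN1 n j N1n).
rewrite energy_nrm; last exact: cL2B.
rewrite lee_fin sub0r normrN ger0_norm ?nrm_ge0//.
by rewrite ler_pXn2r// nnegrE ?nrm_ge0// ltW.
Qed.

End completeness.

(** * The Fourier-Plancherel transform *)

Section fourierL2_theory.
Context {R : realType}.
Local Notation mu := (@lebesgue_measure R).
Implicit Types (h k H K : R -> R[i]) (D : set R).

Lemma cvg_nrm_dominated (k : nat -> R -> R[i]) h : cL2 h -> (forall n, cmeas (k n)) ->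
  (forall n x, Normc.normc (k n x) <= Normc.normc (h x)) ->
  (forall x, Normc.normc (k n x) @[n --> \oo] --> 0) ->
  nrm (k n) @[n --> \oo] --> 0.
Proof.
move=> Lh mk kh k0.
have Lk n : cL2 (k n).
  by apply: (cL2_le (mk n) ler01 _ Lh) => x; rewrite mul1r.
have mk2 n : measurable_fun setT (fun x => (Normc.normc (k n x) ^+ 2)%:E).
  by apply/measurable_EFinP; apply: measurable_normc_sq.
have i2 : mu.-integrable setT (fun x => (Normc.normc (h x) ^+ 2)%:E).
  apply/integrableP; split; first by apply/measurable_EFinP; exact: measurable_normc_sq Lh.1.
  by under eq_integral do rewrite gee0_abs ?lee_fin ?sqr_ge0//; exact: Lh.2.
have c0 : {ae mu, forall x, setT x -> (fun n => (Normc.normc (k n x) ^+ 2)%:E) n @[n --> \oo] --> 0%E}.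
  apply: nearW => x _; apply: cvg_EFin; first exact: nearW.
  by have := cvgM (k0 x) (k0 x); rewrite mulr0 => hh; exact: hh.
have d0 : {ae mu, forall x n, setT x -> (`|(Normc.normc (k n x) ^+ 2)%:E| <= (Normc.normc (h x) ^+ 2)%:E)%E}.
  apply: nearW => x n _; rewrite gee0_abs ?lee_fin ?sqr_ge0//.
  by rewrite lerXn2r ?nnegrE ?normc_ge0.
have [_ _ ] := @dominated_convergence _ _ R mu setT measurableT
   (fun n x => (Normc.normc (k n x) ^+ 2)%:E) (fun=> 0%E) (fun x => (Normc.normc (h x) ^+ 2)%:E)
   mk2 (measurable_cst _) c0 i2 d0.
rewrite integral0 => /fine_cvgP [_ hc].
apply/cvgrPdist_le => e e0.
move/cvgrPdist_le : hc => /(_ (e ^+ 2)); rewrite exprn_gt0// => /(_ isT).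
apply: filterS => n /=; rewrite -/(energy (k n)) energy_nrm//= !sub0r !normrN.
by rewrite !ger0_norm ?sqr_ge0 ?nrm_ge0// ler_pXn2r// nnegrE ?nrm_ge0// ltW.
Qed.

Definition clip D h (x : R) : R[i] := if x \in D then h x else 0.

Lemma cmeas_clip D h : measurable D -> cmeas h -> cmeas (clip D h).
Proof.
move=> mD [h1 h2]; split.
  have -> : (fun x => complex.Re (clip D h x)) = (fun x => \1_D x * complex.Re (h x)).
    by apply/funext => x; rewrite /clip indicE; case: (_ \in _); rewrite ?mul1r ?mul0r.
  exact: measurable_funM.
have -> : (fun x => complex.Im (clip D h x)) = (fun x => \1_D x * complex.Im (h x)).
  by apply/funext => x; rewrite /clip indicE; case: (_ \in _); rewrite ?mul1r ?mul0r.
exact: measurable_funM.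
Qed.

Lemma normc0 : Normc.normc (0 : R[i]) = 0.
Proof. by rewrite /= expr0n/= addr0 sqrtr0. Qed.

Lemma normc_clip_le D h x : Normc.normc (clip D h x) <= Normc.normc (h x).
Proof. by rewrite /clip; case: (_ \in _); rewrite ?normc0 ?normc_ge0. Qed.

Lemma cL2_clip D h : measurable D -> cL2 h -> cL2 (clip D h).
Proof.
move=> mD Lh; apply: (cL2_le (M := 1) _ _ _ Lh) => //; first exact: cmeas_clip Lh.1.
by move=> x; rewrite mul1r normc_clip_le.
Qed.

(** On [D], which has finite measure, [|h| <= 1 + |h|^2]. *)
Lemma cint_clip_L2 D h : measurable D -> (mu D < +oo)%E -> cL2 h -> cint (clip D h).
Proof.
move=> mD Doo Lh; have mh := Lh.1.
have mc := cmeas_clip mD mh.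
apply/cintP => //.
apply: (@le_lt_trans _ _ (\int[mu]_x ((\1_D x)%:E + (Normc.normc (h x) ^+ 2)%:E))%E).
  apply: ge0_le_integral => //.
  - by move=> x _; rewrite lee_fin normc_ge0.
  - by apply/measurable_EFinP; exact: measurable_normc.
  - apply: emeasurable_funD; first exact/measurable_EFinP.
    by apply/measurable_EFinP; exact: measurable_normc_sq.
  - move=> x _; rewrite -EFinD lee_fin /clip indicE; case: (_ \in _).
      by have := sqr_ge0 (Normc.normc (h x) - 2^-1); rewrite (_ : true%:R = 1 :> R)// !expr2; move: (Normc.normc _) => r; nra.
    by rewrite normc0 add0r sqr_ge0.
rewrite ge0_integralD//.
- by rewrite integral_indic// setIT lte_add_pinfty//; exact: Lh.2.
- exact/measurable_EFinP.
- by move=> x _; rewrite lee_fin sqr_ge0.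
- by apply/measurable_EFinP; exact: measurable_normc_sq.
Qed.

Lemma fourier_on_clip D h l : fourier_on D h l = fourier (clip D h) l.
Proof.
rewrite /fourier /fourier_on /Cintegral; congr Complex.
  rewrite Rintegral_mkcond; apply: eq_Rintegral => x _.
  by rewrite patchE /clip; case: (_ \in _) => //; rewrite mul0r.
rewrite Rintegral_mkcond; apply: eq_Rintegral => x _.
by rewrite patchE /clip; case: (_ \in _) => //; rewrite mul0r.
Qed.

Definition window (n : nat) : set R := `[- n%:R, n%:R]%classic.

Lemma measurable_window n : measurable (window n).
Proof. exact: measurable_itv. Qed.

Lemma window_lty n : (mu (window n) < +oo)%E.
Proof. by rewrite lebesgue_measure_itv/=; case: ifP => // _; rewrite -EFinB ltry. Qed.

Lemma near_window (x : R) : \forall n \near \oo, x \in window n.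
Proof.
apply: filterS (nbhs_infty_ger `|x|) => n h.
by rewrite inE /window/= in_itv/= -ler_norml.
Qed.

Lemma cint_window n h : cL2 h -> cint (clip (window n) h).
Proof. by move=> Lh; apply: cint_clip_L2 => //; [exact: measurable_window|exact: window_lty]. Qed.

Lemma cL2_window n h : cL2 h -> cL2 (clip (window n) h).
Proof. by move=> Lh; apply: cL2_clip => //; exact: measurable_window. Qed.

Lemma cvg_tail h : cL2 h -> nrm (fun x => h x - clip (window n) h x) @[n --> \oo] --> 0.
Proof.
move=> Lh; apply: (cvg_nrm_dominated Lh).
- by move=> n; apply: cmeasB; [exact: Lh.1|exact: (cL2_window n Lh).1].
- by move=> n x; rewrite /clip; case: (_ \in _); rewrite ?subr0// subrr normc0 normc_ge0.
- move=> x; apply: cvg_near_cst; apply: filterS (near_window x) => n.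
  by rewrite /clip => ->; rewrite subrr normc0.
Qed.

(** The defining condition, with the truncations of [h] seen as functions on the
    whole line, to which [plancherel_L1L2] applies. *)
Lemma is_fourierL2P h H : cL2 h -> is_fourierL2 h H <->
  cL2 H /\ nrm (fun l => H l - fourier (clip (window n) h) l) @[n --> \oo] --> 0.
Proof.
move=> Lh.
have LF n : cL2 (fourier (clip (window n) h)).
  by apply: cL2_fourier; [exact: cint_window|exact: cL2_window].
have e n : (fun l => H l - fourier_on (window n) h l) = (fun l => H l - fourier (clip (window n) h) l).
  by apply/funext => l; rewrite fourier_on_clip.
have ee n : CLnorm 2%:E (fun l => (H l - fourier_on (window n) h l)%R) = CLnorm 2%:E (fun l => (H l - fourier (clip (window n) h) l)%R).
  by rewrite e.
split=> [[/in_CLp2P LH hc]|[LH hc]]; split=> //.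
- by have /fine_cvgP[_] := hc; rewrite /comp; under eq_fun do rewrite ee.
- exact/in_CLp2P.
- have e2 : (fun n => CLnorm 2%:E (fun l => (H l - fourier_on (window n) h l)%R)) =
     (fun n => (nrm (fun l => H l - fourier (clip (window n) h) l))%:E).
    by apply/funext => n; rewrite ee CLnorm2_nrm//; exact: cL2B.
  have : (nrm (fun l => H l - fourier (clip (window n) h) l))%:E @[n --> \oo] --> 0%:E.
    by apply: cvg_EFin; [exact: nearW|exact: hc].
  by rewrite -e2.
Qed.

Lemma nrm_fourierB h k : cint h -> cL2 h -> cint k -> cL2 k ->
  nrm (fun l => fourier h l - fourier k l) = Num.sqrt (2 * pi) * nrm (fun x => h x - k x).
Proof.
move=> ih Lh ik Lk; rewrite -nrm_fourier; [|exact: cintB|exact: cL2B].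
by congr nrm; apply/funext => l; rewrite fourierB.
Qed.

Let c2pi : R := Num.sqrt (2 * pi).
Let c2pi_gt0 : 0 < c2pi.
Proof. by rewrite sqrtr_gt0 mulr_gt0// pi_gt0. Qed.

(** The truncations of [h] form a Cauchy sequence, hence so do their transforms,
    by Plancherel's identity; [cL2_complete] provides the limit. *)
Lemma ex_fourierL2 h : cL2 h -> exists H, is_fourierL2 h H.
Proof.
move=> Lh.
have LF n : cL2 (fourier (clip (window n) h)).
  by apply: cL2_fourier; [exact: cint_window|exact: cL2_window].
have hC (d : R) : 0 < d -> exists N, forall n m, (N <= n)%N -> (N <= m)%N ->
    nrm (fun l => fourier (clip (window n) h) l - fourier (clip (window m) h) l) <= d.
  move=> d0.
  have /cvgrPdist_le/(_ (d / (2 * c2pi))) := cvg_tail Lh.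
  rewrite divr_gt0 ?mulr_gt0// => /(_ isT) [N _ hN].
  exists N => n m nN mN.
  rewrite (nrm_fourierB (cint_window n Lh) (cL2_window n Lh) (cint_window m Lh) (cL2_window m Lh)).
  have := hN n nN; have := hN m mN; rewrite /= !sub0r !normrN !ger0_norm ?nrm_ge0// => h1 h2.
  have -> : (fun x => clip (window n) h x - clip (window m) h x) =
     (fun x => (h x - clip (window m) h x) - (h x - clip (window n) h x)).
    by apply/funext => x; ring.
  apply: (@le_trans _ _ (c2pi * (d / (2 * c2pi) + d / (2 * c2pi)))).
    rewrite ler_wpM2l ?(ltW c2pi_gt0)//.
    apply: (le_trans (nrmB_le _ _)); try (by apply: cL2B => //; exact: cL2_window).
    exact: lerD.
  have c0 : c2pi != 0 by rewrite gt_eqF.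
  move: c2pi c0 => c c0.
  by rewrite le_eqVlt; apply/orP; left; apply/eqP; field.
have [H [LH hc]] := cL2_complete LF hC.
exists H; apply/is_fourierL2P => //; split => //.
move: hc; under eq_fun do rewrite -nrmN.
by under eq_fun do under [X in nrm X]eq_fun do rewrite opprB.
Qed.

Lemma fourierL2P h : cL2 h -> is_fourierL2 h (fourierL2 h).
Proof. by move=> /ex_fourierL2 [H hH]; exact: (xgetPex _ (ex_intro _ H hH)). Qed.

Lemma is_fourierL2B h k H K : cL2 h -> cL2 k -> is_fourierL2 h H -> is_fourierL2 k K ->
  is_fourierL2 (fun x => h x - k x) (fun l => H l - K l).
Proof.
move=> Lh Lk /(is_fourierL2P _ Lh)[LH hH] /(is_fourierL2P _ Lk)[LK hK].
apply/is_fourierL2P; first exact: cL2B.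
split; first exact: cL2B.
have LF n g : cL2 g -> cL2 (fourier (clip (window n) g)).
  by move=> Lg; apply: cL2_fourier; [exact: cint_window|exact: cL2_window].
have hHK : nrm (fun l => H l - fourier (clip (window n) h) l) +
    nrm (fun l => K l - fourier (clip (window n) k) l) @[n --> \oo] --> 0.
  by rewrite -[X in _ --> X](addr0 (0 : R)); exact: cvgD.
apply: (squeeze_cvgr _ (cvg_cst (0 : R)) hHK); apply: nearW => n; rewrite nrm_ge0/=.
have -> : (fun l => H l - K l - fourier (clip (window n) (fun x => h x - k x)) l) =
   (fun l => (H l - fourier (clip (window n) h) l) - (K l - fourier (clip (window n) k) l)).
  apply/funext => l.
  have -> : clip (window n) (fun x => h x - k x) = (fun x => clip (window n) h x - clip (window n) k x).
    by apply/funext => x; rewrite /clip; case: (_ \in _); rewrite ?subr0.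
  by rewrite (fourierB l (cint_window n Lh) (cint_window n Lk)); ring.
by apply: nrmB_le; apply: cL2B => //; exact: LF.
Qed.

Lemma nrm_dist_le h k : cL2 h -> cL2 k -> `|nrm h - nrm k| <= nrm (fun x => h x - k x).
Proof.
move=> Lh Lk; rewrite ler_norml; apply/andP; split.
  rewrite lerNl opprB lerBlDr.
  have -> : nrm k = nrm (fun x => h x - (h x - k x)).
    by congr nrm; apply/funext => x; ring.
  by rewrite addrC; apply: nrmB_le => //; exact: cL2B.
rewrite lerBlDr.
have {1}-> : h = (fun x => (h x - k x) + k x) by apply/funext => x; ring.
by apply: nrmD_le => //; exact: cL2B.
Qed.

(** Plancherel's identity holds for the truncations and passes to the limit, as
    the norm is 1-Lipschitz. *)
Lemma is_fourierL2_nrm h H : cL2 h -> is_fourierL2 h H -> nrm H = c2pi * nrm h.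
Proof.
move=> Lh /(is_fourierL2P _ Lh)[LH hH].
have LF n : cL2 (fourier (clip (window n) h)).
  by apply: cL2_fourier; [exact: cint_window|exact: cL2_window].
have c1 : nrm (fourier (clip (window n) h)) @[n --> \oo] --> nrm H.
  apply/cvgrPdist_le => e e0; move/cvgrPdist_le : hH => /(_ e e0); apply: filterS => n.
  by rewrite sub0r normrN ger0_norm ?nrm_ge0//; apply: le_trans; exact: nrm_dist_le.
have c2 : nrm (clip (window n) h) @[n --> \oo] --> nrm h.
  apply/cvgrPdist_le => e e0; have /cvgrPdist_le/(_ e e0) := cvg_tail Lh; apply: filterS => n.
  rewrite sub0r normrN ger0_norm ?nrm_ge0//; apply: le_trans; apply: nrm_dist_le => //.
  exact: cL2_window.
have c3 : nrm (fourier (clip (window n) h)) @[n --> \oo] --> c2pi * nrm h.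
  under eq_fun => n do rewrite (nrm_fourier (cint_window n Lh) (cL2_window n Lh)).
  by apply: cvgMr.
by rewrite -(cvg_lim (@Rhausdorff R) c1) (cvg_lim (@Rhausdorff R) c3).
Qed.

(** The identity of Plancherel, applied to the tails of [h], shows that the
    transforms of the truncations also converge to the transform defined by the
    integral. *)
Lemma is_fourierL2_L1 h : cint h -> cL2 h -> is_fourierL2 h (fourier h).
Proof.
move=> ih Lh; apply/is_fourierL2P => //; split; first exact: cL2_fourier.
have -> : (fun n => nrm (fun l => fourier h l - fourier (clip (window n) h) l)) =
    (fun n => c2pi * nrm (fun x => h x - clip (window n) h x)).
  by apply/funext => n; rewrite (nrm_fourierB ih Lh (cint_window n Lh) (cL2_window n Lh)).
have : c2pi * nrm (fun x => h x - clip (window n) h x) @[n --> \oo] --> c2pi * 0.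
  by apply: cvgMr; exact: cvg_tail.
by rewrite mulr0.
Qed.

End fourierL2_theory.

(** * Convolution with an integrable function *)

Section convolution_theorem.
Context {R : realType}.
Local Notation mu := (@lebesgue_measure R).
Implicit Types (h k H K phi f g : R -> R[i]) (D : set R).

Lemma Rintegral_shift (c : R) (f : R -> R) : measurable_fun setT f ->
  \int[mu]_x f (x - c) = \int[mu]_x f x.
Proof.
move=> mf; have mEf : measurable_fun setT (EFin \o f) by exact/measurable_EFinP.
rewrite /Rintegral -(integral_reflect 0 mEf).
rewrite -(integral_reflect c (f := fun x => (EFin \o f) (0 - x)%R)).
  by congr fine; apply: eq_integral => x _ /=; rewrite sub0r opprB.
exact: (measurableT_comp mEf (measurable_reflect 0)).
Qed.

(** Young's inequality for L1 and L2. Write [p * q = sqrt p * (sqrt p * q)],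
    apply the Cauchy-Schwarz inequality in [s], and integrate in [t] first. *)
Lemma integral_conv_sqr_le (p q : R -> R) (A : R) :
  measurable_fun setT p -> measurable_fun setT q ->
  (forall x, 0 <= p x) -> (forall x, 0 <= q x) ->
  (\int[mu]_x (p x)%:E = A%:E)%E ->
  (\int[mu]_t (\int[mu]_s (p (t - s) * q s)%:E) ^+ 2 <=
   (A ^+ 2)%:E * \int[mu]_s (q s ^+ 2)%:E)%E.
Proof.
move=> mp mq p0 q0 pA.
have A0 : 0 <= A by rewrite -lee_fin -pA; apply: integral_ge0 => x _; rewrite lee_fin.
have mp2 : measurable_fun setT (fun z : R * R => p (z.1 - z.2)).
  by apply: (measurableT_comp mp); exact: measurable_funB.
have mq2 : measurable_fun setT (fun z : R * R => q z.2) by exact: (measurableT_comp mq).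
pose Q t := (\int[mu]_s (p (t - s) * q s ^+ 2)%:E)%E.
pose B (z : R * R) := (p (z.1 - z.2) * q z.2 ^+ 2)%:E.
have mB : measurable_fun setT B.
  by apply/measurable_EFinP; apply: measurable_funM => //; exact: measurable_funX.
have B0 z : (0 <= B z)%E by rewrite lee_fin mulr_ge0 ?sqr_ge0.
have mQ : measurable_fun setT Q by apply: (@measurable_fun_fubini_tonelli_F _ _ _ _ _ mu B).
have Q0 t : (0 <= Q t)%E by apply: integral_ge0 => s _; rewrite lee_fin mulr_ge0 ?sqr_ge0.
have CS t : ((\int[mu]_s (p (t - s) * q s)%:E) ^+ 2 <= A%:E * Q t)%E.
  pose u : R -> R := fun s => Num.sqrt (p (t - s)); pose v : R -> R := fun s => u s * q s.
  have mpt : measurable_fun setT (fun s : R => p (t - s)).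
    exact: (measurableT_comp mp (measurable_reflect t)).
  have mu' : measurable_fun setT u.
    have ms : measurable_fun setT (@Num.sqrt R).
      by apply: continuous_measurable_fun; exact: sqrt_continuous.
    exact: (measurableT_comp ms mpt).
  have mv : measurable_fun setT v by exact: measurable_funM.
  have u2 s : u s * u s = p (t - s) by rewrite -expr2 sqr_sqrtr.
  have h12 : 2^-1 + 2^-1 = 1 :> R by lra.
  have := @hoelder _ _ _ mu u v 2 2 mu' mv (ltr0n _ 2) (ltr0n _ 2) h12.
  rewrite Lnorm1 !unlock.
  have -> : (\int[mu]_x `|(EFin \o (u \* v)%R) x| = \int[mu]_s (p (t - s) * q s)%:E)%E.
    apply: eq_integral => s _ /=; rewrite /v mulrA u2 ger0_norm// mulr_ge0//.
  have -> : (\int[mu]_x (`|(EFin \o u) x| `^ 2) = A%:E)%E.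
    rewrite -pA -(@ge0_integral_reflect R t (EFin \o p)).
    - by apply: eq_integral => s _ /=; rewrite powR_mulrn// real_normK ?num_real// expr2 u2.
    - exact/measurable_EFinP.
    - by move=> x; rewrite lee_fin.
  have -> : (\int[mu]_x (`|(EFin \o v) x| `^ 2) = Q t)%E.
    apply: eq_integral => s _ /=; rewrite powR_mulrn// real_normK ?num_real//.
    by rewrite /v exprMn expr2 u2.
  have I0 : (0 <= \int[mu]_s (p (t - s) * q s)%:E)%E.
    by apply: integral_ge0 => s _; rewrite lee_fin mulr_ge0.
  move=> le; rewrite expe2; apply: (le_trans (lee_pmul I0 I0 le le)).
  rewrite -poweRM ?lee_fin//.
  rewrite -poweRD; last by apply: add_neq0_poweRD_def; rewrite h12 oner_neq0.
  by rewrite h12 poweRe1// mule_ge0.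
apply: (@le_trans _ _ (\int[mu]_t (A%:E * Q t))%E).
  apply: ge0_le_integral => //.
  - by move=> t _; rewrite expe2 mule_ge0//; apply: integral_ge0 => s _; rewrite lee_fin mulr_ge0.
  - under eq_fun do rewrite expe2.
    pose B' (z : R * R) := (p (z.1 - z.2) * q z.2)%:E.
    pose P t := (\int[mu]_s (p (t - s) * q s)%:E)%E.
    have mP : measurable_fun setT P.
      apply: (@measurable_fun_fubini_tonelli_F _ _ _ _ _ mu B').
        by apply/measurable_EFinP; exact: measurable_funM.
      by move=> z; rewrite lee_fin mulr_ge0.
    exact: emeasurable_funM.
  - exact: emeasurable_funM.
rewrite ge0_integralZl//.
rewrite expr2 EFinM -muleA lee_pmul ?mule_ge0 ?lee_fin//; first exact: integral_ge0.
have -> : (\int[mu]_t Q t = \int[mu]_s \int[mu]_t B (t, s))%E.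
  exact: (@fubini_tonelli _ _ _ _ _ mu mu B mB B0).
rewrite -ge0_integralZl//; last 2 first.
- by apply/measurable_EFinP; exact: measurable_funX.
- by move=> s _; rewrite lee_fin sqr_ge0.
rewrite le_eqVlt; apply/orP; left; apply/eqP; apply: eq_integral => s _.
rewrite /B /=; under eq_integral do rewrite mulrC EFinM.
rewrite ge0_integralZl//.
- rewrite (@ge0_integral_shift R s (EFin \o p)) ?pA 1?muleC//.
    exact/measurable_EFinP.
- by apply/measurable_EFinP; exact: (measurableT_comp mp2 (measurable_pair2 s)).
- by move=> x _; rewrite lee_fin.
- by rewrite lee_fin sqr_ge0.
Qed.

Definition norm1 h : R := fine (CLnorm 1%E h).

Lemma CLnorm1_norm1 h : cint h -> (\int[mu]_x (Normc.normc (h x))%:E = (norm1 h)%:E)%E.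
Proof.
move=> ih; rewrite /norm1 CLnorm1E fineK// ge0_fin_numE.
  exact/(cintP (cint_meas ih)).
by apply: integral_ge0 => x _; rewrite lee_fin normc_ge0.
Qed.

Lemma norm1_ge0 h : 0 <= norm1 h.
Proof. by apply: fine_ge0; exact: Lnorm_ge0. Qed.

(** An extended real number, defined at every [t] without any integrability; it
    controls where the convolution converges absolutely as well as its norm. *)
Definition conv_abs phi f (t : R) : \bar R :=
  (\int[mu]_s (Normc.normc (phi (t - s)) * Normc.normc (f s))%:E)%E.

Lemma conv_absE phi f t :
  conv_abs phi f t = (\int[mu]_s (Normc.normc (phi (t - s)%R * f s)%R)%:E)%E.
Proof. by apply: eq_integral => s _; rewrite Normc.normcM. Qed.

Lemma conv_abs_ge0 phi f t : (0 <= conv_abs phi f t)%E.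
Proof. by apply: integral_ge0 => s _; rewrite lee_fin mulr_ge0 ?normc_ge0. Qed.

Lemma measurable_conv_abs phi f : cmeas phi -> cmeas f -> measurable_fun setT (conv_abs phi f).
Proof.
move=> mp mf; have np := measurable_normc mp; have nf := measurable_normc mf.
pose B (z : R * R) := (Normc.normc (phi (z.1 - z.2)) * Normc.normc (f z.2))%:E.
apply: (@measurable_fun_fubini_tonelli_F _ _ _ _ _ mu B).
  apply/measurable_EFinP; apply: measurable_funM; last exact: (measurableT_comp nf).
  by apply: (measurableT_comp np); exact: measurable_funB.
by move=> z; rewrite lee_fin mulr_ge0 ?normc_ge0.
Qed.

Lemma integral_conv_abs_sqr_le phi f : cint phi -> cL2 f ->
  (\int[mu]_t (conv_abs phi f t) ^+ 2 <= ((norm1 phi * nrm f) ^+ 2)%:E)%E.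
Proof.
move=> ip Lf; have mp := cint_meas ip.
rewrite exprMn EFinM -energy_nrm//.
apply: (integral_conv_sqr_le (measurable_normc mp) (measurable_normc Lf.1)).
- by move=> x; exact: normc_ge0.
- by move=> x; exact: normc_ge0.
- exact: CLnorm1_norm1.
Qed.

Lemma cmeas_reflect phi (t : R) : cmeas phi -> cmeas (fun s : R => phi (t - s)).
Proof. by move=> mp; apply: cmeas_comp mp _; exact: measurable_reflect. Qed.

Lemma ae_cint_conv phi f : cint phi -> cL2 f ->
  {ae mu, forall t, cint (fun s : R => phi (t - s) * f s)}.
Proof.
move=> ip Lf; have mp := cint_meas ip.
have mC := measurable_conv_abs mp Lf.1.
have iC : mu.-integrable setT (fun t => (conv_abs phi f t) ^+ 2)%E.
  apply/integrableP; split; first by under eq_fun do rewrite expe2; exact: emeasurable_funM.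
  under eq_integral do rewrite gee0_abs ?expe2 ?mule_ge0 ?conv_abs_ge0// -expe2.
  by apply: (le_lt_trans (integral_conv_abs_sqr_le ip Lf)); exact: ltry.
have := integrable_ae measurableT iC.
apply: (@filterS _ _ (ae_filter_ringOfSetsType mu)) => t /(_ I) h.
have mt : cmeas (fun s : R => phi (t - s) * f s).
  by apply: cmeasM Lf.1; exact: cmeas_reflect.
apply/(cintP mt); rewrite -conv_absE ltey; apply: contraL h => /eqP ->.
by rewrite expe2 mulyy.
Qed.

(** Young's inequality, stated for any function dominated by the convolution of
    the moduli. It thus applies to a difference of two convolutions, which is a
    convolution only at the points where both converge. *)
Lemma nrm_conv_bound phi f k : cint phi -> cL2 f -> cmeas k ->
  {ae mu, forall t, ((Normc.normc (k t))%:E <= conv_abs phi f t)%E} ->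
  cL2 k /\ nrm k <= norm1 phi * nrm f.
Proof.
move=> ip Lf mk kP; have mp := cint_meas ip.
have mC := measurable_conv_abs mp Lf.1.
have le : (energy k <= ((norm1 phi * nrm f) ^+ 2)%:E)%E.
  apply: le_trans (integral_conv_abs_sqr_le ip Lf).
  apply: ae_ge0_le_integral => //.
  - by move=> x _; rewrite lee_fin sqr_ge0.
  - by apply/measurable_EFinP; exact: measurable_normc_sq.
  - by move=> x _; rewrite expe2 mule_ge0 ?conv_abs_ge0.
  - by under eq_fun do rewrite expe2; exact: emeasurable_funM.
  - move: kP; apply: (@filterS _ _ (ae_filter_ringOfSetsType mu)) => t h _.
    by rewrite EFin_expe !expe2; apply: lee_pmul => //; rewrite lee_fin normc_ge0.
have Lk : cL2 k by split => //; apply: le_lt_trans le _; exact: ltry.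
split => //; move: le; rewrite energy_nrm// lee_fin.
by rewrite ler_pXn2r// nnegrE ?mulr_ge0 ?nrm_ge0 ?norm1_ge0.
Qed.

Definition cprod_int (F : R -> R -> R[i]) :=
  (mu \x mu)%E.-integrable setT (fun z => (complex.Re (F z.1 z.2))%:E) /\
  (mu \x mu)%E.-integrable setT (fun z => (complex.Im (F z.1 z.2))%:E).

Lemma Cintegral_fubini (F : R -> R -> R[i]) : cprod_int F ->
  Cintegral setT (fun x => Cintegral setT (F x)) =
  Cintegral setT (fun y => Cintegral setT (fun x => F x y)).
Proof.
move=> [i1 i2]; rewrite /Cintegral/=; congr Complex.
  exact: (Rintegral_fubini (F := fun x y => complex.Re (F x y))).
exact: (Rintegral_fubini (F := fun x y => complex.Im (F x y))).
Qed.

Lemma cprod_intP (F : R -> R -> R[i]) : cmeas (fun z : R * R => F z.1 z.2) ->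
  (\int[mu]_x \int[mu]_y (Normc.normc (F x y))%:E < +oo)%E -> cprod_int F.
Proof.
move=> mF Foo; have [m1 m2] := mF; have mn := measurable_normc mF.
pose B (z : R * R) := (Normc.normc (F z.1 z.2))%:E.
have mB : measurable_fun setT B by exact/measurable_EFinP.
have iB : (mu \x mu)%E.-integrable setT B.
  apply/(@integrable12ltyP _ _ _ _ _ mu mu B mB).
  by under eq_integral do under eq_integral do rewrite gee0_abs ?lee_fin ?normc_ge0//.
split; apply: (le_integrable measurableT _ _ iB); try exact/measurable_EFinP.
  by move=> z _; rewrite lee_fin (le_trans (normRe_le _))// ler_norm.
by move=> z _; rewrite lee_fin (le_trans (normIm_le _))// ler_norm.
Qed.

Lemma cmeas_conv_integrand phi f : cmeas phi -> cmeas f ->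
  cmeas (fun z : R * R => phi (z.1 - z.2) * f z.2).
Proof.
move=> mp mf; apply: cmeasM; last exact: (cmeas_comp mf).
by apply: (cmeas_comp mp); exact: measurable_funB.
Qed.

Lemma integral_conv_abs phi f : cint phi -> cint f ->
  (\int[mu]_t conv_abs phi f t = (norm1 phi * norm1 f)%:E)%E.
Proof.
move=> ip jf; have mp := cint_meas ip; have mf := cint_meas jf.
have np := measurable_normc mp; have nf := measurable_normc mf.
pose B (z : R * R) := (Normc.normc (phi (z.1 - z.2)) * Normc.normc (f z.2))%:E.
have mB : measurable_fun setT B.
  apply/measurable_EFinP; apply: measurable_funM; last exact: (measurableT_comp nf).
  by apply: (measurableT_comp np); exact: measurable_funB.
have B0 z : (0 <= B z)%E by rewrite lee_fin mulr_ge0 ?normc_ge0.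
transitivity (\int[mu]_s \int[mu]_t B (t, s))%E.
  exact: (@fubini_tonelli _ _ _ _ _ mu mu B mB B0).
under eq_integral => s _.
  rewrite /B /=; under eq_integral do rewrite mulrC EFinM.
  rewrite ge0_integralZl//; last 3 first.
  - apply/measurable_EFinP; apply: (measurableT_comp np); exact: measurable_funB.
  - by move=> x _; rewrite lee_fin normc_ge0.
  - by rewrite lee_fin normc_ge0.
  rewrite (@ge0_integral_shift R s (fun x => (Normc.normc (phi x))%:E)); last 2 first.
  - exact/measurable_EFinP.
  - by move=> x; rewrite lee_fin normc_ge0.
  rewrite CLnorm1_norm1//.
  over.
rewrite ge0_integralZr//.
- by rewrite CLnorm1_norm1// -EFinM mulrC.
- exact/measurable_EFinP.
- by move=> x _; rewrite lee_fin normc_ge0.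
- by rewrite lee_fin norm1_ge0.
Qed.

Lemma cprod_int_conv phi f : cint phi -> cint f ->
  cprod_int (fun t s : R => phi (t - s) * f s).
Proof.
move=> ip jf; apply: cprod_intP.
  by apply: cmeas_conv_integrand; exact: cint_meas.
under eq_integral do rewrite -conv_absE.
by rewrite integral_conv_abs// ltry.
Qed.

Lemma cint_convolution phi f : cint phi -> cint f -> cint (convolution phi f).
Proof.
move=> ip jf; have [i1 i2] := cprod_int_conv ip jf.
have mc : cmeas (convolution phi f).
  split; rewrite /convolution/Cintegral/=; apply: measurableT_comp => //.
    exact: (measurable_fubini_F i1).
  exact: (measurable_fubini_F i2).
apply/(cintP mc); apply: (@le_lt_trans _ _ (\int[mu]_t conv_abs phi f t)%E).
  apply: ge0_le_integral => //.
  - by move=> t _; rewrite lee_fin normc_ge0.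
  - by apply/measurable_EFinP; exact: measurable_normc.
  - by apply: measurable_conv_abs; exact: cint_meas.
  - move=> t _; rewrite conv_absE; apply: normc_Cintegral_le.
    by apply: cmeasM (cint_meas jf); apply: cmeas_reflect; exact: cint_meas.
by rewrite integral_conv_abs// ltry.
Qed.

Lemma waveD l (x y : R) : wave l (x + y) = wave l x * wave l y.
Proof.
rewrite /wave mulrDr cosD sinD; apply/eqP; rewrite eq_complex; apply/andP.
by split; apply/eqP; rewrite ?cReM ?cImM /=; ring.
Qed.

Lemma Cintegral_shift c h : cmeas h ->
  Cintegral setT (fun x : R => h (x - c)) = Cintegral setT h.
Proof.
move=> [h1 h2]; rewrite /Cintegral; congr Complex.
  exact: (Rintegral_shift c h1).
exact: (Rintegral_shift c h2).
Qed.

Lemma cint_reflect phi (t : R) : cint phi -> cint (fun s : R => phi (t - s)).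
Proof.
move=> ip; have mp := cint_meas ip; have mr := cmeas_reflect t mp.
apply/(cintP mr); rewrite (@ge0_integral_reflect R t (fun x => (Normc.normc (phi x))%:E)).
- exact/(cintP mp).
- by apply/measurable_EFinP; exact: measurable_normc.
- by move=> x; rewrite lee_fin normc_ge0.
Qed.

Lemma cint_shift phi (s : R) : cint phi -> cint (fun t : R => phi (t - s)).
Proof.
move=> ip; have mp := cint_meas ip.
have mr : cmeas (fun t : R => phi (t - s)) by apply: cmeas_comp mp _; exact: measurable_funB.
apply/(cintP mr); rewrite (@ge0_integral_shift R s (fun x => (Normc.normc (phi x))%:E)).
- exact/(cintP mp).
- by apply/measurable_EFinP; exact: measurable_normc.
- by move=> x; rewrite lee_fin normc_ge0.
Qed.

(** The bound on [f] makes the convolution converge absolutely at every [t], and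
    not only almost everywhere; the theorem is then Fubini's, because [wave l]
    is a character. *)
Theorem fourier_convolution phi f (M : R) : cint phi -> cint f ->
  (forall x, Normc.normc (f x) <= M) ->
  forall l, fourier (convolution phi f) l = fourier phi l * fourier f l.
Proof.
move=> ip jf fM l; have mp := cint_meas ip; have mf := cint_meas jf.
have ic t : cint (fun s : R => phi (t - s) * f s).
  exact: (cint_mul_bounded (cint_reflect t ip) mf fM).
pose F (t s : R) := wave l t * (phi (t - s) * f s).
have iF : cprod_int F.
  apply: cprod_intP.
    apply: cmeasM; last exact: cmeas_conv_integrand.
    exact: (cmeas_comp (cmeas_wave l)).
  under eq_integral do under eq_integral do rewrite Normc.normcM normc_wave mul1r.
  under eq_integral do rewrite -conv_absE.
  by rewrite integral_conv_abs// ltry.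
rewrite /fourier /fourier_on.
transitivity (Cintegral setT (fun t => Cintegral setT (F t))).
  by congr Cintegral; apply/funext => t; rewrite /F CintegralZ// mulrC.
rewrite Cintegral_fubini//.
transitivity (Cintegral setT (fun s => fourier phi l * (f s * wave l s))); last first.
  by rewrite CintegralZ//; exact: cint_wave.
congr Cintegral; apply/funext => s.
have -> : (fun t => F t s) = (fun t => (f s * wave l s) * ((fun u => phi u * wave l u) (t - s))).
  apply/funext => t; rewrite /F.
  have -> : wave l t = wave l (t - s) * wave l s by rewrite -waveD subrK.
  ring.
rewrite CintegralZ; last by apply: (cint_shift (phi := fun u => phi u * wave l u)); exact: cint_wave.
rewrite (Cintegral_shift s (h := fun u => phi u * wave l u)) 1?mulrC//.
by apply: cint_meas; exact: cint_wave.
Qed.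

End convolution_theorem.

(** * The convolution theorem in L2 *)

Section convolution_L2.
Context {R : realType}.
Local Notation mu := (@lebesgue_measure R).
Implicit Types (h k H K phi f g : R -> R[i]) (D : set R).

Lemma nrm0_ae h : cL2 h -> nrm h = 0 -> {ae mu, forall x, h x = 0}.
Proof.
move=> Lh h0.
have m : measurable_fun setT (fun x => (Normc.normc (h x))%:E).
  by apply/measurable_EFinP; exact: measurable_normc Lh.1.
have : CLnorm 2%:E h = 0%E by rewrite CLnorm2_nrm// h0.
have p2 : (0 < 2%:E :> \bar R)%E by rewrite lte_fin.
move=> h2; have := @Lnorm_eq0_eq0 _ _ _ mu _ 2%:E m p2 h2.
apply: (@filterS _ _ (ae_filter_ringOfSetsType mu)) => x /(_ I) hx.
by apply: Normc.eq0_normc; case: hx.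
Qed.

Lemma nrm_mul_bounded h k (M : R) : cmeas k -> (forall x, Normc.normc (k x) <= M) -> cL2 h ->
  cL2 (fun x => k x * h x) /\ nrm (fun x => k x * h x) <= M * nrm h.
Proof.
move=> mk kM Lh; have M0 : 0 <= M by rewrite (le_trans _ (kM 0))// normc_ge0.
have mkh := cmeasM mk Lh.1.
have le x : Normc.normc (k x * h x) <= M * Normc.normc (h x).
  by rewrite Normc.normcM ler_wpM2r ?normc_ge0.
by split; [exact: (cL2_le mkh M0 le Lh)|exact: (nrm_le mkh M0 le Lh)].
Qed.

Lemma normc_fourier_norm1 phi l : cint phi -> Normc.normc (fourier phi l) <= norm1 phi.
Proof.
move=> ip; rewrite -lee_fin -CLnorm1_norm1// -CLnorm1E.
exact: normc_fourier_le.
Qed.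

(** Cutting the domain and the range at once: the restriction of [f] to this set
    is bounded, integrable and square integrable. *)
Definition level f (n : nat) : set R := window n `&` [set x | Normc.normc (f x) <= n%:R].

Lemma measurable_level f n : cmeas f -> measurable (level f n).
Proof.
move=> mf; apply: measurableI; first exact: measurable_window.
have -> : [set x | Normc.normc (f x) <= n%:R] = setT `&` (fun x => Normc.normc (f x)) @^-1` `]-oo, n%:R].
  by rewrite setTI; apply/seteqP; split => x /=; rewrite in_itv.
by apply: measurable_normc.
Qed.

Lemma level_lty f n : cmeas f -> (mu (level f n) < +oo)%E.
Proof.
move=> mf; apply: le_lt_trans (window_lty n); apply: le_measure; rewrite ?inE.
- exact: measurable_level.
- exact: measurable_window.
- exact: subIsetl.
Qed.

Lemma normc_clip_level f n x : Normc.normc (clip (level f n) f x) <= n%:R.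
Proof.
rewrite /clip; case: ifPn => [|_]; last by rewrite normc0.
by rewrite inE => -[].
Qed.

Lemma cvg_clip_level f : cL2 f ->
  nrm (fun x => f x - clip (level f n) f x) @[n --> \oo] --> 0.
Proof.
move=> Lf; apply: (cvg_nrm_dominated Lf).
- move=> n; apply: cmeasB; first exact: Lf.1.
  by apply: cmeas_clip Lf.1; exact: measurable_level Lf.1.
- by move=> n x; rewrite /clip; case: (_ \in _); rewrite ?subr0// subrr normc0 normc_ge0.
- move=> x; apply: cvg_near_cst.
  apply: filterS2 (near_window x) (nbhs_infty_ger (Normc.normc (f x))) => n h1 h2.
  rewrite /clip mem_set ?subrr ?normc0//.
  by split => //; move: h1; rewrite inE.
Qed.

(** Let [f_n] be [f] restricted to [level f n], so that [fourier_convolution]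
    applies to it. By Young's inequality [phi * f_n] tends to [g] in L2, and by
    boundedness of [fourier phi] the products of the transforms tend to [fourier
    phi * F]; the two limits agree. *)
Theorem fourierL2_convolution phi f g F G : cint phi -> cL2 f -> cL2 g ->
  {ae mu, forall t, convolution phi f t = g t} ->
  is_fourierL2 f F -> is_fourierL2 g G ->
  {ae mu, forall l, G l = fourier phi l * F l}.
Proof.
move=> ip Lf Lg fg fF gG.
have mp := cint_meas ip; have mf := Lf.1.
have LF : cL2 F by have [] := (is_fourierL2P F Lf).1 fF.
have LG : cL2 G by have [] := (is_fourierL2P G Lg).1 gG.
pose fn n := clip (level f n) f.
have ml n : measurable (level f n) by exact: measurable_level.
have jfn n : cint (fn n) by apply: cint_clip_L2 => //; exact: level_lty.
have Lfn n : cL2 (fn n) by exact: cL2_clip.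
pose wn n := convolution phi (fn n).
have iwn n : cint (wn n) by exact: cint_convolution.
have ict n t : cint (fun s : R => phi (t - s) * fn n s).
  exact: (cint_mul_bounded (cint_reflect t ip) (cint_meas (jfn n)) (normc_clip_level f n)).
have mpt t : cmeas (fun s : R => phi (t - s)) by exact: cmeas_reflect.
have Lwn n : cL2 (wn n).
  apply: (nrm_conv_bound ip (Lfn n) (cint_meas (iwn n)) _).1.
  apply: nearW => t; rewrite conv_absE; apply: normc_Cintegral_le.
  by apply: cmeasM; [exact: mpt|exact: (Lfn n).1].
pose A := norm1 phi; pose r n := nrm (fun x => f x - fn n x).
have A0 : 0 <= A := norm1_ge0 phi.
have gw n : nrm (fun t => g t - wn n t) <= A * r n.
  apply: (nrm_conv_bound ip (cL2B Lf (Lfn n)) (cmeasB Lg.1 (Lwn n).1) _).2.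
  have := ae_cint_conv ip Lf; move: fg.
  apply: (@filterS2 _ _ (ae_filter_ringOfSetsType mu)) => t <- it.
  rewrite /wn /convolution -CintegralB; [|exact: it|exact: ict].
  rewrite conv_absE.
  have -> : (fun s : R => phi (t - s) * f s - phi (t - s) * fn n s) =
     (fun s : R => phi (t - s) * (f s - fn n s)) by apply/funext => s; rewrite mulrBr.
  apply: normc_Cintegral_le; apply: cmeasM; first exact: mpt.
  by apply: cmeasB; [exact: mf|exact: (Lfn n).1].
pose c : R := Num.sqrt (2 * pi).
have c0 : 0 <= c by exact: sqrtr_ge0.
have Lwh n := cL2_fourier (iwn n) (Lwn n).
have Lfh n := cL2_fourier (jfn n) (Lfn n).
have Gw n : nrm (fun l => G l - fourier (wn n) l) = c * nrm (fun t => g t - wn n t).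
  apply: is_fourierL2_nrm; first exact: cL2B.
  by apply: is_fourierL2B => //; exact: is_fourierL2_L1.
have Ff n : nrm (fun l => F l - fourier (fn n) l) = c * r n.
  apply: is_fourierL2_nrm; first exact: cL2B.
  by apply: is_fourierL2B => //; exact: is_fourierL2_L1.
have mphi := cmeas_fourier ip.
have phiA l : Normc.normc (fourier phi l) <= A by exact: normc_fourier_norm1.
have LphiF : cL2 (fun l => fourier phi l * F l) by exact: (nrm_mul_bounded mphi phiA LF).1.
have LGF := cL2B LG LphiF.
(* [G - fourier phi * F] splits along [phi * f_n], whose transform is a product. *)
have bound n : nrm (fun l => G l - fourier phi l * F l) <= 2 * c * A * r n.
  have -> : (fun l => G l - fourier phi l * F l) =
     (fun l => (G l - fourier (wn n) l) - fourier phi l * (F l - fourier (fn n) l)).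
    apply/funext => l; rewrite (fourier_convolution ip (jfn n) (normc_clip_level f n)); ring.
  have [Lp le] := nrm_mul_bounded mphi phiA (cL2B LF (Lfh n)).
  apply: (le_trans (nrmB_le (cL2B LG (Lwh n)) Lp)).
  rewrite Gw; rewrite Ff in le.
  have -> : 2 * c * A * r n = c * (A * r n) + A * (c * r n) by ring.
  by apply: lerD => //; rewrite ler_wpM2l.
have GF0 : nrm (fun l => G l - fourier phi l * F l) = 0.
  apply/eqP; rewrite eq_le nrm_ge0 andbT.
  have h : 2 * c * A * r n @[n --> \oo] --> 2 * c * A * 0.
    by apply: cvgMr; exact: cvg_clip_level.
  rewrite mulr0 in h; rewrite -(cvg_lim (@Rhausdorff R) h).
  by apply: limr_ge; [apply/cvg_ex; eexists; exact: h|apply: nearW].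
have := nrm0_ae LGF GF0.
apply: (@filterS _ _ (ae_filter_ringOfSetsType mu)) => l /eqP.
by rewrite subr_eq0 => /eqP.
Qed.

End convolution_L2.

(** * The pointwise error of Tikhonov regularization *)

Section tikhonov.
Context {R : realType}.

(** With [D = del + |P|^2], the numerator [F0 * D - G * conj P] is the sum of
    [del * F0], [- (P0 - P) * F0 * conj P] and [(P0 * F0 - G) * conj P]. *)
Lemma normc_tikhonov_le (F0 G P0 P : R[i]) (del e : R) : 0 < del ->
  Normc.normc (P0 - P) <= e ->
  Normc.normc (F0 - G * conjc P / real_complex R (del + Normc.normc P ^+ 2)) <=
  ((del + e * Normc.normc P) * Normc.normc F0 + Normc.normc (P0 * F0 - G) * Normc.normc P)
    / (del + Normc.normc P ^+ 2).
Proof.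
move=> del0 hP; set u := Normc.normc P; set c := del + u ^+ 2.
have c0 : 0 < c by rewrite /c ltr_pwDl// sqr_ge0.
have rc0 : real_complex R c != 0.
  by apply/eqP => /(congr1 (@Normc.normc R)); rewrite normc_real normc0 => /normr0_eq0/eqP; rewrite gt_eqF.
have nconj : Normc.normc (conjc P) = u by rewrite /u; case: (P) => x y /=; rewrite sqrrN.
have cE : real_complex R c = real_complex R del + P * conjc P.
  rewrite /c /u normc_sqE; apply/eqP; rewrite eq_complex; apply/andP.
  by split; apply/eqP; case: (P) => x y /=; ring.
have -> : F0 - G * conjc P / real_complex R c =
   (real_complex R del * F0 - (P0 - P) * F0 * conjc P + (P0 * F0 - G) * conjc P) / real_complex R c.
  apply: (mulIf rc0); rewrite divfK// mulrBl divfK// cE; ring.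
rewrite Normc.normcM Normc.normcV normc_real gtr0_norm// ler_pM2r ?invr_gt0//.
apply: (le_trans (normcD_le _ _)); rewrite [X in _ + X <= _]Normc.normcM nconj lerD2r.
apply: (le_trans (normcB_le _ _)); rewrite !Normc.normcM normc_real nconj gtr0_norm// mulrDl lerD2l.
rewrite -!mulrA [X in _ * X]mulrC ler_wpM2r// mulr_ge0// ?normc_ge0//; exact: normc_ge0.
Qed.

(** Here [a], [u], [u0], [d] are the moduli of [F0], [P], [P0] and [G0 - G], and
    [D = del + u^2]. By the inequality of the means [u / D <= 1 / (2 sqrt del)],
    which gives the last term. If [u0 < b], then [del / D <= 1] and [e * u / D
    <= 1 / 2], since [e^2 <= del]. If [u0 >= b], then [u] is nearly at least
    [b], so that [del / D] and [e * u / D] are at most about [del / b^2] and [e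
    / b], and [a <= (u0 * a) / b]. The constants 8 and 15/4 are round numbers
    that are small enough for the final bound. *)
Lemma tikhonov_pointwise (a u u0 d del e b : R) : 0 <= a -> 0 <= u -> 0 <= d ->
  0 < del -> 0 < e -> 0 < b -> u0 - e <= u -> e ^+ 2 <= del -> e <= b / 20 ->
  (((del + e * u) * a + d * u) / (del + u ^+ 2)) ^+ 2 <=
  (if u0 < b then 8 * a ^+ 2 else 0)
   + (15 / 4) * (del ^+ 2 / b ^+ 6 + e ^+ 2 / b ^+ 4) * (u0 * a) ^+ 2
   + 3 / (4 * del) * d ^+ 2.
Proof.
move=> a0 ug0 d0 del0 e0 b0 u0u edel eb.
have D0 : 0 < del + u ^+ 2 by rewrite ltr_pwDl// sqr_ge0.
set D := del + u ^+ 2 in D0 *.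
pose w := u / D.
have wd : w ^+ 2 * d ^+ 2 <= d ^+ 2 / (4 * del).
  rewrite mulrC ler_wpM2l ?sqr_ge0//.
  rewrite /w expr_div_n ler_pdivrMr ?exprn_gt0// mulrC ler_pdivlMr ?mulr_gt0//.
  by have := sqr_ge0 (del - u ^+ 2); rewrite /D; nra.
have b60 : 0 < b ^+ 6 by rewrite exprn_gt0.
have b40 : 0 < b ^+ 4 by rewrite exprn_gt0.
have [ub|bu] := ltP u0 b.
  have k0 : 0 <= (15 / 4) * (del ^+ 2 / b ^+ 6 + e ^+ 2 / b ^+ 4) * (u0 * a) ^+ 2.
    apply: mulr_ge0; last exact: sqr_ge0.
    apply: mulr_ge0; first by rewrite divr_ge0.
    by apply: addr_ge0; apply: divr_ge0; rewrite ?sqr_ge0// ltW.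
  (* [e * u <= (e^2 + u^2) / 2 <= D / 2]. *)
  have h1 : (del + e * u) / D <= 3 / 2.
    rewrite ler_pdivrMr// /D.
    by have := sqr_ge0 (e - u); nra.
  have h10 : 0 <= (del + e * u) / D.
    exact: divr_ge0 (addr_ge0 (ltW del0) (mulr_ge0 (ltW e0) ug0)) (ltW D0).
  have -> : ((del + e * u) * a + d * u) / D = (del + e * u) / D * a + w * d.
    by rewrite /w; field; rewrite gt_eqF.
  have h2 : ((del + e * u) / D * a) ^+ 2 <= 9 / 4 * a ^+ 2.
    rewrite exprMn ler_wpM2r ?sqr_ge0//.
    by move: h1 h10; move: (_ / D) => t; nra.
  have h3 := sqr_ge0 ((del + e * u) / D * a - w * d).
  have h4 : (w * d) ^+ 2 <= d ^+ 2 / (4 * del) by rewrite exprMn.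
  have -> : 3 / (4 * del) * d ^+ 2 = 3 * (d ^+ 2 / (4 * del)) by field; rewrite gt_eqF.
  have d40 : 0 <= d ^+ 2 / (4 * del) by rewrite divr_ge0 ?sqr_ge0// mulr_ge0// ltW.
  have a20 := sqr_ge0 a.
  move: k0 h2 h3 h4 d40 a20.
  move: (_ / D * a) (w * d) (d ^+ 2 / (4 * del)) (a ^+ 2) (15 / 4 * _ * _) => x y z t k.
  rewrite sqrrB sqrrD; move: (x ^+ 2) (y ^+ 2) (x * y) => x2 y2 xy; lra.
rewrite add0r.
have b00 := ltW b0; have e00 := ltW e0; have del00 := ltW del0.
(* [u >= u0 - e >= b - b / 20]. *)
have ubb : 19 / 20 * b <= u by lra.
have u20 : 9 / 10 * b ^+ 2 <= u ^+ 2 by nra.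
pose p := del / D; pose q := e * u / D.
have p0 : 0 <= p by exact: divr_ge0 (ltW del0) (ltW D0).
have q0 : 0 <= q by exact: divr_ge0 (mulr_ge0 (ltW e0) ug0) (ltW D0).
have ba : b * a <= u0 * a by rewrite ler_wpM2r.
have ba0 : 0 <= b * a by rewrite mulr_ge0.
have pb : p * b ^+ 2 <= 10 / 9 * del.
  rewrite /p mulrAC ler_pdivrMr// /D; have := sqr_ge0 b; nra.
have qb : q * b <= 20 / 19 * e.
  rewrite /q mulrAC ler_pdivrMr// /D -!mulrA.
  rewrite [leRHS](_ : _ = e * (20 / 19 * (del + u ^+ 2))); last by ring.
  by rewrite ler_wpM2l ?(ltW e0)//; nra.
(* 5/4 exceeds both (10/9)^2 and (20/19)^2, and becomes 15/4 when a square of a sum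
   of three terms is bounded by 3 times the sum of the squares. *)
have h1 : (p * a) ^+ 2 <= 5 / 4 * (del ^+ 2 / b ^+ 6) * (u0 * a) ^+ 2.
  have h : (p * a) * b ^+ 3 <= (10 / 9 * del) * (u0 * a).
    rewrite [leLHS](_ : _ = (p * b ^+ 2) * (b * a)); last by ring.
    by apply: ler_pM => //; rewrite mulr_ge0// sqr_ge0.
  have pab0 : 0 <= p * a * b ^+ 3.
    by apply: mulr_ge0; [exact: mulr_ge0|exact: exprn_ge0].
  have h' : ((p * a) * b ^+ 3) ^+ 2 <= ((10 / 9 * del) * (u0 * a)) ^+ 2.
    by apply: lerXn2r => //; rewrite nnegrE; exact: le_trans h.
  rewrite -(ler_pM2r b60).
  have -> : (p * a) ^+ 2 * b ^+ 6 = ((p * a) * b ^+ 3) ^+ 2 by ring.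
  apply: (le_trans h').
  have -> : 5 / 4 * (del ^+ 2 / b ^+ 6) * (u0 * a) ^+ 2 * b ^+ 6 = 5 / 4 * (del * (u0 * a)) ^+ 2.
    by field; rewrite gt_eqF.
  rewrite -mulrA exprMn ler_wpM2r ?sqr_ge0//; lra.
have h2 : (q * a) ^+ 2 <= 5 / 4 * (e ^+ 2 / b ^+ 4) * (u0 * a) ^+ 2.
  have h : (q * a) * b ^+ 2 <= (20 / 19 * e) * (u0 * a).
    rewrite [leLHS](_ : _ = (q * b) * (b * a)); last by ring.
    by apply: ler_pM => //; rewrite mulr_ge0// ltW.
  have qab0 : 0 <= q * a * b ^+ 2.
    by apply: mulr_ge0; [exact: mulr_ge0|exact: sqr_ge0].
  have h' : ((q * a) * b ^+ 2) ^+ 2 <= ((20 / 19 * e) * (u0 * a)) ^+ 2.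
    by apply: lerXn2r => //; rewrite nnegrE; exact: le_trans h.
  rewrite -(ler_pM2r b40).
  have -> : (q * a) ^+ 2 * b ^+ 4 = ((q * a) * b ^+ 2) ^+ 2 by ring.
  apply: (le_trans h').
  have -> : 5 / 4 * (e ^+ 2 / b ^+ 4) * (u0 * a) ^+ 2 * b ^+ 4 = 5 / 4 * (e * (u0 * a)) ^+ 2.
    by field; rewrite gt_eqF.
  rewrite -mulrA exprMn ler_wpM2r ?sqr_ge0//; lra.
have -> : ((del + e * u) * a + d * u) / D = p * a + q * a + w * d.
  by rewrite /p /q /w; field; rewrite gt_eqF.
have h4 : (w * d) ^+ 2 <= d ^+ 2 / (4 * del) by rewrite exprMn.
have -> : 3 / (4 * del) * d ^+ 2 = 3 * (d ^+ 2 / (4 * del)) by field; rewrite gt_eqF.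
have -> : 15 / 4 * (del ^+ 2 / b ^+ 6 + e ^+ 2 / b ^+ 4) * (u0 * a) ^+ 2 =
   3 * (5 / 4 * (del ^+ 2 / b ^+ 6) * (u0 * a) ^+ 2) + 3 * (5 / 4 * (e ^+ 2 / b ^+ 4) * (u0 * a) ^+ 2).
  by field; rewrite !gt_eqF.
move: h1 h2 h4.
move: (5 / 4 * (del ^+ 2 / b ^+ 6) * _) (5 / 4 * (e ^+ 2 / b ^+ 4) * _) (d ^+ 2 / (4 * del)) => A B C.
move: (p * a) (q * a) (w * d) => x y z h1 h2 h4.
have := sqr_ge0 (x - y); have := sqr_ge0 (x - z); have := sqr_ge0 (y - z); nra.
Qed.

End tikhonov.

(** * The regularization error *)

Section regularization_error.
Context {R : realType}.
Local Notation mu := (@lebesgue_measure R).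

Lemma ae_neq (r : R) : {ae mu, forall x, x != r}.
Proof.
exists [set r]; split => //; first exact: lebesgue_measure_set1.
by move=> x /= /negP; rewrite negbK => /eqP.
Qed.

(** The integral of [tikhonov_pointwise]. The frequencies with [|l| = r] lie in
    neither domain of integration on the right, and form a null set. *)
Lemma energy_tikhonov_le (F0 F G0 G P0 P : R -> R[i]) (del e b r : R) :
  cL2 F0 -> cL2 F -> cL2 G0 -> cL2 G -> cmeas P0 ->
  0 < del -> 0 < e -> 0 < b -> e ^+ 2 <= del -> e <= b / 20 ->
  (forall l, Normc.normc (P0 l - P l) <= e) ->
  {ae mu, forall l, G0 l = P0 l * F0 l} ->
  {ae mu, forall l, F l = G l * conjc (P l) / real_complex R (del + Normc.normc (P l) ^+ 2)} ->
  (energy (fun l => (F0 l - F l)%R) <=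
   8%:E * (\int[mu]_(l in [set l | (r < `|l|)%R /\ (Normc.normc (P0 l) < b)%R])
              (Normc.normc (F0 l) ^+ 2)%:E
         + \int[mu]_(l in [set l | (`|l| < r)%R /\ (Normc.normc (P0 l) < b)%R])
              (Normc.normc (F0 l) ^+ 2)%:E)
   + (15 / 4 * (del ^+ 2 / b ^+ 6 + e ^+ 2 / b ^+ 4) * nrm G0 ^+ 2
      + 3 / (4 * del) * nrm (fun l => G0 l - G l) ^+ 2)%:E)%E.
Proof.
move=> LF0 LF LG0 LG mP0 del0 e0 b0 edel eb PP aeG aeF.
set A1 := [set l | _ /\ _]; set A2 := [set l | _ /\ _].
set k1 := 15 / 4 * _; set k2 := 3 / (4 * del).
have k10 : 0 <= k1.
  apply: mulr_ge0; first by rewrite divr_ge0.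
  by apply: addr_ge0; apply: divr_ge0; rewrite ?sqr_ge0// exprn_ge0// ltW.
have k20 : 0 <= k2 by rewrite divr_ge0// mulr_ge0// ltW.
have LGG := cL2B LG0 LG.
have mp := measurable_normc mP0.
have mB : measurable [set l | (Normc.normc (P0 l) < b)%R].
  have -> : [set l | (Normc.normc (P0 l) < b)%R] = setT `&` (fun x => Normc.normc (P0 x)) @^-1` `]-oo, b[.
    by rewrite setTI; apply/seteqP; split => x /=; rewrite in_itv.
  by apply: mp.
have mn : measurable_fun setT (fun l : R => `|l|) by exact: normr_measurable.
have mA1 : measurable A1.
  have mr1 : measurable [set l : R | r < `|l|].
    have -> : [set l : R | r < `|l|] = setT `&` (fun l : R => `|l|) @^-1` `]r, +oo[.
      by rewrite setTI; apply/seteqP; split => x /=; rewrite in_itv/= andbT.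
    by apply: mn.
  exact: (measurableI _ _ mr1 mB).
have mA2 : measurable A2.
  have mr2 : measurable [set l : R | `|l| < r].
    have -> : [set l : R | `|l| < r] = setT `&` (fun l : R => `|l|) @^-1` `]-oo, r[.
      by rewrite setTI; apply/seteqP; split => x /=; rewrite in_itv.
    by apply: mn.
  exact: (measurableI _ _ mr2 mB).
pose a2 l := (Normc.normc (F0 l) ^+ 2)%:E.
have ma2 : measurable_fun setT a2 by apply/measurable_EFinP; exact: measurable_normc_sq LF0.1.
have a20 l : (0 <= a2 l)%E by rewrite lee_fin sqr_ge0.
pose T1 l := (8%:E * ((a2 \_ A1) l + (a2 \_ A2) l))%E.
pose T2 l := (k1%:E * (Normc.normc (G0 l) ^+ 2)%:E)%E.
pose T3 l := (k2%:E * (Normc.normc (G0 l - G l) ^+ 2)%:E)%E.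
have mr A : measurable A -> measurable_fun setT (a2 \_ A).
  by move=> mA; apply/(measurable_restrictT _ mA); exact: measurable_funTS.
have r0 A l : (0 <= (a2 \_ A) l)%E by rewrite patchE; case: ifP.
have m1 : measurable_fun setT T1.
  by apply: emeasurable_funM => //; apply: emeasurable_funD; exact: mr.
have mg0 : measurable_fun setT (fun l => (Normc.normc (G0 l) ^+ 2)%:E).
  by apply/measurable_EFinP; exact: measurable_normc_sq LG0.1.
have mgg : measurable_fun setT (fun l => (Normc.normc (G0 l - G l)%R ^+ 2)%:E).
  by apply/measurable_EFinP; exact: measurable_normc_sq LGG.1.
have m2 : measurable_fun setT T2 by exact: emeasurable_funM.
have m3 : measurable_fun setT T3 by exact: emeasurable_funM.
have T10 l : (0 <= T1 l)%E by rewrite mule_ge0// adde_ge0.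
have T20 l : (0 <= T2 l)%E by rewrite mule_ge0// lee_fin// sqr_ge0.
have T30 l : (0 <= T3 l)%E by rewrite mule_ge0// lee_fin// sqr_ge0.
apply: (@le_trans _ _ (\int[mu]_l (T1 l + (T2 l + T3 l)))%E).
  apply: ae_ge0_le_integral => //.
  - by move=> l _; rewrite lee_fin sqr_ge0.
  - by apply/measurable_EFinP; apply: measurable_normc_sq; apply: cmeasB; [exact: LF0.1|exact: LF.1].
  - by move=> l _; rewrite !adde_ge0.
  - by apply: emeasurable_funD => //; exact: emeasurable_funD.
  have fil := ae_filter_ringOfSetsType mu.
  have aer : {ae mu, forall l, l != r /\ l != - r}.
    have := ae_neq (- r); have := ae_neq r.
    by apply: (@filterS2 _ _ fil) => l; split.
  have := aer; move: aeF aeG; apply: (@filterS3 _ _ fil) => l Fl Gl [lr lr'] _.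
  have := tikhonov_pointwise (normc_ge0 (F0 l)) (normc_ge0 (P l)) (normc_ge0 (G0 l - G l)) del0 e0 b0 _ edel eb.
  move=> /(_ (Normc.normc (P0 l))) tp.
  have hP : Normc.normc (P0 l) - e <= Normc.normc (P l).
    rewrite lerBlDr addrC -lerBlDr; apply: le_trans (PP l).
    rewrite lerBlDr; have {1}-> : P0 l = (P0 l - P l) + P l by rewrite subrK.
    exact: normcD_le.
  have {}tp := tp hP.
  have tn := normc_tikhonov_le (F0 l) (G l) del0 (PP l).
  rewrite -Gl -Fl in tn.
  have tn2 := le_trans (lerXn2r 2 (normc_ge0 _) (le_trans (normc_ge0 _) tn) tn) tp.
  apply: (@le_trans _ _ (((if Normc.normc (P0 l) < b then 8 * Normc.normc (F0 l) ^+ 2 else 0) +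
     k1 * Normc.normc (G0 l) ^+ 2 + k2 * Normc.normc (G0 l - G l) ^+ 2)%:E)).
    by rewrite lee_fin (le_trans tn2)// -Normc.normcM -Gl.
  rewrite -addrA EFinD (EFinD (k1 * _)) !EFinM leeD2r//.
  case: ifPn => [ub|_]; last exact: T10.
  rewrite /T1 EFinM lee_pmul2l// ?lte_fin//.
  have [rl|lr2|lre] := ltgtP r `|l|.
  - by rewrite -[leLHS]adde0; apply: leeD => //; rewrite patchE mem_set.
  - by rewrite -[leLHS]add0e; apply: leeD => //; rewrite patchE mem_set.
  - exfalso; move: lr lr'; rewrite lre; case: (ler0P l) => _; rewrite ?opprK ?eqxx//.
rewrite ge0_integralD//; last 2 first.
- by move=> l _; exact: adde_ge0.
- exact: emeasurable_funD.
rewrite ge0_integralD// !ge0_integralZl//; last 4 first.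
- by move=> l _; rewrite lee_fin sqr_ge0.
- by move=> l _; rewrite lee_fin sqr_ge0.
- by apply: emeasurable_funD; exact: mr.
- by move=> l _; exact: adde_ge0.
have e0' : (\int[mu]_x (Normc.normc (G0 x) ^+ 2)%:E = (nrm G0 ^+ 2)%:E)%E.
  by rewrite -energy_nrm.
have e1' : (\int[mu]_x (Normc.normc (G0 x - G x)%R ^+ 2)%:E = (nrm (fun l => G0 l - G l) ^+ 2)%:E)%E.
  by rewrite -energy_nrm.
rewrite e0' e1' -!EFinM -EFinD leeD2r// lee_pmul2l ?lte_fin//.
rewrite ge0_integralD//; last 2 first.
- exact: mr.
- exact: mr.
by rewrite -!integral_mkcond.
Qed.

Lemma powR_mulD (e x y : R) : 0 < e -> e `^ x * e `^ y = e `^ (x + y).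
Proof. by move=> e0; rewrite powRD// (gt_eqF e0) implybT. Qed.

(** With [b = e^beta], [S = sqrt (C1 / C2)] and [E = e^(1 - 3 beta)], one has
    [del^2 / b^6 = S * E], [e^2 / b^4 = E * e^(1 - beta)] and [e^2 / del <= E].
    As [n <= C2], [S * C2 = sqrt (C1 * C2)] and [1 <= sqrt (C1 * C2)], the
    left-hand side is at most [15/4 * (1 + 1/20) + 3/4 < 6] times [sqrt (C1 *
    C2) * E]. *)
Lemma tikhonov_parameters (beta C1 C2 e del n : R) :
  0 < beta -> beta < 1 / 3 -> 1 <= C2 -> C2 <= C1 -> 0 <= n -> n <= C2 ->
  0 < e -> e <= 1 -> e `^ (1 - beta) <= 1 / 20 ->
  del = (C1 / C2) `^ (1 / 4) * e `^ ((1 + 3 * beta) / 2) ->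
  [/\ 0 < del, e ^+ 2 <= del, e <= e `^ beta / 20 &
   15 / 4 * (del ^+ 2 / (e `^ beta) ^+ 6 + e ^+ 2 / (e `^ beta) ^+ 4) * n
     + 3 / (4 * del) * e ^+ 2
   <= 3 * (2 * Num.sqrt (C1 * C2) * e `^ (1 - 3 * beta))].
Proof.
move=> beta0 beta1 C21 C12 n0 nC2 e0 e1 e20 delE.
have C20 : 0 < C2 by lra.
have C10 : 0 < C1 by lra.
have C120 : 0 <= C1 / C2 by rewrite divr_ge0// ltW.
pose E1 := e `^ (1 - 3 * beta); pose x := e `^ (1 - beta); pose b := e `^ beta.
have E10 : 0 < E1 by exact: powR_gt0.
have b0 : 0 < b by exact: powR_gt0.
have x0 : 0 < x by exact: powR_gt0.
have bn k : b ^+ k = e `^ (beta * k%:R) by rewrite /b -powR_mulrn ?powR_ge0// -powRrM.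
have en k : e ^+ k = e `^ k%:R by rewrite powR_mulrn// ltW.
pose S := Num.sqrt (C1 / C2); pose Q := Num.sqrt (C1 * C2).
have S0 : 0 <= S by exact: sqrtr_ge0.
have SQ : S * C2 = Q.
  rewrite /S /Q -{2}[C2]ger0_norm ?(ltW C20)// -sqrtr_sqr -sqrtrM//.
  by congr Num.sqrt; field; rewrite gt_eqF.
have QC2 : C2 <= Q.
  rewrite -{1}[C2]ger0_norm ?(ltW C20)// -sqrtr_sqr ler_sqrt; last exact: mulr_ge0 (ltW C10) (ltW C20).
  by rewrite expr2 ler_pM2r.
have del2 : del ^+ 2 = S * (e `^ (1 + 3 * beta)).
  rewrite delE exprMn; congr (_ * _).
    rewrite -powR_mulrn ?powR_ge0// -powRrM /S -powR12_sqrt//; congr (_ `^ _); lra.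
  by rewrite -powR_mulrn ?powR_ge0// -powRrM; congr (_ `^ _); lra.
have t1 : del ^+ 2 / b ^+ 6 = S * E1.
  rewrite del2 bn; apply: (@mulIf _ (e `^ (beta * 6))); first by rewrite gt_eqF// powR_gt0.
  rewrite divfK; last by rewrite gt_eqF// powR_gt0.
  by rewrite -mulrA powR_mulD//; congr (_ * _ `^ _); ring.
have t2 : e ^+ 2 / b ^+ 4 = E1 * x.
  rewrite en bn; apply: (@mulIf _ (e `^ (beta * 4))); first by rewrite gt_eqF// powR_gt0.
  rewrite divfK; last by rewrite gt_eqF// powR_gt0.
  by rewrite !powR_mulD//; congr (_ `^ _); ring.
have delge : e `^ ((1 + 3 * beta) / 2) <= del.
  rewrite delE ler_peMl ?powR_ge0//.
  have a1 : 1 <= C1 / C2 by rewrite ler_pdivlMr// mul1r.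
  have q0 : 0 <= 1 / 4 :> R by lra.
  by have := ler_powR a1 q0; rewrite powRr0.
have del0 : 0 < del by apply: lt_le_trans delge; exact: powR_gt0.
have e01 : 0 < e <= 1 by rewrite e0.
have t3 : e ^+ 2 <= E1 * del.
  have -> : e ^+ 2 = E1 * e `^ (1 + 3 * beta).
    by rewrite en powR_mulD//; congr (_ `^ _); ring.
  rewrite ler_pM2l//; apply: le_trans delge; apply: ger_powR => //; lra.
have E11 : E1 <= 1.
  by rewrite -(powRr0 e); apply: ger_powR => //; lra.
split => //.
- by apply: (le_trans t3); rewrite ler_piMl// ltW.
- have eb : e = b * x.
    by rewrite powR_mulD// -[LHS]powRr1 ?ltW//; congr (_ `^ _); ring.
  rewrite -/b [leLHS]eb ler_pM2l//; move: e20; rewrite -/x; lra.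
rewrite -/b t1 t2 -/E1 -/Q.
have t4 : 3 / (4 * del) * e ^+ 2 <= 3 / 4 * E1.
  rewrite [leLHS](_ : _ = 3 / 4 * (e ^+ 2 / del)); last by field; rewrite gt_eqF.
  by rewrite ler_wpM2l// ler_pdivrMr.
have t5 : S * n <= Q by rewrite -SQ ler_wpM2l.
have t6 : x * n <= Q / 20.
  apply: (@le_trans _ _ (1 / 20 * C2)); first by apply: ler_pM => //; exact: ltW.
  lra.
have t7 : (S * n + x * n) * E1 <= (Q + Q / 20) * E1 by rewrite ler_wpM2r ?(ltW E10)// lerD.
have t8 : E1 <= Q * E1 by rewrite ler_peMl ?(ltW E10)//; lra.
rewrite [X in X + _ <= _](_ : _ = 15 / 4 * ((S * n + x * n) * E1)); last by ring.
have -> : 3 * (2 * Q * E1) = 6 * (Q * E1) by ring.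
have e3 : (Q + Q / 20) * E1 = 21 / 20 * (Q * E1) by field.
rewrite e3 in t7.
move: t4 t7 t8; move: (3 / (4 * del) * _) ((S * n + _) * E1) (Q * E1) => y z w; lra.
Qed.

End regularization_error.

Theorem theorem1 (R : realType) (beta : R)
    (hbeta0 : 0 < beta) (hbeta1 : beta < 1 / 3)
    (phi0 g0 f0 : R -> R[i])
    (hphi0 : in_CLp 1%E phi0) (hg0 : in_CLp 2%:E g0) (hf0 : in_CLp 2%:E f0)
    (hsol : {ae (@lebesgue_measure R), forall t, convolution phi0 f0 t = g0 t})
    (C1 C2 : R)
    (hC1 : C1 = 4 * (1 + fine (CLnorm 2%:E g0) ^+ 2
                       + fine (CLnorm 1%E phi0) ^+ 2))
    (hC2 : C2 = 1 + fine (CLnorm 2%:E g0) ^+ 2)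
    (phi g f : R -> R -> R[i]) (delta : R -> R)
    (hdelta : forall e, delta e = (C1 / C2) `^ (1 / 4) * e `^ ((1 + 3 * beta) / 2))
    (hphi : \forall e \near 0^'+, in_CLp 1%E (phi e))
    (hg : \forall e \near 0^'+, in_CLp 2%:E (g e))
    (hclose : \forall e \near 0^'+,
      (Order.max (CLnorm 1%E (fun x => (phi0 x - phi e x)%R))
                 (CLnorm 2%:E (fun x => (g0 x - g e x)%R)) <= e%:E)%E)
    (hf : \forall e \near 0^'+, in_CLp 2%:E (f e))
    (hfhat : \forall e \near 0^'+, {ae (@lebesgue_measure R), forall l,
      fourierL2 (f e) l =
      fourierL2 (g e) l * conjc (fourier (phi e) l)
        / real_complex R (delta e + Normc.normc (fourier (phi e) l) ^+ 2)})
    (Reps : R -> R)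
    (hReps_gt0 : \forall e \near 0^'+, 0 < Reps e)
    (hReps : Reps e @[e --> 0^'+] --> +oo) :
  \forall e \near 0^'+,
    (CLnorm 2%:E (fun x => (f0 x - f e x)%R) ^+ 2 <=
     3%:E *
      (\int[@lebesgue_measure R]_(l in
          [set l | (Reps e < `|l|)%R
                   /\ (Normc.normc (fourier phi0 l) < e `^ beta)%R])
          ((Normc.normc (fourierL2 f0 l) ^+ 2)%R)%:E
       + \int[@lebesgue_measure R]_(l in
          [set l | (`|l| < Reps e)%R
                   /\ (Normc.normc (fourier phi0 l) < e `^ beta)%R])
          ((Normc.normc (fourierL2 f0 l) ^+ 2)%R)%:E
       + (2 * Num.sqrt (C1 * C2) * e `^ (1 - 3 * beta))%:E))%E.
Proof.
have ip0 := (in_CLp1P phi0).1 hphi0.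
have Lg0 := (in_CLp2P g0).1 hg0; have Lf0 := (in_CLp2P f0).1 hf0.
have C21 : 1 <= C2 by rewrite hC2 lerDl sqr_ge0.
have C12 : C2 <= C1.
  rewrite hC1 hC2; have := sqr_ge0 (fine (CLnorm 2%:E g0)); have := sqr_ge0 (fine (CLnorm 1%E phi0)).
  by move: (_ ^+ 2) (_ ^+ 2) => x y; lra.
near=> e.
have e0 : 0 < e by near: e; exact: nbhs_right_gt.
have e1 : e <= 1 by near: e; exact: nbhs_right_le.
have e20 : e `^ (1 - beta) <= 1 / 20.
  near: e; have b1 : 0 < 1 - beta by lra.
  have /cvgrPdist_le /(_ (1 / 20)) := powR_cvg0 b1.
  rewrite divr_gt0// => /(_ isT); apply: filterS => e.
  by rewrite sub0r normrN ger0_norm ?powR_ge0.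
have ip : cint (phi e) by apply/in_CLp1P; near: e.
have Lg : cL2 (g e) by apply/in_CLp2P; near: e.
have Lf : cL2 (f e) by apply/in_CLp2P; near: e.
have aeF : {ae (@lebesgue_measure R), forall l,
      fourierL2 (f e) l =
      fourierL2 (g e) l * conjc (fourier (phi e) l)
        / real_complex R (delta e + Normc.normc (fourier (phi e) l) ^+ 2)}.
  by near: e.
have : (Order.max (CLnorm 1%E (fun x => (phi0 x - phi e x)%R))
                 (CLnorm 2%:E (fun x => (g0 x - g e x)%R)) <= e%:E)%E.
  by near: e.
rewrite ge_max => /andP[clP clG].
have LGd := cL2B Lg0 Lg; have Lfd := cL2B Lf0 Lf.
have nG : nrm (fun x => g0 x - g e x) <= e by rewrite -lee_fin -CLnorm2_nrm.
have PP l : Normc.normc (fourier phi0 l - fourier (phi e) l) <= e.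
  rewrite -fourierB// -lee_fin; apply: le_trans clP; apply: normc_fourier_le.
  exact: cintB.
have FF0 := fourierL2P Lf0; have FG0 := fourierL2P Lg0.
have FF := fourierL2P Lf; have FG := fourierL2P Lg.
have [LF0 _] := (is_fourierL2P (fourierL2 f0) Lf0).1 FF0.
have [LG0 _] := (is_fourierL2P (fourierL2 g0) Lg0).1 FG0.
have [LF _] := (is_fourierL2P (fourierL2 (f e)) Lf).1 FF.
have [LG _] := (is_fourierL2P (fourierL2 (g e)) Lg).1 FG.
have n20 : 0 <= nrm g0 ^+ 2 by exact: sqr_ge0.
have nC2 : nrm g0 ^+ 2 <= C2 by rewrite hC2 lerDr.
have [del0 edel eb par] := tikhonov_parameters hbeta0 hbeta1 C21 C12 n20 nC2 e0 e1 e20 (hdelta e).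
have aeG := fourierL2_convolution ip0 Lf0 Lg0 hsol FF0 FG0.
have b0 : 0 < e `^ beta by exact: powR_gt0.
have := energy_tikhonov_le (Reps e) LF0 LF LG0 LG (cmeas_fourier ip0) del0 e0 b0 edel eb PP aeG aeF.
rewrite CLnorm2_sqr !energy_nrm//; last exact: cL2B.
have nF := is_fourierL2_nrm Lfd (is_fourierL2B Lf0 Lf FF0 FF).
have nGd := is_fourierL2_nrm LGd (is_fourierL2B Lg0 Lg FG0 FG).
have nG0 := is_fourierL2_nrm Lg0 FG0.
rewrite [nrm (fun l => fourierL2 f0 l - _)]nF [nrm (fun l => fourierL2 g0 l - _)]nGd [nrm (fourierL2 g0)]nG0.
set I1 := integral _ _ _; set I2 := integral _ _ _.
have I0 : (0 <= I1 + I2)%E.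
  by apply: adde_ge0; apply: integral_ge0 => l _; rewrite lee_fin sqr_ge0.
(* If the integrals are infinite there is nothing to prove. *)
case: (I1 + I2)%E I0 => [r| |] // r0; last by move=> _; rewrite addye// gt0_muley ?lte_fin// leey.
rewrite -!EFinM -!EFinD -?EFinM ?lee_fin !exprMn sqr_sqrtr; last by rewrite mulr_ge0// pi_ge0.
move: par; rewrite lee_fin in r0.
set k1 := 15 / 4 * _; set k2 := 3 / (4 * _); set q := 2 * Num.sqrt _ * _ => par main.
have k20 : 0 <= k2 by rewrite divr_ge0// mulr_ge0// ltW.
have h : k2 * nrm (fun x => g0 x - g e x) ^+ 2 <= k2 * e ^+ 2.
  by rewrite ler_wpM2l// lerXn2r// nnegrE ?nrm_ge0// ltW.
have pi2 := pi_ge2 R; have pi0 : 0 < 2 * pi :> R by rewrite mulr_gt0// pi_gt0.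
(* Of the factor [2 * pi] on both sides, the two integrals only need [8 <= 6 * pi]. *)
rewrite -(ler_pM2l pi0); apply: (le_trans main).
move: pi2 pi0 par h r0; clear.
move: (pi : R) (nrm g0 ^+ 2) (nrm (fun x => g0 x - g e x) ^+ 2) (e ^+ 2) q k1 k2 => p n d ee q k1 k2 p2 p0 par h r0.
have -> : 8 * r + (k1 * (2 * p * n) + k2 * (2 * p * d)) = 8 * r + 2 * p * (k1 * n + k2 * d) by ring.
have -> : 2 * p * (3 * (r + q)) = 2 * p * (3 * r) + 2 * p * (3 * q) by ring.
apply: lerD; first by nra.
by rewrite ler_pM2l//; lra.
Unshelve. all: by end_near. Qed.
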